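(* Let $m\in\mathbb N$ and let $h_1,\dots,h_m$ be distinct real numbers, independent of $n$. Let $\{\vec k_n\}_{n=0}^\infty\subset\mathbb Z_{\ge 0}^m$ be a path such that $|\vec k_n|=n$, $\vec k_{n+1}=\vec k_n+\vec e_{j_n}$ for some $j_n\in\{1,\dots,m\}$, and $\vec k_n/n\to\vec\nu=(\nu_1,\dots,\nu_m)$ as $n\to\infty$ for some $\vec\nu\in[0,1]^m$ with $|\vec \nu|=1$. For each $n$ let $\{x_j\}_{j=1}^n$ be the eigenvalues of a random $n\times n$ matrix from the Gaussian Unitary Ensemble with external source $H$, where $H$ is the $n\times n$ diagonal matrix whose eigenvalues $h_1,\dots,h_m$ have multiplicities given by $\vec k_n$. Then for any polynomial $f$ with real coefficients, $$\sum_{j=1}^n f(x_j)-\mathbb E\Big[\sum_{j=1}^n f(x_j)\Big]\longrightarrow N\Big(0,\sum_{\ell=1}^\infty \ell f_\ell f_{-\ell}\Big)$$ in distribution as $n\to\infty$, where for $\ell\in\mathbb Z$ $$f_\ell=\frac1{2\pi i}\oint_\gamma f\Big(z+\sum_{j=1}^m\frac{\nu_j}{z-h_j}\Big)\frac{dz}{z^{\ell+1}}$$ and $\gamma$ is a simple closed contour with counter-clockwise orientation going around all the points $h_1,\dots,h_m$ and around the origin.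
   Context: Notation: $|\vec k|=k_1+\dots+k_m$; $\vec e_1,\dots,\vec e_m$ is the standard basis of $\mathbb R^m$; $N(0,\sigma^2)$ is the normal law with mean $0$ and variance $\sigma^2$. The Gaussian Unitary Ensemble with external source $H$ (a real diagonal $n\times n$ matrix) is the probability measure on $n\times n$ Hermitian matrices $M$ proportional to $e^{-n\operatorname{Tr}(\frac12M^2-HM)}\,dM$, where $dM$ is Lebesgue measure on the (independent real) entries. *)

(* Defs.v *)
From HB Require Import structures.
From mathcomp Require Import all_boot all_order all_algebra.
From mathcomp Require Import complex.
From mathcomp Require Import all_classical all_reals all_analysis.

Set Implicit Arguments.
Unset Strict Implicit.
Unset Printing Implicit Defensive.

Import Order.TTheory GRing.Theory Num.Theory.
Import numFieldTopology.Exports numFieldNormedType.Exports.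

Local Open Scope classical_set_scope.
Local Open Scope ring_scope.
Local Open Scope complex_scope.

Lemma pushforward_prod_sigma_finite d1 d2 d3 (R : realType)
    (T1 : measurableType d1) (T2 : measurableType d2) (T3 : measurableType d3)
    (m1 : {sigma_finite_measure set T1 -> \bar R})
    (m2 : {sigma_finite_measure set T2 -> \bar R})
    (f : T1 * T2 -> T3) (g : T3 -> T1 * T2) :
  measurable_fun setT f -> measurable_fun setT g -> cancel f g ->
  {mu : {sigma_finite_measure set T3 -> \bar R} |
    pushforward (m1 \x m2)%E f = mu :> (set _ -> \bar R)}.
Proof.
move=> mf mg fK.
pose pm : {measure set T3 -> \bar R} := pushforward (m1 \x m2)%E f.
pose p := pm mf.
have pE : (p : set T3 -> \bar R) = pushforward (m1 \x m2)%E f by [].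
have sp : sigma_finite setT p.
  have /sigma_finiteP[A [AT ndA Aoo]] := sigma_finiteT m1.
  have /sigma_finiteP[B [BT ndB Boo]] := sigma_finiteT m2.
  exists (fun n => g @^-1` (A n `*` B n)).
    rewrite -preimage_bigcup; apply/seteqP; split=> // z _ /=.
    have [i _ Ai] : (\bigcup_n A n) (g z).1 by rewrite -AT.
    have [j _ Bj] : (\bigcup_n B n) (g z).2 by rewrite -BT.
    exists (maxn i j) => //; split.
      by move: Ai; apply/subsetPset/ndA/leq_maxl.
    by move: Bj; apply/subsetPset/ndB/leq_maxr.
  move=> n; have [mA fA] := Aoo n; have [mB fB] := Boo n.
  have mAB : measurable (A n `*` B n) by exact: measurableX.
  split; first by rewrite -[X in measurable X]setTI; exact: mg.
  rewrite pE /pushforward -comp_preimage.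
  rewrite (_ : _ \o _ = id); last by apply/funext => x; exact: fK.
  by rewrite preimage_id product_measure1E// lte_mul_pinfty// ge0_fin_numE.
pose s := Measure_isSigmaFinite.Build _ _ _ p sp.
pose q : {sigma_finite_measure set T3 -> \bar R} :=
  HB.pack (p : set T3 -> \bar R) p s.
by exists q.
Qed.

Arguments pushforward_prod_sigma_finite {d1 d2 d3 R T1 T2 T3} m1 m2 {f g}.

Section LebesgueTuple.
Variable R : realType.
Local Notation TR := (measurableTypeR R).

Definition cons_pair N (p : (TR * N.-tuple TR)%type) : N.+1.-tuple TR :=
  [tuple of p.1 :: p.2].

Definition uncons_pair N (t : N.+1.-tuple TR) : (TR * N.-tuple TR)%type :=
  (thead t, [tuple of behead t]).

Lemma cons_pairK N : cancel (@cons_pair N) (@uncons_pair N).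
Proof. by case=> x t; rewrite /uncons_pair /= theadE; congr pair; apply: val_inj. Qed.

Lemma measurable_cons_pair N : measurable_fun setT (@cons_pair N).
Proof. exact: measurable_cons. Qed.

Lemma measurable_uncons_pair N : measurable_fun setT (@uncons_pair N).
Proof.
apply: measurable_fun_pair; first exact: measurable_tnth.
exact: measurable_behead.
Qed.

(* Lebesgue measure on R^N, as an iterated product measure. *)
Fixpoint lebesgue_tuple (N : nat) : set (N.-tuple TR) -> \bar R :=
  if N is N'.+1 then
    pushforward (@lebesgue_measure R \x @lebesgue_tuple N')%E (@cons_pair N')
  else \d_ ([tuple] : 0.-tuple TR).

Lemma lebesgue_tuple_measure N :
  {mu : {sigma_finite_measure set (N.-tuple TR) -> \bar R} |
    @lebesgue_tuple N = mu :> (set _ -> \bar R)}.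
Proof.
elim: N => [|N [mu IH]] /=; first by eexists (\d_ _).
rewrite IH.
have [nu nuE] := pushforward_prod_sigma_finite (@lebesgue_measure R) mu
  (@measurable_cons_pair N) (@measurable_uncons_pair N) (@cons_pairK N).
by exists nu; rewrite -nuE.
Qed.

Let lt0 N : @lebesgue_tuple N set0 = 0%E.
Proof. by case: (lebesgue_tuple_measure N) => mu ->; rewrite measure0. Qed.
Let lt_ge0 N A : (0 <= @lebesgue_tuple N A)%E.
Proof. by case: (lebesgue_tuple_measure N) => mu ->; rewrite measure_ge0. Qed.
Let lt_sigma N : semi_sigma_additive (@lebesgue_tuple N).
Proof.
by case: (lebesgue_tuple_measure N) => mu ->; exact: measure_semi_sigma_additive.
Qed.
HB.instance Definition _ N :=
  isMeasure.Build _ _ _ (@lebesgue_tuple N) (@lt0 N) (@lt_ge0 N) (@lt_sigma N).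

Let lt_sigma_finite N : sigma_finite setT (@lebesgue_tuple N).
Proof. by case: (lebesgue_tuple_measure N) => mu ->; exact: sigma_finiteT. Qed.
HB.instance Definition _ N :=
  Measure_isSigmaFinite.Build _ _ _ (@lebesgue_tuple N) (@lt_sigma_finite N).

End LebesgueTuple.

Section ExternalSource.
Variable R : realType.

(* The n^2 independent real entries of a Hermitian matrix M are packed in a real
   matrix X: M i i = X i i, and 'Re (M i j) = X i j, 'Im (M i j) = X j i for i < j. *)
Definition hermitian_of_coords n (t : (n * n).-tuple (measurableTypeR R)) :
    'M[R[i]]_n :=
  let X : 'M[R]_n := vec_mx (\row_k tnth t k) in
  \matrix_(i, j)
    if (i < j)%N then X i j +i* X j i
    else if (j < i)%N then X j i -i* X i j
    else (X i i)%:C.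

(* The trace is real, as both H and M are Hermitian. *)
Definition source_weight n (H M : 'M[R[i]]_n) : R :=
  expR (- (n%:R * complex.Re (\tr (2^-1 *: (M *m M) - H *m M)))).

Definition gue_external_source n (H : 'M[R[i]]_n) d (Omega : measurableType d)
    (P : probability Omega R) (M : Omega -> 'M[R[i]]_n) : Prop :=
  exists2 T : {mfun Omega >-> (n * n).-tuple (measurableTypeR R)},
    M =1 (fun w => hermitian_of_coords (T w)) &
    exists2 c : R, 0 < c &
      forall A, measurable A -> distribution P T A =
        (c%:E * \int[@lebesgue_tuple R (n * n)]_(t in A)
                  (source_weight H (hermitian_of_coords t))%:E)%E.

Definition are_eigenvalues n (A : 'M[R[i]]_n) (x : 'I_n -> R) : Prop :=
  char_poly A = \prod_(i < n) ('X - ((x i)%:C)%:P).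

End ExternalSource.

Section ConvergenceInDistribution.
Variable R : realType.

(* normal_prob takes the standard deviation, and normal_prob 0 0 is not the point
   mass at 0. *)
Definition centered_normal (s2 : R) : probability (measurableTypeR R) R :=
  if s2 == 0 then \d_ (0 : measurableTypeR R) : probability _ R
  else normal_prob 0 (Num.sqrt s2) : probability _ R.

Definition cvg_in_distribution (d : nat -> measure_display)
    (Omega : forall n, measurableType (d n))
    (P : forall n, probability (Omega n) R) (X : forall n, Omega n -> R)
    (mu : probability (measurableTypeR R) R) : Prop :=
  (forall n, measurable_fun setT (X n)) /\
  forall g : R -> R, continuous g -> (exists B, forall x, `|g x| <= B) ->
    (\int[P n]_w (g (X n w))%:E)%E @[n --> \oo] --> (\int[mu]_x (g x)%:E)%E.

End ConvergenceInDistribution.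

Section Contours.
Variable R : realType.
Implicit Types (gamma : R -> R[i]) (F : R[i] -> R[i]).

Definition piecewise_C1 (u : R -> R) : Prop :=
  exists2 s : seq R, itv_partition 0 1 s &
    forall i, (i < size s)%N ->
      exists g : R -> R,
        [/\ forall t, derivable g t 1, continuous (derive1 g) &
            {in `[nth 0 (0 :: s) i, nth 0 s i], u =1 g}].

Definition simple_closed_contour gamma : Prop :=
  [/\ piecewise_C1 (@complex.Re R \o gamma), piecewise_C1 (@complex.Im R \o gamma),
      gamma 0 = gamma 1 & {in `[0, 1[ &, injective gamma}].

Definition contour_velocity gamma (t : R) : R[i] :=
  derive1 (@complex.Re R \o gamma) t +i* derive1 (@complex.Im R \o gamma) t.

Definition contour_integral gamma F : R[i] :=
  let G t := F (gamma t) * contour_velocity gamma t in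
  (\int[@lebesgue_measure R]_(t in `[0, 1]) complex.Re (G t)) +i*
  (\int[@lebesgue_measure R]_(t in `[0, 1]) complex.Im (G t)).

Definition two_pi_i : R[i] := 0 +i* (2 * pi).

(* The winding number of gamma around p is 1: for a simple closed contour, p is
   enclosed and gamma is positively oriented. *)
Definition ccw_around gamma (p : R[i]) : Prop :=
  {in `[0, 1], forall t, gamma t != p} /\
  contour_integral gamma (fun z => (z - p)^-1) = two_pi_i.

Definition fourier_coef m (h nu : 'I_m -> R) (f : {poly R}) gamma (l : int) : R[i] :=
  two_pi_i^-1 *
  contour_integral gamma (fun z =>
    (map_poly (real_complex R) f).[z + \sum_(j < m) (nu j)%:C / (z - (h j)%:C)]
    / z ^ (l + 1)).

End Contours.

(* Main.v *)
Require Import Defs.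
From HB Require Import structures.
From mathcomp Require Import all_boot all_order all_algebra.
From mathcomp Require Import complex.
From mathcomp Require Import all_classical all_reals all_analysis.
From mathcomp Require Import measurable_realfun spectral.
From mathcomp Require Import -(notations) mpoly.
From mathcomp Require Import ring lra zify.

(** Write [H] for the source and [w z = z + \sum_j nu j / (z - h j)]. The proof computes
  all the limiting moments of the linear statistic and recognizes those of a normal law.

  In its real coordinates [M] is a vector of independent Gaussian variables, so that the
  expectation of a polynomial in its entries is an explicit linear functional on
  polynomials ([gue_expectE]) that obeys integration by parts ([gue_ibp]). Applied to the
  mixed traces [T p q] of [H ^+ p * M ^+ q], integration by parts gives loop equations
  ([matrix_loop_eq]), which express the expectation of [T p q.+1 * x] by [T p.+1 q], by
  products of two traces of lower degree in [M], and by a derivation of [x].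

  All limits follow from these equations by induction on the degree in [M]. First, the
  joint moments of the centered traces are bounded ([bdd_centered]): after centering, the
  products of two expectations cancel. Hence expectations of products factorize to leading
  order, and the normalized traces converge ([cvg_word]). The limits are the integrals
  against the law of the source of polynomials [Q q] ([free_appell]), where [Q q] at [t] is
  the limiting conditional expectation of [M ^+ q] where [H] takes the value [t]. At the
  next order, the expectation of a centered trace times a power [Y ^+ r] of the centered
  statistic tends to [r] times a covariance times the limiting moment of [Y ^+ r.-1]
  ([cvg_centered_pow]), which is the recursion of the moments of a normal law
  ([cvg_moment_lin_stat]).

  The variance rests on one fact about rational functions: [Q q] is the polynomial part of
  [w ^+ q * w'], and the rest of it is a sum of polar parts with residue 0
  ([free_appell_polar]). On the one hand, it solves the recursion of the covariances
  ([source_int_cov_poly]) in terms of the residues of [Q q] times [f \o w]. On the other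
  hand, let [G] be the polynomial part of the derivative of [f \o w]. Integration by parts
  along the contour identifies [l] times the [l]-th Fourier coefficient with the
  coefficient of degree [l - 1] of [G] ([residue_pole_test]), so that the series of the
  theorem is a finite sum, equal to the residue of [G] times [f \o w]
  ([res_test_deriv_test_coef]); this is the variance. Only rational functions are
  integrated, so that Cauchy's theorem reduces to the fundamental theorem of calculus along
  the contour ([contour_integral_derive]) and to the winding number hypotheses.

  Finally, convergence of moments implies convergence in distribution
  ([cvg_in_distribution_moments]): the moments of a normal law grow slowly enough for the
  Taylor expansions of sines and cosines to be integrated, and polynomials in
  [sin (a * x)] approximate a bounded continuous function on a large segment while staying
  bounded elsewhere ([cvg_int_bounded]). *)

Set Implicit Arguments.
Unset Strict Implicit.
Unset Printing Implicit Defensive.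

Import Order.TTheory GRing.Theory Num.Theory.
Import numFieldTopology.Exports numFieldNormedType.Exports.

Local Open Scope classical_set_scope.
Local Open Scope ring_scope.
Local Open Scope complex_scope.


(** * Convolution of sequences *)

Section Convolution.
Variable A : comNzRingType.
Implicit Types a b c : nat -> A.

Definition conv a b (q : nat) : A := \sum_(i < q) a i * b (q - i.+1)%N.

Lemma conv0 a b : conv a b 0 = 0. Proof. by rewrite /conv big_ord0. Qed.

Lemma convS a b q : conv a b q.+1 = a 0%N * b q + conv (fun i => a i.+1) b q.
Proof.
rewrite /conv big_ord_recl /= subSS subn0; congr (_ + _).
Qed.

Lemma eq_conv a a' b b' q :
  (forall i, (i < q)%N -> a i = a' i) -> (forall i, (i < q)%N -> b i = b' i) ->
  conv a b q = conv a' b' q.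
Proof.
move=> ha hb; apply: eq_bigr => i _; rewrite ha ?hb//.
by have := ltn_ord i; lia.
Qed.

Lemma convC a b q : conv a b q = conv b a q.
Proof.
rewrite /conv (reindex_inj rev_ord_inj) /=; apply: eq_bigr => i _.
by rewrite mulrC; congr (b _ * a _); have := ltn_ord i; lia.
Qed.

Lemma convDl a b c q : conv (fun i => a i + b i) c q = conv a c q + conv b c q.
Proof. by rewrite /conv -big_split; apply: eq_bigr => i _; rewrite mulrDl. Qed.

Lemma convDr a b c q : conv c (fun i => a i + b i) q = conv c a q + conv c b q.
Proof. by rewrite /conv -big_split; apply: eq_bigr => i _; rewrite mulrDr. Qed.

Lemma convMl x a b q : conv (fun i => x * a i) b q = x * conv a b q.
Proof. by rewrite /conv mulr_sumr; apply: eq_bigr => i _; rewrite mulrA. Qed.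

Lemma convMr x a b q : conv a (fun i => x * b i) q = x * conv a b q.
Proof. by rewrite convC convMl convC. Qed.

Lemma convA a b c q : conv a (conv b c) q = conv (conv a b) c q.
Proof.
elim: q a => [|q IH] a; first by rewrite !conv0.
rewrite !convS conv0 mul0r add0r IH.
rewrite (@eq_conv (fun i => conv a b i.+1)
  (fun i => a 0%N * b i + conv (fun i => a i.+1) b i) c c)//; last first.
  by move=> i _; rewrite convS.
by rewrite convDl convMl.
Qed.

(** On generating series [\sum_q a q * x ^ (- q - 1)], [conv] is the product and
  [index_deriv] is the derivation [- d/dx]. *)
Definition index_deriv a (q : nat) : A := q%:R * a q.-1.

Lemma index_deriv_conv a b q :
  index_deriv (conv a b) q = conv (index_deriv a) b q + conv a (index_deriv b) q.
Proof.
case: q => [|q]; first by rewrite /index_deriv mul0r !conv0 addr0.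
rewrite /index_deriv /=.
have -> : conv (index_deriv a) b q.+1 = \sum_(i < q) i.+1%:R * (a i * b (q - i.+1)%N).
  rewrite convS /index_deriv /= !mul0r add0r; apply: eq_bigr => i _.
  by rewrite mulrA.
have -> : conv a (index_deriv b) q.+1 =
    \sum_(i < q) (q - i)%:R * (a i * b (q - i.+1)%N).
  rewrite /conv big_ord_recr /= subnn /index_deriv /= mul0r mulr0 addr0.
  apply: eq_bigr => i _; rewrite subSS mulrCA; congr (_ * (_ * b _)).
  by have := ltn_ord i; lia.
rewrite -big_split /= /conv mulr_sumr; apply: eq_bigr => i _.
by rewrite -mulrDl -natrD; congr (_%:R * _); have := ltn_ord i; lia.
Qed.

(** Variation of constants: [Q] is the fundamental solution of the linear recursion, and
  the generating series of [Z] is the product of those of [Q] and of the source term. *)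
Lemma conv_resolvent (x : A) (phi Q V Z : nat -> A) :
  Q 0%N = 1 -> (forall q, Q q.+1 = x * Q q + conv phi Q q) ->
  Z 0%N = 0 -> (forall q, Z q.+1 = x * Z q + conv phi Z q + V q) ->
  forall q, Z q = conv Q V q.
Proof.
move=> Q0 QS Z0 ZS; elim/ltn_ind => -[|q] IH; first by rewrite conv0.
rewrite ZS IH// (@eq_conv phi phi Z (conv Q V))//; last first.
  by move=> i iq; apply: IH; exact: ltn_trans iq _.
rewrite convS Q0 mul1r.
rewrite (@eq_conv (fun i => Q i.+1) (fun i => x * Q i + conv phi Q i) V V)//.
rewrite convDl convMl convA; ring.
Qed.

End Convolution.

(** * The recursions satisfied by the limits *)

Section FreeAppell.
Variables (F : fieldType) (m : nat) (h nu : 'I_m -> F).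
Implicit Types (P : {poly F}) (f : {poly F}).

(** Integration against the limiting law of the source. *)
Definition source_int P : F := \sum_(j < m) nu j * P.[h j].

(** The difference quotient of [P], integrated in one of its two variables. *)
Definition source_quot P : {poly F} :=
  \sum_(j < m) nu j *: (P %/ ('X - (h j)%:P)).

(** [free_appell q] is the conditional expectation of the [q]-th power of the limiting
  matrix given the source, as a polynomial in the source. *)
Fixpoint free_appell (q : nat) : {poly F} :=
  if q is q'.+1 then 'X * free_appell q' + source_quot (free_appell q') else 1.

Local Notation L := source_int.
Local Notation Lam := source_quot.
Local Notation Q := free_appell.
Local Notation phi := (fun q => (L (Q q))%:P).

Lemma source_intD P1 P2 : L (P1 + P2) = L P1 + L P2.
Proof. by rewrite /L -big_split; apply: eq_bigr => j _; rewrite hornerD mulrDr. Qed.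

Lemma source_intZ c P : L (c *: P) = c * L P.
Proof. by rewrite /L mulr_sumr; apply: eq_bigr => j _; rewrite hornerZ mulrCA. Qed.

Lemma source_int0 : L 0 = 0.
Proof. by rewrite -(scale0r 0) source_intZ mul0r. Qed.

Lemma source_int_sum (I : Type) (r : seq I) (G : I -> {poly F}) :
  L (\sum_(i <- r) G i) = \sum_(i <- r) L (G i).
Proof. by apply: (big_morph L source_intD source_int0). Qed.

Lemma source_quotD P1 P2 : Lam (P1 + P2) = Lam P1 + Lam P2.
Proof. by rewrite /Lam -big_split; apply: eq_bigr => j _; rewrite divpD scalerDr. Qed.

Lemma source_quotZ c P : Lam (c *: P) = c *: Lam P.
Proof.
rewrite /Lam scaler_sumr; apply: eq_bigr => j _.
by rewrite divpZl !scalerA mulrC.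
Qed.

Lemma source_quot0 : Lam 0 = 0.
Proof. by have := source_quotZ 0 0; rewrite !scale0r. Qed.

Lemma source_quot_sum (I : Type) (r : seq I) (G : I -> {poly F}) :
  Lam (\sum_(i <- r) G i) = \sum_(i <- r) Lam (G i).
Proof. by apply: (big_morph Lam source_quotD source_quot0). Qed.

Lemma divp_XsubC_mulX (a : F) P :
  ('X * P) %/ ('X - a%:P) = 'X * (P %/ ('X - a%:P)) + (P.[a])%:P.
Proof.
have Xa0 : 'X - a%:P != 0 by rewrite -size_poly_eq0 size_XsubC.
have E : 'X * P = ('X * (P %/ ('X - a%:P)) + (P.[a])%:P) * ('X - a%:P)
    + (a * P.[a])%:P.
  rewrite [in LHS](divp_eq P ('X - a%:P)) modp_XsubC polyCM; ring.
rewrite E divpD mulpK// (divp_small (p := (a * P.[a])%:P)) ?addr0//.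
by rewrite size_XsubC (leq_ltn_trans (size_polyC_leq1 _)).
Qed.

Lemma source_quot_mulX P : Lam ('X * P) = 'X * Lam P + (L P)%:P.
Proof.
rewrite /Lam /L mulr_sumr rmorph_sum -big_split; apply: eq_bigr => j _ /=.
rewrite divp_XsubC_mulX scalerDr -scalerAr; congr (_ + _).
by rewrite -mul_polyC -polyCM.
Qed.

(** The free difference quotient of a power splits it in two, hence the convolution. *)
Lemma source_quot_appell q : Lam (Q q) = conv phi Q q.
Proof.
elim/ltn_ind: q => -[|q] IH.
  rewrite conv0 /= /Lam big1// => j _.
  by rewrite divp_small ?scaler0// size_XsubC size_poly1.
have -> : Lam (Q q.+1) =
    'X * conv phi Q q + (L (Q q))%:P + conv phi (fun i => Lam (Q i)) q.
  rewrite [Q q.+1]/= source_quotD source_quot_mulX (IH q)//; congr (_ + _).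
  rewrite {1}/conv source_quot_sum; apply: eq_bigr => i _.
  by rewrite !mul_polyC source_quotZ.
rewrite [RHS]convC convS mul1r [in RHS]convC.
rewrite (@eq_conv _ phi phi (fun i => Q i.+1) (fun i => 'X * Q i + Lam (Q i)))//.
by rewrite convDr convMr; ring.
Qed.

Lemma free_appellS q : Q q.+1 = 'X * Q q + conv phi Q q.
Proof. by rewrite -source_quot_appell. Qed.

Lemma deriv_free_appell q : (Q q)^`() = conv Q Q q.
Proof.
apply: (@conv_resolvent _ 'X phi Q Q (fun q => (Q q)^`())) => //.
- exact: free_appellS.
- by rewrite /= derivC.
move=> {}q; rewrite free_appellS derivD derivM derivX mul1r.
have -> : (conv phi Q q)^`() = conv phi (fun i => (Q i)^`()) q.
  rewrite /conv (big_morph (@deriv F) (@derivD F) (@deriv0 F)).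
  by apply: eq_bigr => i _; rewrite derivM derivC mul0r add0r.
ring.
Qed.

Local Notation e := (fun q => (L (index_deriv Q q))%:P).

Lemma source_int_index_deriv q : e q = index_deriv phi q.
Proof.
by rewrite /index_deriv !mulr_natl -scaler_nat source_intZ mulr_natl polyCMn.
Qed.

(** The generating series of [Q] is the resolvent [1 / (s x - t)], with [s] the
  subordination function; its derivatives in [x] and in [t] agree up to the factor
  [- s' x], and [e] is the series of [s' x - 1]. *)
Lemma index_deriv_free_appell q :
  index_deriv Q q = (Q q)^`() + conv e (fun i => (Q i)^`()) q.
Proof.
have -> : (Q q)^`() + conv e (fun i => (Q i)^`()) q
        = conv Q (fun i => Q i + conv e Q i) q.
  rewrite convDr -deriv_free_appell; congr (_ + _).
  rewrite (@eq_conv _ e e (fun i => (Q i)^`()) (conv Q Q))//; last first.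
    by move=> i _; exact: deriv_free_appell.
  by rewrite !convA; apply: eq_conv => // i _; exact: convC.
apply: (@conv_resolvent _ 'X phi) => //; first exact: free_appellS.
  by rewrite /index_deriv mul0r.
case=> [|{}q].
  by rewrite /index_deriv !conv0 /= mul0r mulr0 !addr0 add0r mulr1.
have -> : index_deriv Q q.+2 = index_deriv Q q.+1 * 'X + Q q.+1
    + index_deriv (conv phi Q) q.+1.
  rewrite /index_deriv /= -/(Q q.+1) free_appellS -!natr1; ring.
rewrite index_deriv_conv (@eq_conv _ (index_deriv phi) e Q Q)//; last first.
  by move=> i _; rewrite source_int_index_deriv.
ring.
Qed.

(** The limits of the normalized mixed traces of the source and of the matrix. *)
Definition lim_word (p q : nat) : F := L ('X^p * Q q).

Lemma lim_wordS p q : lim_word p q.+1 =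
  lim_word p.+1 q + \sum_(i < q) lim_word 0 i * lim_word p (q - i.+1).
Proof.
rewrite /lim_word free_appellS mulrDr source_intD mulrA -exprSr; congr (_ + _).
rewrite /conv mulr_sumr source_int_sum; apply: eq_bigr => i _.
by rewrite expr0 mul1r mul_polyC -scalerAr source_intZ.
Qed.

Variable f : {poly F}.
(** [res P] stands for the residue of [P] times the composition of [f] with the inverse
  of the subordination function. *)
Variables (res : {poly F} -> F).
Hypothesis resD : forall P1 P2, res (P1 + P2) = res P1 + res P2.
Hypothesis resZ : forall c P, res (c *: P) = c * res P.

(** The source term of the covariance recursion: a derivative of the test function [f]
  of the second trace, multiplied by the [q]-th power from the first one. *)
Definition cov_source (q : nat) : {poly F} :=
  \sum_(b < size f) (b%:R * f`_b) *: Q (q + b).-1.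

Hypothesis res_deriv : forall q,
  res (Q q)^`() = L (conv Q cov_source q).

Local Notation rho := (fun q => res (index_deriv Q q)).

(** The solution given by [conv_resolvent] of the recursion [cov_polyS], which is the limit
  of the loop equations for covariances. *)
Definition cov_poly (q : nat) : {poly F} :=
  conv Q (fun i => conv (fun j => (rho j)%:P) Q i + cov_source i) q.

Lemma source_int_convC (a : nat -> F) (B : nat -> {poly F}) q :
  L (conv (fun j => (a j)%:P) B q) = conv a (fun j => L (B j)) q.
Proof.
by rewrite /conv source_int_sum; apply: eq_bigr => i _; rewrite mul_polyC source_intZ.
Qed.

Lemma res_convC (a : nat -> F) (B : nat -> {poly F}) q :
  res (conv (fun j => (a j)%:P) B q) = conv a (fun j => res (B j)) q.
Proof.
have res0 : res 0 = 0 by have := resZ 0 0; rewrite scale0r mul0r.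
rewrite /conv (big_morph res resD res0).
by apply: eq_bigr => i _; rewrite mul_polyC resZ.
Qed.

(** The scalars [rho] enter the recursion [cov_polyS] as the unknown covariances of the
  traces of the powers of the matrix alone; this identity says that they are the right
  ones. Both sides solve the same linear equation, with resolvent [e]. *)
Lemma source_int_cov_poly q : L (cov_poly q) = rho q.
Proof.
pose a q := L ((Q q)^`()); pose d q := L (conv Q cov_source q).
pose e0 q := L (index_deriv Q q).
have eE i : e0 i = a i + conv e0 a i.
  by rewrite /e0 {1}index_deriv_free_appell source_intD source_int_convC.
have rhoE i : rho i = d i + conv e0 d i.
  rewrite /= {1}index_deriv_free_appell resD res_convC res_deriv.
  by congr (_ + _); apply: eq_conv => // j _; exact: res_deriv.
have -> : L (cov_poly q) = conv rho a q + d q.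
  rewrite /cov_poly convDr source_intD; congr (_ + _).
  rewrite convA (@eq_conv _ (conv Q _) (conv (fun j => (rho j)%:P) Q) Q Q)//; last first.
    by move=> i _; exact: convC.
  rewrite -convA source_int_convC; apply: eq_conv => // i _.
  by rewrite /a deriv_free_appell.
rewrite rhoE (@eq_conv _ rho (fun i => d i + conv e0 d i) a a)//.
rewrite convDl -convA (@eq_conv _ e0 e0 (conv d a) (conv a d))//; last first.
  by move=> i _; exact: convC.
rewrite convA (convC d) -convDl addrC; congr (_ + _).
by apply: eq_conv => // i _; rewrite eE.
Qed.

Lemma cov_polyS q : cov_poly q.+1 = 'X * cov_poly q + conv phi cov_poly q
  + (conv (fun j => (rho j)%:P) Q q + cov_source q).
Proof.
rewrite /cov_poly convS mul1r.
rewrite (@eq_conv _ (fun i => Q i.+1) (fun i => 'X * Q i + conv phi Q i)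
  (fun i => conv (fun j => (rho j)%:P) Q i + cov_source i)
  (fun i => conv (fun j => (rho j)%:P) Q i + cov_source i))//; last first.
  by move=> i _; exact: free_appellS.
rewrite convDl convMl.
rewrite (@eq_conv _ phi phi (fun q => conv Q _ q)
  (conv Q (fun i => conv (fun j => (rho j)%:P) Q i + cov_source i)))//.
rewrite convA; ring.
Qed.

(** The limits of the covariances of the mixed traces with the trace of [f]. *)
Definition lim_cov (p q : nat) : F := L ('X^p * cov_poly q).

Lemma lim_cov0q q : lim_cov 0 q = rho q.
Proof. by rewrite /lim_cov expr0 mul1r source_int_cov_poly. Qed.

Lemma lim_covp0 p : lim_cov p 0 = 0.
Proof. by rewrite /lim_cov /cov_poly conv0 mulr0 source_int0. Qed.

Lemma lim_covS p q : lim_cov p q.+1 = lim_cov p.+1 q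
  + \sum_(i < q) (lim_word 0 i * lim_cov p (q - i.+1)
                  + lim_cov 0 i * lim_word p (q - i.+1))
  + \sum_(b < size f) b%:R * f`_b * lim_word p (q + b).-1.
Proof.
rewrite {1}/lim_cov cov_polyS !mulrDr !source_intD mulrA -exprSr -!addrA.
congr (_ + _).
rewrite big_split /= -!addrA; congr (_ + (_ + _)).
- rewrite /conv mulr_sumr source_int_sum; apply: eq_bigr => i _.
  by rewrite /lim_word expr0 mul1r mul_polyC -scalerAr source_intZ.
- rewrite /conv mulr_sumr source_int_sum; apply: eq_bigr => i _.
  by rewrite lim_cov0q mul_polyC -scalerAr source_intZ.
- rewrite /cov_source mulr_sumr source_int_sum; apply: eq_bigr => b _.
  by rewrite -scalerAr source_intZ.
Qed.

End FreeAppell.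

(** * From loop equations to limits of moments *)

Section BoundedSequences.
Variable K : numFieldType.
Implicit Types u v : nat -> K.

Definition bounded_seq u := exists B, forall n, `|u n| <= B.

Lemma eq_bounded_seq u v : (forall n, u n = v n) -> bounded_seq v -> bounded_seq u.
Proof. by move=> uv [B vB]; exists B => n; rewrite uv. Qed.

Lemma bounded_seq_cst c : bounded_seq (fun=> c).
Proof. by exists `|c|. Qed.

Lemma bounded_seqD u v :
  bounded_seq u -> bounded_seq v -> bounded_seq (fun n => u n + v n).
Proof.
move=> [a ua] [b vb]; exists (a + b) => n.
by rewrite (le_trans (ler_normD _ _))// lerD.
Qed.

Lemma bounded_seqM u v :
  bounded_seq u -> bounded_seq v -> bounded_seq (fun n => u n * v n).
Proof. by move=> [a ua] [b vb]; exists (a * b) => n; rewrite normrM ler_pM. Qed.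

Lemma bounded_seqN u : bounded_seq u -> bounded_seq (fun n => - u n).
Proof. by move=> [a ua]; exists a => n; rewrite normrN. Qed.

Lemma bounded_seq_sum N (u : 'I_N -> nat -> K) :
  (forall i, bounded_seq (u i)) -> bounded_seq (fun n => \sum_(i < N) u i n).
Proof.
move=> bu; elim: N u bu => [|N IH] u bu.
  by exists 0 => n; rewrite big_ord0 normr0.
have -> : (fun n => \sum_(i < N.+1) u i n) =
    (fun n => u ord0 n + \sum_(i < N) u (lift ord0 i) n).
  by apply/funext => n; rewrite big_ord_recl.
by apply: bounded_seqD; [exact: bu | exact: IH].
Qed.

Lemma bounded_seq_inv : bounded_seq (fun n => n%:R^-1).
Proof.
exists 1 => -[|n]; first by rewrite invr0 normr0.
by rewrite normfV invf_le1 normr_nat ?ltr0n// ler1n.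
Qed.

Lemma bounded_cvg_seq u (l : K) : u n @[n --> \oo] --> l -> bounded_seq u.
Proof.
move=> ul.
have /(@cvgrPdist_lt K K^o)/(_ 1 ltr01)[N _ NP] := ul.
pose B := `|l| + 1 + \sum_(i < N) `|u i|.
have B0 : 0 <= \sum_(i < N) `|u i| by apply: sumr_ge0.
exists B => n; rewrite /B.
have [Nn|nN] := leqP N n.
  have := NP n Nn; rewrite /= distrC => unl.
  rewrite -[u n](subrK l) -[leLHS]addr0 lerD//.
  by rewrite (le_trans (ler_normD _ _))// addrC lerD// ltW.
rewrite -[leLHS]add0r lerD ?addr_ge0//.
by rewrite (bigD1 (Ordinal nN))//= lerDl sumr_ge0.
Qed.

Lemma cvg_invn_bounded u : (forall e : K, 0 < e -> \forall n \near \oo, n%:R^-1 < e) ->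
  bounded_seq u -> (n%:R^-1 * u n) @[n --> \oo] --> (0 : K).
Proof.
move=> arch [B uB]; apply/(@cvgrPdist_lt K K^o) => e e0.
have B0 : 0 <= B by exact: le_trans (uB 0%N).
near=> n; rewrite sub0r normrN normrM normfV normr_nat.
have : n%:R^-1 < e / (B + 1) by near: n; apply: arch; rewrite divr_gt0// ltr_wpDl.
rewrite ltr_pdivlMr ?ltr_wpDl// => /le_lt_trans; apply.
by rewrite ler_wpM2l ?invr_ge0// (le_trans (uB n))// lerDl.
Unshelve. all: by end_near. Qed.

Lemma cvg_sum_ord N (u : 'I_N -> nat -> K) (a : 'I_N -> K) :
  (forall i, u i n @[n --> \oo] --> a i) ->
  \sum_(i < N) u i n @[n --> \oo] --> \sum_(i < N) a i.
Proof.
elim: N u a => [|N IH] u a ua.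
  rewrite big_ord0 (_ : (fun n => _) = fun=> 0); first exact: cvg_cst.
  by apply/funext => n; rewrite big_ord0.
rewrite big_ord_recl (_ : (fun n => _) = fun n => u ord0 n + \sum_(i < N) u (lift ord0 i) n).
  by apply: (@cvgD K K^o); [exact: ua | apply: IH].
by apply/funext => n; rewrite big_ord_recl.
Qed.

End BoundedSequences.

Section LoopEquations.
Variables (K : numFieldType) (A : nat -> comAlgType K).
Hypothesis arch : forall e : K, 0 < e -> \forall n \near \oo, n%:R^-1 < e.
Variables (E : forall n, {scalar A n}) (T : forall n, nat -> nat -> A n).
Variable theta : forall n, nat -> nat -> A n -> A n.
Hypothesis E1 : forall n, E n 1 = 1.
Hypothesis thetaD : forall n p q x y,
  theta p q (x + y) = theta p q x + theta p q y :> A n.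
Hypothesis thetaZ : forall n p q c x, theta p q (c *: x) = c *: theta p q x :> A n.
Hypothesis thetaM : forall n p q x y,
  theta p q (x * y) = theta p q x * y + x * theta p q y :> A n.
Hypothesis theta_trace : forall n p q b,
  theta p q (T n 0 b) = b%:R *: T n p (q + b).-1.
Variable t : nat -> nat -> K.
Hypothesis traceH : forall n p, T n p 0 = (t n p)%:A.
Hypothesis loop_eq : forall n p q x,
  E n (T n p q.+1 * x) = E n (T n p.+1 q * x)
    + n%:R^-1 * \sum_(i < q) E n (T n 0 i * T n p (q - i.+1) * x)
    + n%:R^-1 * E n (theta p q x).
Variables (m : nat) (h nu : 'I_m -> K).
Hypothesis t_cvg : forall p,
  (n%:R^-1 * t n p) @[n --> \oo] --> source_int h nu 'X^p.

Definition centered n p q : A n := T n p q - (E n (T n p q))%:A.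
Local Notation X := centered.
Local Notation bdd := (@bounded_seq K).
Local Notation eT n p q := (n%:R^-1 * E n (T n p q)).

Lemma theta1 n p q : theta p q (1 : A n) = 0.
Proof.
have := thetaM p q (1 : A n) 1; rewrite !mulr1 mul1r.
by move/eqP; rewrite -subr_eq0 opprD addrA subrr sub0r oppr_eq0 => /eqP.
Qed.

Lemma theta_centered n p q b : theta p q (X n 0 b) = b%:R *: T n p (q + b).-1.
Proof. by rewrite thetaD theta_trace -scaleNr thetaZ theta1 scaler0 addr0. Qed.

Lemma E_alg n c x : E n (c%:A * x) = c * E n x.
Proof. by rewrite mulr_algl linearZ. Qed.

Lemma E_cst n c : E n c%:A = c.
Proof. by rewrite linearZ /= E1 mulr1. Qed.

Lemma E_centered n p q : E n (X n p q) = 0.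
Proof. by rewrite linearB /= E_cst subrr. Qed.

Lemma E_traceM n p q x :
  E n (T n p q * x) = E n (X n p q * x) + E n (T n p q) * E n x.
Proof. by rewrite mulrBl linearB /= E_alg subrK. Qed.

Lemma E_traceMM n i p j x :
  E n (T n 0 i * T n p j * x) = E n (X n p j * X n 0 i * x)
    + E n (T n 0 i) * E n (X n p j * x) + E n (T n p j) * E n (X n 0 i * x)
    + E n (T n 0 i) * E n (T n p j) * E n x.
Proof.
rewrite -mulrA E_traceM -[in LHS](subrK (E n (T n p j))%:A (T n p j)).
rewrite -/(X n p j) (mulrDl (X n p j)) mulrDr !linearD /=.
rewrite mulrCA (mulrCA _ (_%:A)) !E_alg mulrA; ring.
Qed.

Lemma centered_p0 n p : X n p 0 = 0.
Proof.
by rewrite /X traceH E_cst subrr.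
Qed.

(** Subtract [E n x] times the equation at [x = 1]: the leading terms, which are products
  of expectations, cancel. *)
Lemma loop_eq_centered n p q x :
  E n (X n p q.+1 * x) = E n (X n p.+1 q * x)
    + \sum_(i < q) (n%:R^-1 * (E n (X n p (q - i.+1) * X n 0 i * x)
                    - E n (X n p (q - i.+1) * X n 0 i) * E n x)
        + eT n 0 i * E n (X n p (q - i.+1) * x)
        + eT n p (q - i.+1) * E n (X n 0 i * x))
    + n%:R^-1 * E n (theta p q x).
Proof.
have H y : E n (X n p q.+1 * y) = E n (T n p q.+1 * y) - E n (T n p q.+1) * E n y.
  by rewrite E_traceM addrK.
have := loop_eq p q (1 : A n); rewrite !mulr1 theta1 linear0 mulr0 addr0 => L1.
rewrite H loop_eq L1 E_traceM.
set s1 := \sum_(i < q) E n (_ * x); set s2 := \sum_(i < q) E n (_ * 1).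
have -> : \sum_(i < q) (n%:R^-1 * (E n (X n p (q - i.+1) * X n 0 i * x)
                    - E n (X n p (q - i.+1) * X n 0 i) * E n x)
        + eT n 0 i * E n (X n p (q - i.+1) * x)
        + eT n p (q - i.+1) * E n (X n 0 i * x)) = n%:R^-1 * s1 - n%:R^-1 * s2 * E n x.
  rewrite -mulrA -mulrBr /s1 /s2 mulr_suml -sumrB mulr_sumr.
  apply: eq_bigr => i _; rewrite !E_traceMM E1 !mulr1 !E_centered; ring.
ring.
Qed.

(** By the Leibniz rule the derivation merges [T n p q] with one centered trace at a time,
  which lowers the total degree by one; [cs] collects the factors already passed. *)
Lemma bdd_loop_theta d p q cs bs :
  (forall p q bs, (q + sumn bs <= d)%N ->
     bdd (fun n => n%:R^-1 * E n (T n p q * \prod_(b <- bs) X n 0 b))) ->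
  (q + sumn cs + sumn bs <= d.+1)%N ->
  bdd (fun n => n%:R^-1 * E n (\prod_(c <- cs) X n 0 c *
                  theta p q (\prod_(b <- bs) X n 0 b))).
Proof.
move=> H; elim: bs cs => [|b bs IH] cs le_d.
  have -> : (fun n => n%:R^-1 * E n (\prod_(c <- cs) X n 0 c *
                  theta p q (\prod_(b <- [::]) X n 0 b))) = fun=> 0.
    by apply/funext => n; rewrite big_nil theta1 mulr0 linear0 mulr0.
  exact: bounded_seq_cst.
have -> : (fun n => n%:R^-1 * E n (\prod_(c <- cs) X n 0 c *
                  theta p q (\prod_(b <- b :: bs) X n 0 b))) =
   (fun n => b%:R * (n%:R^-1 * E n (T n p (q + b).-1 * \prod_(c <- cs ++ bs) X n 0 c))
     + n%:R^-1 * E n (\prod_(c <- b :: cs) X n 0 c *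
                  theta p q (\prod_(b <- bs) X n 0 b))).
  apply/funext => n; rewrite !big_cons big_cat /= thetaM theta_centered mulrDr.
  rewrite linearD mulrDr /= -scalerAl -scalerAr linearZ /= mulrCA.
  by congr (_ * (_ * E n _) + _ * E n _); ring.
apply: bounded_seqD; last by apply: IH; move: le_d => /=; lia.
case: b le_d => [|b] le_d.
  by rewrite [X in bdd X](_ : _ = fun=> 0);
    [exact: bounded_seq_cst | apply/funext => n; rewrite mul0r].
apply: bounded_seqM; first exact: bounded_seq_cst.
by apply: H; rewrite addnS /= sumn_cat; move: le_d => /=; lia.
Qed.

(** The loop equations bound all the joint moments of the centered traces, by induction
  on the total degree in the random matrix. *)
Lemma bdd_centered d : (forall p q, (q <= d)%N -> bdd (fun n => eT n p q)) /\
  (forall p q bs, (q + sumn bs <= d)%N ->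
    bdd (fun n => E n (X n p q * \prod_(b <- bs) X n 0 b))).
Proof.
have base p : bdd (fun n => eT n p 0).
  rewrite (_ : (fun n => _) = (fun n => n%:R^-1 * t n p)).
    exact: bounded_cvg_seq (@t_cvg p).
  by apply/funext => n; rewrite traceH E_cst.
have base2 p bs : bdd (fun n => E n (X n p 0 * \prod_(b <- bs) X n 0 b)).
  rewrite (_ : (fun n => _) = fun=> 0); first exact: bounded_seq_cst.
  by apply/funext => n; rewrite centered_p0 mul0r linear0.
elim: d => [|d [IH1 IH2]].
  split=> [p q|p q bs]; first by rewrite leqn0 => /eqP ->.
  by rewrite leqn0 addn_eq0 => /andP[/eqP -> _].
have bprod bs : (sumn bs <= d)%N -> bdd (fun n => E n (\prod_(b <- bs) X n 0 b)).
  case: bs => [_|b bs bd].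
    rewrite (_ : (fun n => _) = fun=> 1); first exact: bounded_seq_cst.
    by apply/funext => n; rewrite big_nil E1.
  rewrite (_ : (fun n => _) = fun n => E n (X n 0 b * \prod_(b <- bs) X n 0 b)).
    exact: IH2.
  by apply/funext => n; rewrite big_cons.
have bXX i p j bs : (i + j + sumn bs <= d)%N ->
    bdd (fun n => E n (X n p j * X n 0 i * \prod_(b <- bs) X n 0 b)).
  move=> le_d; rewrite (_ : (fun n => _) =
      fun n => E n (X n p j * \prod_(b <- i :: bs) X n 0 b)).
    by apply: IH2 => /=; lia.
  by apply/funext => n; rewrite big_cons mulrA.
have bXX1 i p j : (i + j <= d)%N -> bdd (fun n => E n (X n p j * X n 0 i)).
  move=> le_d; rewrite (_ : (fun n => _) =
      fun n => E n (X n p j * X n 0 i * \prod_(b <- [::]) X n 0 b)).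
    by apply: bXX; rewrite addn0.
  by apply/funext => n; rewrite big_nil mulr1.
have bT p q bs : (q + sumn bs <= d)%N ->
    bdd (fun n => n%:R^-1 * E n (T n p q * \prod_(b <- bs) X n 0 b)).
  move=> le_d; rewrite (_ : (fun n => _) = fun n =>
      n%:R^-1 * E n (X n p q * \prod_(b <- bs) X n 0 b) +
      eT n p q * E n (\prod_(b <- bs) X n 0 b)).
    apply: bounded_seqD; apply: bounded_seqM.
    - exact: bounded_seq_inv.
    - exact: IH2.
    - by apply: IH1; lia.
    - by apply: bprod; lia.
  by apply/funext => n; rewrite E_traceM mulrDr mulrA.
split=> [p [|q] qd|p [|q] bs le_d]; [exact: base| |exact: base2|].
  rewrite (_ : (fun n => _) = fun n => eT n p.+1 q + \sum_(i < q)
      (n%:R^-1 * n%:R^-1 * E n (X n p (q - i.+1) * X n 0 i)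
       + eT n 0 i * eT n p (q - i.+1))).
    apply: bounded_seqD; first by apply: IH1; lia.
    apply: bounded_seq_sum => i; have iq := ltn_ord i; apply: bounded_seqD.
      apply: bounded_seqM; first by apply: bounded_seqM; exact: bounded_seq_inv.
      by apply: bXX1; lia.
    by apply: bounded_seqM; apply: IH1; lia.
  apply/funext => n; rewrite -[T n p q.+1]mulr1 loop_eq theta1 linear0 mulr0 addr0.
  rewrite mulr1 mulrDr; congr (_ + _); rewrite !mulr_sumr; apply: eq_bigr => i _.
  by rewrite E_traceMM !mulr1 !E_centered E1; ring.
apply: eq_bounded_seq => [n|]; first exact: loop_eq_centered.
apply: bounded_seqD; last first.
  rewrite (_ : (fun n => _) = fun n => n%:R^-1 * E n (\prod_(c <- [::]) X n 0 c *
                  theta p q (\prod_(b <- bs) X n 0 b))).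
    by apply: (@bdd_loop_theta d) => //=; lia.
  by apply/funext => n; rewrite big_nil mul1r.
apply: bounded_seqD; first by apply: IH2; lia.
apply: bounded_seq_sum => i; have iq := ltn_ord i.
apply: bounded_seqD; [apply: bounded_seqD|].
- apply: bounded_seqM; first exact: bounded_seq_inv.
  apply: bounded_seqD; first by apply: bXX; lia.
  apply: bounded_seqN; apply: bounded_seqM; first by apply: bXX1; lia.
  by apply: bprod; lia.
- by apply: bounded_seqM; [apply: IH1; lia|apply: IH2; lia].
- by apply: bounded_seqM; [apply: IH1; lia|apply: IH2; lia].
Qed.

Lemma bdd_pow (f : {poly K}) r p q bs :
  bdd (fun n => E n (X n p q * \prod_(b <- bs) X n 0 b
                     * (\sum_(b < size f) f`_b *: X n 0 b) ^+ r)).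
Proof.
elim: r bs => [|r IH] bs.
  apply: (@eq_bounded_seq _ _ (fun n => E n (X n p q * \prod_(b <- bs) X n 0 b))).
    by move=> n; rewrite expr0 mulr1.
  exact: (bdd_centered _).2.
apply: (@eq_bounded_seq _ _ (fun n => \sum_(b < size f) f`_b *
   E n (X n p q * \prod_(c <- nat_of_ord b :: bs) X n 0 c
                     * (\sum_(b < size f) f`_b *: X n 0 b) ^+ r))); last first.
  by apply: bounded_seq_sum => b; apply: bounded_seqM; [exact: bounded_seq_cst|].
move=> n; rewrite exprS mulrCA mulrC mulr_sumr linear_sum; apply: eq_bigr => b _ /=.
by rewrite -scalerAr linearZ /= big_cons; congr (_ * E n _); ring.
Qed.

Let cvgsD u v (a b : K) : u n @[n --> \oo] --> a -> v n @[n --> \oo] --> b ->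
  (u n + v n) @[n --> \oo] --> a + b.
Proof. exact: (@cvgD K K^o). Qed.

Let cvgsM u v (a b : K) : u n @[n --> \oo] --> a -> v n @[n --> \oo] --> b ->
  (u n * v n) @[n --> \oo] --> a * b.
Proof. exact: (@cvgM K). Qed.

Let cvgs_eq (u v : nat -> K) (a b : K) : (forall n, u n = v n) -> a = b ->
  v n @[n --> \oo] --> b -> u n @[n --> \oo] --> a.
Proof. by move=> /funext -> ->. Qed.

(** As covariances stay bounded, the expectation of a product of two traces factorizes at
  the leading order [n ^ 2], and the loop equation becomes [lim_wordS]. *)
Lemma cvg_word p q : eT n p q @[n --> \oo] --> lim_word h nu p q.
Proof.
elim/ltn_ind: q p => -[|q] IH p.
  apply: (cvgs_eq _ _ (@t_cvg p)) => [n|]; first by rewrite traceH E_cst.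
  by rewrite /lim_word mulr1.
apply: (@cvgs_eq _ (fun n => eT n p.+1 q + \sum_(i < q)
      (n%:R^-1 * (n%:R^-1 * E n (X n p (q - i.+1) * X n 0 i))
       + eT n 0 i * eT n p (q - i.+1))) _
    (lim_word h nu p.+1 q + \sum_(i < q)
      (0 + lim_word h nu 0 i * lim_word h nu p (q - i.+1)))).
- move=> n; rewrite -[T n p q.+1]mulr1 loop_eq theta1 linear0 mulr0 addr0.
  rewrite mulr1 mulrDr; congr (_ + _); rewrite !mulr_sumr; apply: eq_bigr => i _.
  by rewrite E_traceMM !mulr1 !E_centered E1; ring.
- by rewrite lim_wordS; congr (_ + _); apply: eq_bigr => i _; rewrite add0r.
apply: cvgsD; first exact: IH.
apply: cvg_sum_ord => i; have iq := ltn_ord i; apply: cvgsD; last by apply: cvgsM; apply: IH; lia.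
apply: cvg_invn_bounded => //; apply: bounded_seqM; first exact: bounded_seq_inv.
apply: eq_bounded_seq ((bdd_centered _).2 p (q - i.+1)%N [:: nat_of_ord i] (leqnn _)).
by move=> n; rewrite big_seq1.
Qed.

Section Fluctuations.
Variable f : {poly K}.
Variables (res : {poly K} -> K).
Hypothesis resD : forall P1 P2, res (P1 + P2) = res P1 + res P2.
Hypothesis resZ : forall c P, res (c *: P) = c * res P.
Hypothesis res_deriv : forall q,
  res (free_appell h nu q)^`() =
  source_int h nu (conv (free_appell h nu) (cov_source h nu f) q).

Definition lin_stat n : A n := \sum_(b < size f) f`_b *: X n 0 b.

Local Notation Y := lin_stat.
Local Notation c := (lim_cov h nu f res).

Definition lim_var : K := \sum_(b < size f) f`_b * res (index_deriv (free_appell h nu) b).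

(** The recursion that integration by parts gives for the moments of the centered normal
  law of variance [s]. *)
Fixpoint normal_moment (s : K) (r : nat) : K :=
  match r with
  | 0 => 1 | 1 => 0
  | r'.+2 => r'.+1%:R * s * normal_moment s r'
  end.

Local Notation mu := (normal_moment lim_var).

Lemma theta_exp n p q x r :
  theta p q (x ^+ r : A n) = r%:R * x ^+ r.-1 * theta p q x.
Proof.
elim: r => [|r IH]; first by rewrite theta1 !mul0r.
rewrite exprS thetaM IH /= -natr1; case: r {IH} => [|r]; last rewrite exprS; ring.
Qed.

Lemma theta_lin_stat n p q :
  theta p q (Y n) = \sum_(b < size f) (b%:R * f`_b) *: T n p (q + b).-1.
Proof.
rewrite /Y.
have th0 : theta p q (0 : A n) = 0.
  by have := thetaZ p q 0 (0 : A n); rewrite !scale0r.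
rewrite (big_morph (theta p q) (@thetaD n p q) th0).
by apply: eq_bigr => b _; rewrite thetaZ theta_centered scalerA mulrC.
Qed.

(** In the limit the loop equation becomes the linear recursion [lim_covS]: the derivation
  pairs the trace with one of the [r] factors [Y n], and the term with two centered traces
  and the factor [n ^ -1] vanishes. *)
Lemma cvg_centered_pow r :
  (E n (Y n ^+ r.-1) @[n --> \oo] --> mu r.-1) ->
  (E n (Y n ^+ r) @[n --> \oo] --> mu r) ->
  forall q p, E n (X n p q * Y n ^+ r) @[n --> \oo] --> r%:R * c p q * mu r.-1.
Proof.
move=> cr1 cr; elim/ltn_ind => -[|q] IH p.
  rewrite lim_covp0 mulr0 mul0r.
  by apply: (@cvgs_eq _ (fun=> 0) _ 0) => // [n|]; [rewrite centered_p0 mul0r linear0|exact: cvg_cst].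
rewrite lim_covS//.
apply: (@cvgs_eq _ (fun n => E n (X n p.+1 q * Y n ^+ r)
    + \sum_(i < q) (n%:R^-1 * (E n (X n p (q - i.+1) * X n 0 i * Y n ^+ r)
                    - E n (X n p (q - i.+1) * X n 0 i) * E n (Y n ^+ r))
        + eT n 0 i * E n (X n p (q - i.+1) * Y n ^+ r)
        + eT n p (q - i.+1) * E n (X n 0 i * Y n ^+ r))
    + \sum_(b < size f) r%:R * (b%:R * f`_b) *
       (n%:R^-1 * E n (X n p (q + b).-1 * Y n ^+ r.-1) +
        eT n p (q + b).-1 * E n (Y n ^+ r.-1))) _
  (r%:R * c p.+1 q * mu r.-1
    + \sum_(i < q) (0 + lim_word h nu 0 i * (r%:R * c p (q - i.+1) * mu r.-1)
        + lim_word h nu p (q - i.+1) * (r%:R * c 0 i * mu r.-1))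
    + \sum_(b < size f) r%:R * (b%:R * f`_b) *
       (0 + lim_word h nu p (q + b).-1 * mu r.-1))).
- move=> n; rewrite loop_eq_centered; congr (_ + _).
  rewrite theta_exp theta_lin_stat !mulr_sumr linear_sum mulr_sumr.
  apply: eq_bigr => b _ /=; rewrite -scalerAr linearZ /=.
  have -> : r%:R * Y n ^+ r.-1 * T n p (q + b).-1 =
      r%:R *: (T n p (q + b).-1 * Y n ^+ r.-1).
    by rewrite scaler_nat -mulr_natl; ring.
  rewrite linearZ /= E_traceM; ring.
- rewrite !mulrDr !mulrDl; congr (_ + _ + _).
    rewrite mulr_sumr mulr_suml; apply: eq_bigr => i _; ring.
  rewrite mulr_sumr mulr_suml; apply: eq_bigr => i _; ring.
have bY s p' q' : bdd (fun n => E n (X n p' q' * Y n ^+ s)).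
  by apply: eq_bounded_seq (bdd_pow f s p' q' [::]) => n; rewrite big_nil mulr1.
apply: cvgsD; [apply: cvgsD|].
- exact: IH.
- apply: cvg_sum_ord => i; have iq := ltn_ord i; apply: cvgsD; [apply: cvgsD|].
  + apply: cvg_invn_bounded => //; apply: bounded_seqD.
      apply: eq_bounded_seq (bdd_pow f r p (q - i.+1) [:: nat_of_ord i]) => n.
      by rewrite big_seq1.
    apply: bounded_seqN; apply: bounded_seqM; last exact: bounded_cvg_seq cr.
    apply: eq_bounded_seq (bdd_pow f 0 p (q - i.+1) [:: nat_of_ord i]) => n.
    by rewrite big_seq1 mulr1.
  + by apply: cvgsM; [exact: cvg_word|apply: IH; lia].
  + by apply: cvgsM; [exact: cvg_word|apply: IH; lia].
- apply: cvg_sum_ord => b; apply: cvgsM; first exact: cvg_cst.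
  apply: cvgsD; first exact: cvg_invn_bounded.
  by apply: cvgsM => //; exact: cvg_word.
Qed.

(** Expanding one factor [Y n] by linearity reduces the moments to [cvg_centered_pow],
  which yields the recursion of [normal_moment]. *)
Lemma cvg_moment_lin_stat r : E n (Y n ^+ r) @[n --> \oo] --> mu r.
Proof.
suff [] : (E n (Y n ^+ r) @[n --> \oo] --> mu r) /\
    (E n (Y n ^+ r.+1) @[n --> \oo] --> mu r.+1) by [].
elim: r => [|r [IH1 IH2]].
  split.
    apply: (@cvgs_eq _ (fun=> 1) _ 1) => //; last exact: cvg_cst.
  apply: (@cvgs_eq _ (fun=> 0) _ 0) => //; last exact: cvg_cst.
  by move=> n; rewrite ?expr1 linear_sum big1// => b _; rewrite linearZ /= E_centered mulr0.
split=> //.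
apply: (@cvgs_eq _ (fun n => \sum_(b < size f) f`_b * E n (X n 0 b * Y n ^+ r.+1)) _
   (\sum_(b < size f) f`_b * (r.+1%:R * c 0 b * mu r))).
- move=> n; rewrite exprS {1}/Y mulr_suml linear_sum; apply: eq_bigr => b _ /=.
  by rewrite -scalerAl linearZ.
- rewrite /= /lim_var !mulr_sumr mulr_suml; apply: eq_bigr => b _.
  rewrite lim_cov0q//; ring.
apply: cvg_sum_ord => b; apply: cvgsM; first exact: cvg_cst.
exact: (@cvg_centered_pow r.+1).
Qed.

End Fluctuations.

End LoopEquations.

(** * The loop equation of a Gaussian Hermitian matrix *)

Section MatrixLoopEquation.
Variables (K : numFieldType) (A : comAlgType K) (n : nat).
Variables (E : {scalar A}) (M : 'M[A]_n) (H0 : 'M[K]_n) (v : K).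
Variable D : 'I_n -> 'I_n -> A -> A.
Hypothesis DD : forall a b x y, D a b (x + y) = D a b x + D a b y.
Hypothesis DZ : forall a b c x, D a b (c *: x) = c *: D a b x.
Hypothesis DM : forall a b x y, D a b (x * y) = D a b x * y + x * D a b y.
Hypothesis D_entry : forall a b c d, D a b (M c d) = ((a == c) && (b == d))%:R.
Hypothesis ibp : forall a b x, E ((M a b - (H0 a b)%:A) * x) = v * E (D b a x).

Local Notation H := (map_mx (fun c : K => c%:A : A) H0).

Definition mixed_trace p q : A := \tr (H ^+ p * M ^+ q).

(** The derivation that the loop equation applies to the other factor of the
  expectation. *)
Definition word_deriv p q (x : A) : A :=
  \sum_a \sum_b (M ^+ q * H ^+ p) a b * D a b x.

Lemma mixed_trace_p0 p : mixed_trace p 0 = (\tr (H0 ^+ p))%:A.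
Proof.
rewrite /mixed_trace expr0 mulr1.
have -> : H ^+ p = map_mx (in_alg A) (H0 ^+ p) by rewrite rmorphXn.
rewrite /mxtrace -[RHS]/(in_alg A _) rmorph_sum; apply: eq_bigr => i _.
by rewrite mxE.
Qed.

Lemma D0 a b : D a b 0 = 0.
Proof. by have := DZ a b 0 0; rewrite !scale0r. Qed.

Lemma D_sum a b (I : Type) (r : seq I) (F : I -> A) :
  D a b (\sum_(i <- r) F i) = \sum_(i <- r) D a b (F i).
Proof. exact: (big_morph (D a b) (DD a b) (D0 a b)). Qed.

Lemma D1 a b : D a b 1 = 0.
Proof.
have := DM a b 1 1; rewrite !mulr1 mul1r.
by move/eqP; rewrite -subr_eq0 opprD addrA subrr sub0r oppr_eq0 => /eqP.
Qed.

Lemma map_mx_DM a b (X Y : 'M[A]_n) :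
  map_mx (D a b) (X * Y) = map_mx (D a b) X * Y + X * map_mx (D a b) Y.
Proof.
apply/matrixP => i j; rewrite !mxE D_sum -big_split; apply: eq_bigr => k _ /=.
by rewrite DM !mxE.
Qed.

Lemma map_mx_D_const a b p : map_mx (D a b) (H ^+ p) = 0.
Proof.
have -> : H ^+ p = map_mx (in_alg A) (H0 ^+ p) by rewrite rmorphXn.
by apply/matrixP => i j; rewrite !mxE DZ D1 scaler0.
Qed.

Lemma map_mx_D_pow a b q : map_mx (D a b) (M ^+ q) =
  \sum_(i < q) M ^+ i * delta_mx a b * M ^+ (q - i.+1).
Proof.
elim: q => [|q IH].
  rewrite big_ord0 expr0; apply/matrixP => i j; rewrite !mxE.
  by case: eqP => _; rewrite ?D0// D1.
rewrite exprS map_mx_DM IH big_ord_recl expr0 mul1r subn1 /=; congr (_ * _ + _).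
  by apply/matrixP => i j; rewrite !mxE D_entry eq_sym (eq_sym j).
rewrite mulr_sumr; apply: eq_bigr => i _.
by rewrite !mulrA -exprS subSS.
Qed.

Lemma mx_delta_entry a b (X Y : 'M[A]_n) i j :
  (X * delta_mx a b * Y) i j = X i a * Y b j.
Proof.
rewrite -mulmxE mxE (bigD1 b)//= big1 ?addr0.
  rewrite mxE (bigD1 a)//= big1 ?addr0.
    by rewrite mxE !eqxx mulr1.
  by move=> k ka; rewrite mxE (negbTE ka) mulr0.
move=> k kb; rewrite mxE big1 ?mul0r// => l _.
by rewrite mxE (negbTE kb) andbF mulr0.
Qed.

(** Integration by parts in the first factor [M] of the word: the derivative of the
  remaining powers of [M] splits the trace in two. *)
Lemma matrix_loop_eq p q x :
  E (mixed_trace p q.+1 * x) = E (mixed_trace p.+1 q * x)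
    + v * \sum_(i < q) E (mixed_trace 0 i * mixed_trace p (q - i.+1) * x)
    + v * E (word_deriv p q x).
Proof.
set u := M ^+ q * H ^+ p.
have trE (X : 'M[A]_n) : E (\tr (X * u) * x) = \sum_a \sum_b E (X a b * (u b a * x)).
  rewrite mulr_suml linear_sum; apply: eq_bigr => a _ /=.
  rewrite mxE mulr_suml linear_sum; apply: eq_bigr => b _ /=.
  by rewrite mulrA.
have -> : mixed_trace p q.+1 = \tr (M * u).
  by rewrite /mixed_trace mxtrace_mulC mulmxE exprS -mulrA.
have -> : mixed_trace p.+1 q = \tr (H * u).
  by rewrite /mixed_trace exprSr -mulrA mxtrace_mulC mulmxE -mulrA.
have splitM a b y : E (M a b * y) = E (H a b * y) + v * E (D b a y).
  by rewrite -ibp mulrBl linearB /= mxE addrC subrK.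
rewrite !trE.
have -> : \sum_a \sum_b E (M a b * (u b a * x)) =
    \sum_a \sum_b E (H a b * (u b a * x))
    + (v * \sum_a \sum_b E (D b a (u b a) * x)
       + v * \sum_a \sum_b E (u b a * D b a x)).
  rewrite -mulrDr -big_split mulr_sumr -big_split; apply: eq_bigr => a _ /=.
  rewrite -big_split mulr_sumr -big_split; apply: eq_bigr => b _ /=.
  by rewrite splitM DM linearD.
rewrite -addrA; congr (_ + (v * _ + v * _)); last first.
  rewrite /word_deriv linear_sum exchange_big; apply: eq_bigr => a _ /=.
  by rewrite linear_sum.
have DuE a b : D b a (u b a) = \sum_(i < q) (M ^+ i) b b * (M ^+ (q - i.+1) * H ^+ p) a a.
  have -> : D b a (u b a) = map_mx (D b a) u b a by rewrite [RHS]mxE.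
  rewrite map_mx_DM map_mx_D_const mulr0 addr0 map_mx_D_pow mulr_suml summxE.
  by apply: eq_bigr => i _; rewrite -mulrA mx_delta_entry.
under eq_bigr do under eq_bigr do rewrite DuE mulr_suml linear_sum.
under eq_bigr do rewrite exchange_big.
rewrite exchange_big; apply: eq_bigr => i _ /=.
have -> : mixed_trace p (q - i.+1) = \tr (M ^+ (q - i.+1) * H ^+ p).
  by rewrite /mixed_trace mxtrace_mulC.
rewrite /mixed_trace expr0 mul1r /mxtrace mulr_sumr mulr_suml linear_sum.
apply: eq_bigr => a _ /=; rewrite mulr_suml mulr_suml linear_sum.
by apply: eq_bigr => b _.
Qed.

Lemma word_deriv_trace p q c :
  word_deriv p q (mixed_trace 0 c) = c%:R *: mixed_trace p (q + c).-1.
Proof.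
have DT a b : D a b (mixed_trace 0 c) = c%:R * (M ^+ c.-1) b a.
  rewrite /mixed_trace expr0 mul1r /mxtrace D_sum.
  have -> : \sum_i D a b ((M ^+ c) i i) = \sum_i map_mx (D a b) (M ^+ c) i i.
    by apply: eq_bigr => i _; rewrite mxE.
  under eq_bigr do rewrite map_mx_D_pow summxE.
  rewrite exchange_big /= mulr_natl.
  transitivity (\sum_(i < c) (M ^+ c.-1) b a); last by rewrite sumr_const card_ord.
  apply: eq_bigr => i _; have ic := ltn_ord i.
  have -> : c.-1 = (c - i.+1 + i)%N by lia.
  rewrite exprD -mulmxE mxE; apply: eq_bigr => k _.
  by rewrite mulmxE mx_delta_entry mulrC.
rewrite /word_deriv; under eq_bigr do under eq_bigr do rewrite DT mulrCA.
under eq_bigr do rewrite -mulr_sumr.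
rewrite -mulr_sumr mulr_natl scaler_nat.
case: c {DT} => [|c]; first by rewrite !mulr0n.
congr (_ *+ _); rewrite /mixed_trace addnS /= mxtrace_mulC mulmxE.
have -> : M ^+ (q + c) * H ^+ p = M ^+ c * (M ^+ q * H ^+ p).
  by rewrite mulrA -exprD addnC.
transitivity (\tr (M ^+ q * H ^+ p * M ^+ c)); last exact: mxtrace_mulC.
by apply: eq_bigr => a _; rewrite [RHS]mxE.
Qed.

Lemma word_derivD p q x y : word_deriv p q (x + y) = word_deriv p q x + word_deriv p q y.
Proof.
rewrite -big_split; apply: eq_bigr => a _ /=; rewrite -big_split; apply: eq_bigr => b _ /=.
by rewrite DD mulrDr.
Qed.

Lemma word_derivZ p q c x : word_deriv p q (c *: x) = c *: word_deriv p q x.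
Proof.
rewrite scaler_sumr; apply: eq_bigr => a _; rewrite scaler_sumr; apply: eq_bigr => b _.
by rewrite DZ scalerAr.
Qed.

Lemma word_derivM p q x y :
  word_deriv p q (x * y) = word_deriv p q x * y + x * word_deriv p q y.
Proof.
rewrite mulr_suml mulr_sumr -big_split; apply: eq_bigr => a _ /=.
rewrite mulr_suml mulr_sumr -big_split; apply: eq_bigr => b _ /=.
by rewrite DM mulrDr mulrA (mulrCA x).
Qed.

End MatrixLoopEquation.

(** * Polynomials in independent coordinates *)

Section ProductMoments.
Variables (K : fieldType) (N : nat) (mom : 'I_N -> nat -> K).
Implicit Types p q : mpoly N K.

Local Notation "p @_ m" := (mcoeff m p) (at level 3, m at level 2).
Local Notation "''X_[' m ]" := (mpolyX K m).
Local Notation "'U_' i" := (mnm1 i) (at level 8).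

(** The expectation of a polynomial in independent variables with prescribed moments. *)
Definition prod_moment p : K := \sum_(m <- msupp p) p@_m * \prod_k mom k (m k).

Lemma prod_momentE (s : seq (multinom N)) p : uniq s -> {subset msupp p <= s} ->
  prod_moment p = \sum_(m <- s) p@_m * \prod_k mom k (m k).
Proof.
move=> us sub; rewrite [RHS](bigID (mem (msupp p))) /=.
rewrite [X in _ + X]big1 ?addr0; last first.
  by move=> m /memN_msupp_eq0 ->; rewrite mul0r.
rewrite -big_filter; apply: perm_big; apply: uniq_perm.
- exact: msupp_uniq.
- exact: filter_uniq.
by move=> m; rewrite mem_filter /=; case: (boolP (m \in msupp p)) => // /sub ->.
Qed.

Lemma prod_moment_is_linear : scalar prod_moment.
Proof.
move=> c p q; pose s := undup (msupp p ++ msupp q ++ msupp (c *: p + q)).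
have us : uniq s by exact: undup_uniq.
rewrite !(@prod_momentE s)//; do ?by move=> m ms; rewrite mem_undup !mem_cat ms ?orbT.
rewrite mulr_sumr -big_split; apply: eq_bigr => m _ /=.
by rewrite mcoeffD mcoeffZ mulrDl mulrA.
Qed.

HB.instance Definition _ := GRing.isLinear.Build K (mpoly N K) K *%R
  prod_moment prod_moment_is_linear.

Lemma prod_momentZ c p : prod_moment (c *: p) = c * prod_moment p.
Proof. exact: linearZ. Qed.

Lemma prod_momentD p q : prod_moment (p + q) = prod_moment p + prod_moment q.
Proof. exact: linearD. Qed.

Lemma prod_momentB p q : prod_moment (p - q) = prod_moment p - prod_moment q.
Proof. exact: linearB. Qed.

Lemma prod_momentX m : prod_moment 'X_[m] = \prod_k mom k (m k).
Proof. by rewrite /prod_moment msuppX big_seq1 mcoeffX eqxx mul1r. Qed.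

Variables (mean var : 'I_N -> K).
Hypothesis momS : forall k a,
  mom k a.+1 = mean k * mom k a + var k * (a%:R * mom k a.-1).

(** On monomials this is the recursion of the moments. *)
Lemma prod_moment_ibp k p :
  prod_moment (('X_[U_ k] - (mean k)%:A) * p) = var k * prod_moment (mderiv k p).
Proof.
elim/mpolyind: p => [|c m p _ _ IH].
  by rewrite mulr0 !linear0 mulr0.
rewrite mulrDr mderivD !linearD /= IH mulrDr; congr (_ + _).
rewrite -scalerAr mderivZ !prod_momentZ mulrCA; congr (_ * _).
rewrite mulrBl mulr_algl linearB /= -mpolyXD mderivX !prod_momentZ !prod_momentX.
rewrite (bigD1 k)//= [X in _ - _ * X](bigD1 k)//= [X in _ = _ * (_ * X)](bigD1 k)//=.
rewrite mnmDE mnmBE !mnm1E eqxx add1n subn1 momS.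
rewrite [X in _ * X - _](eq_bigr (fun i => mom i (m i))); last first.
  by move=> i ik; rewrite mnmDE mnm1E eq_sym (negbTE ik).
rewrite [X in _ = _ * (_ * (_ * X))](eq_bigr (fun i => mom i (m i))); last first.
  by move=> i ik; rewrite mnmBE mnm1E eq_sym (negbTE ik) subn0.
ring.
Qed.

End ProductMoments.

Section HermitianScalars.
Variables (K : numClosedFieldType) (V : lmodType K).
Implicit Types x y : V.

Lemma scale_half_double x : 2^-1 *: (x + x) = x.
Proof.
by rewrite -mulr2n -scalerMnr scalerMnl -[_ *+ 2]mulr_natr mulVf ?scale1r ?pnatr_eq0.
Qed.

Lemma scale_half_imag x : 2^-1 *: (x - 'i *: ('i *: x)) = x.
Proof. by rewrite scalerA -expr2 sqrCi scaleN1r opprK scale_half_double. Qed.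

Lemma scale_half_imag0 x : 2^-1 *: (x + 'i *: ('i *: x)) = 0.
Proof. by rewrite scalerA -expr2 sqrCi scaleN1r subrr scaler0. Qed.

End HermitianScalars.

Section GUEPolynomials.
Variables (R : realType) (n : nat).
Local Notation C := R[i].
Local Notation N := (n * n)%N.
Local Notation A := (mpoly N C).

Definition coord (i j : 'I_n) : A := mpolyX C (mnm1 (mxvec_index i j)).

(** The generic Hermitian matrix, whose entries are polynomials in its real coordinates. *)
Definition generic_herm : 'M[A]_n := \matrix_(i, j)
  if (i < j)%N then coord i j + 'i *: coord j i
  else if (j < i)%N then coord j i - 'i *: coord i j
  else coord i i.

(** The derivation that takes the value 1 on the entry [(a, b)] of [generic_herm] and 0
  on its other entries. *)
Definition entry_deriv (a b : 'I_n) (x : A) : A :=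
  let d i j := mderiv (mxvec_index i j) x in
  if (a < b)%N then 2^-1 *: (d a b - 'i *: d b a)
  else if (b < a)%N then 2^-1 *: (d b a + 'i *: d a b)
  else d a a.

Lemma entry_derivD a b x y : entry_deriv a b (x + y) = entry_deriv a b x + entry_deriv a b y.
Proof.
rewrite /entry_deriv; case: ltngtP => _; rewrite !mderivD// -scalerDr; congr (_ *: _).
- by rewrite scalerDr; ring.
- by rewrite scalerDr; ring.
Qed.

Lemma entry_derivZ a b c x : entry_deriv a b (c *: x) = c *: entry_deriv a b x.
Proof.
rewrite /entry_deriv; case: ltngtP => _; rewrite !mderivZ// [in RHS]scalerA mulrC -scalerA;
  congr (_ *: _).
- by rewrite scalerBr !scalerA [c * 'i]mulrC.
- by rewrite scalerDr !scalerA [c * 'i]mulrC.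
Qed.

Lemma entry_derivM a b x y :
  entry_deriv a b (x * y) = entry_deriv a b x * y + x * entry_deriv a b y.
Proof.
rewrite /entry_deriv; case: ltngtP => _; rewrite !mderivM// -scalerAl -scalerAr -scalerDr;
  congr (_ *: _); rewrite scalerDr !mulrDl !mulrDr ?mulNr ?mulrN -scalerAl -scalerAr; ring.
Qed.

Lemma mderiv_coord i j k l :
  mderiv (mxvec_index i j) (coord k l) = ((i == k) && (j == l))%:R.
Proof.
rewrite /coord mderivX mnm1E.
have -> : (mxvec_index k l == mxvec_index i j) = (i == k) && (j == l).
  apply/eqP/andP => [|[/eqP -> /eqP ->]//].
  by rewrite /mxvec_index => /cast_ord_inj/enum_rank_inj [-> ->].
case: (andP) => [[/eqP -> /eqP ->]|_]; last by rewrite scale0r.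
by rewrite scale1r -[RHS]mpolyX0; congr mpolyX; apply/mnmP => x; rewrite mnmBE subnn mnm0E.
Qed.

Lemma entry_deriv_herm a b c d :
  entry_deriv a b (generic_herm c d) = ((a == c) && (b == d))%:R.
Proof.
have F (p q r s : 'I_n) : (p < q)%N -> (s <= r)%N -> (p == r) && (q == s) = false.
  by move=> pq rs; apply/negP => /andP[/eqP ? /eqP ?]; subst; lia.
have G (p q r s : 'I_n) : (q < p)%N -> (r <= s)%N -> (p == r) && (q == s) = false.
  by move=> pq rs; apply/negP => /andP[/eqP ? /eqP ?]; subst; lia.
have E2 (p r s : 'I_n) : (r < s)%N -> (p == r) && (p == s) = false.
  by move=> rs; apply/negP => /andP[/eqP ? /eqP ?]; subst; lia.
rewrite mxE /entry_deriv.
case: (ltngtP a b) => [ab|ab|/ord_inj ab]; case: (ltngtP c d) => [cd|cd|/ord_inj cd];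
  rewrite ?mderivD ?mderivB ?mderivZ ?mderivN ?mderivZ ?mderiv_coord
    ?(andbC (b == c)) ?(andbC (b == d)).
- rewrite !(F a b d c)// ?(ltnW cd)//.
  by rewrite scaler0 addr0 add0r scale_half_imag.
- rewrite !(F a b c d)// ?(ltnW cd)//.
  by rewrite scaler0 subr0 add0r scalerN opprK scale_half_imag0.
- by rewrite -cd !(F a b c c)// scaler0 subr0 scaler0.
- rewrite !(G a b c d)// ?(ltnW cd)//.
  by rewrite scaler0 addr0 add0r scale_half_imag0.
- rewrite !(G a b d c)// ?(ltnW cd)//.
  by rewrite scaler0 subr0 add0r scalerN scale_half_imag.
- by rewrite -cd !(G a b c c)// scaler0 addr0 scaler0.
- by rewrite -ab ?(andbC (a == d)) !(E2 a c d)// scaler0 addr0.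
- by rewrite -ab ?(andbC (a == c)) !(E2 a d c)// scaler0 subr0.
- by rewrite -ab -cd.
Qed.

Variables (mom : 'I_N -> nat -> C) (mean var : 'I_N -> C) (H0 : 'M[C]_n).
Hypothesis momS : forall k a,
  mom k a.+1 = mean k * mom k a + var k * (a%:R * mom k a.-1).
Hypothesis meanE : forall i j,
  mean (mxvec_index i j) = H0 i j.
Hypothesis H0_diag : forall i j, i != j -> H0 i j = 0.
Hypothesis varE : forall i j,
  var (mxvec_index i j) = if i == j then n%:R^-1 else 2^-1 * n%:R^-1.

Local Notation E := (prod_moment mom).

Lemma coord_ibp i j x : i != j ->
  E (coord i j * x) = 2^-1 * n%:R^-1 * E (mderiv (mxvec_index i j) x).
Proof.
move=> ij; have := prod_moment_ibp momS (mxvec_index i j) x.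
by rewrite meanE varE (negbTE ij) (H0_diag ij) scale0r subr0.
Qed.

(** The two real integrations by parts behind an off-diagonal entry combine into a
  single complex one, for the Wirtinger derivative in the conjugate entry. *)
Lemma gue_ibp a b x :
  E ((generic_herm a b - (H0 a b)%:A) * x) = n%:R^-1 * E (entry_deriv b a x).
Proof.
rewrite mxE /entry_deriv; case: (ltngtP a b) => [ab|ab|/ord_inj ab].
- have nab : a != b by rewrite -val_eqE /= ltn_eqF.
  rewrite H0_diag// scale0r subr0 mulrDl -scalerAl !(prod_momentZ, prod_momentD).
  have nba : b != a by rewrite eq_sym.
  by rewrite !coord_ibp//; ring.
- have nab : a != b by rewrite -val_eqE /= gtn_eqF.
  rewrite H0_diag// scale0r subr0 mulrBl -scalerAl !(prod_momentZ, prod_momentB).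
  have nba : b != a by rewrite eq_sym.
  by rewrite !coord_ibp//; ring.
have := prod_moment_ibp momS (mxvec_index a b) x.
by rewrite meanE varE ab eqxx.
Qed.

End GUEPolynomials.

(** * Calculus on the real line *)

Section IntegralOfDerivative.
Variable R : realType.
Local Notation mu := (@lebesgue_measure R).

Lemma is_derive_continuous (F f : R -> R) :
  (forall x : R, is_derive x 1 F (f x)) -> continuous F.
Proof.
by move=> dF x; apply/differentiable_continuous/derivable1_diffP; case: (dF x).
Qed.

Lemma Rintegral_segment_derive (F f : R -> R) (a b : R) : a <= b ->
  (forall x : R, a <= x <= b -> is_derive x 1 F (f x)) ->
  {within `[a, b], continuous f} ->
  \int[mu]_(x in `[a, b]) f x = F b - F a.
Proof.
rewrite le_eqVlt => /predU1P[->|ab] dF cf.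
  by rewrite set_itv1 Rintegral_set1 subrr.
have cF (x : R) : a <= x <= b -> {for x, continuous F}.
  move=> /dF dx; apply/differentiable_continuous/derivable1_diffP; by case: dx.
rewrite /Rintegral (@continuous_FTC2 _ f F)//.
  split.
  - by move=> x /itvP xab; case: (dF x); rewrite // !xab.
  - by apply: cvg_at_right_filter; apply: cF; rewrite lexx ltW.
  - by apply: cvg_at_left_filter; apply: cF; rewrite lexx ltW.
by move=> x /itvP xab; rewrite derive1E; case: (dF x); rewrite // !xab.
Qed.

(** The primitive vanishes at both ends; dominated convergence leads from segments to the
  whole line. *)
Lemma Rintegral_derive_eq0 (F f : R -> R) :
  (forall x : R, is_derive x 1 F (f x)) -> continuous f ->
  mu.-integrable setT (EFin \o f) ->
  F n%:R @[n --> \oo] --> (0 : R) -> F (- n%:R) @[n --> \oo] --> (0 : R) ->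
  \int[mu]_x f x = 0.
Proof.
move=> dF cf intf Fp Fn.
have mf : measurable_fun setT f.
  by apply/measurable_EFinP; exact: measurable_int intf.
have mEf : measurable_fun setT (EFin \o f) by exact/measurable_EFinP.
pose f_ (n : nat) : R -> \bar R := (EFin \o f) \_ `[- n%:R, n%:R].
have mf_ n : measurable_fun setT (f_ n).
  by apply/(measurable_restrictT _ _).1 => //; apply: measurable_funTS; exact/measurable_EFinP.
have cvgI : (\int[mu]_x f_ n x @[n --> \oo] --> \int[mu]_x (f x)%:E)%E.
  have [|||_ _ cv] := @dominated_convergence _ _ _ mu setT measurableT f_
    (EFin \o f) (abse \o (EFin \o f)) mf_ mEf _ _ _.
  - apply: aeW => x _; apply: cvg_near_cst; near=> n.
    rewrite /f_ patchE mem_set//= in_itv/= -ler_norml.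
    by near: n; exact: nbhs_infty_ger.
  - exact: integrable_abse.
  - apply: aeW => x n _; rewrite /f_ patchE; case: ifP => //= _.
    by rewrite normr0 lee_fin.
  - exact: cv.
have {}cvgI : (F n%:R - F (- n%:R))%:E @[n --> \oo] --> (\int[mu]_x (f x)%:E)%E.
  apply: cvg_trans cvgI; apply: near_eq_cvg; near=> n.
  rewrite /f_ -integral_mkcond -(@Rintegral_segment_derive F f)//.
  - rewrite /Rintegral fineK//.
    by apply: integrable_fin_num => //; exact: integrableS intf.
  - by rewrite (@le_trans _ _ 0)// oppr_le0.
  - exact: continuous_subspaceT.
rewrite /Rintegral.
have : (F n%:R - F (- n%:R))%:E @[n --> \oo] --> (0 - 0 : R)%:E.
  by apply: cvg_EFin; [exact: nearW|apply: cvgB].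
by rewrite subrr => /(cvg_unique _ cvgI) ->.
Unshelve. all: by end_near. Qed.

End IntegralOfDerivative.

Section PointwiseDerivatives.
Variable R : realType.
Implicit Types (f g : R -> R) (x : R).

Lemma is_derive_addf f g x df dg : is_derive x 1 f df -> is_derive x 1 g dg ->
  is_derive x 1 (fun y => f y + g y) (df + dg).
Proof. exact: is_deriveD. Qed.

Lemma is_derive_subf f g x df dg : is_derive x 1 f df -> is_derive x 1 g dg ->
  is_derive x 1 (fun y => f y - g y) (df - dg).
Proof. exact: is_deriveB. Qed.

Lemma is_derive_mulf f g x df dg : is_derive x 1 f df -> is_derive x 1 g dg ->
  is_derive x 1 (fun y => f y * g y) (df * g x + f x * dg).
Proof.
move=> hf hg; apply: (is_derive_eq (is_deriveM hf hg)).
by rewrite addrC /GRing.scale /= [in LHS](mulrC (g x)).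
Qed.

Lemma is_derive_expf k x : is_derive x 1 (fun y : R => y ^+ k) (k%:R * x ^+ k.-1).
Proof.
elim: k => [|k IH]; first by rewrite mul0r; exact: is_derive_cst.
have -> : (fun y : R => y ^+ k.+1) = (fun y => y * y ^+ k).
  by apply/funext => y; rewrite exprS.
apply: (is_derive_eq (is_derive_mulf (is_derive_id x 1) IH)).
by rewrite /= -natr1; case: k {IH} => [|k]; rewrite ?exprS; ring.
Qed.

Lemma is_derive_idf x : is_derive x 1 (fun y : R => y) 1.
Proof. exact: is_derive_id. Qed.

Lemma is_derive_cstf (c : R) x : is_derive x 1 (fun _ : R => c) 0.
Proof. exact: is_derive_cst. Qed.

End PointwiseDerivatives.

Section RealIntegrable.
Context d (T : measurableType d) (R : realType).
Variables (mu : {measure set T -> \bar R}) (D : set T).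
Hypothesis mD : measurable D.
Implicit Types f g : T -> R.

Lemma integrable_addf f g : mu.-integrable D (EFin \o f) ->
  mu.-integrable D (EFin \o g) -> mu.-integrable D (EFin \o (fun x => f x + g x)).
Proof. by move=> hf hg; have := integrableD mD hf hg; exact: eq_integrable. Qed.

Lemma integrable_subf f g : mu.-integrable D (EFin \o f) ->
  mu.-integrable D (EFin \o g) -> mu.-integrable D (EFin \o (fun x => f x - g x)).
Proof. by move=> hf hg; have := integrableB mD hf hg; exact: eq_integrable. Qed.

Lemma integrable_scalef (c : R) f : mu.-integrable D (EFin \o f) ->
  mu.-integrable D (EFin \o (fun x => c * f x)).
Proof. by move=> hf; have := integrableZl mD c hf; exact: eq_integrable. Qed.

End RealIntegrable.

(** * One-dimensional Gaussian moments *)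

Section GaussianMoments.
Variables (R : realType) (alpha beta : R).
Hypothesis alpha0 : 0 < alpha.
Local Notation mu := (@lebesgue_measure R).

Definition gauss_weight (t : R) : R := expR (beta * t - alpha * t ^+ 2).

Local Notation gw := gauss_weight.

Lemma gauss_weight_ge0 t : 0 <= gw t.
Proof. exact: expR_ge0. Qed.

Lemma normX_le_expR (t : R) k : `|t| ^+ k <= k`!%:R * expR `|t|.
Proof.
case: k => [|k]; first by rewrite expr0 fact0 mul1r -expR0 ler_expR.
rewrite mulrC -ler_pdivrMr ?ltr0n ?fact_gt0//.
by apply: le_trans (expR_ge1Dxn k (normr_ge0 t)); rewrite lerDr.
Qed.

(** A monomial is absorbed by half of the quadratic exponent. *)
Lemma gauss_weight_bound k t : `|t ^+ k * gw t| <=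
  k`!%:R * expR ((1 + `|beta|) ^+ 2 / (2 * alpha)) * expR (- (alpha / 2 * t ^+ 2)).
Proof.
rewrite normrM normrX (ger0_norm (gauss_weight_ge0 t)).
apply: (@le_trans _ _ (k`!%:R * expR `|t| * gw t)).
  by rewrite ler_wpM2r ?gauss_weight_ge0// normX_le_expR.
rewrite /gw -!mulrA -!expRD ler_wpM2l// ler_expR.
set c := 1 + `|beta|.
have bt : beta * t <= `|beta| * `|t| by rewrite -normrM ler_norm.
have t2 : t ^+ 2 = `|t| ^+ 2 by rewrite real_normK ?num_real.
have key : c * `|t| <= c ^+ 2 / (2 * alpha) + alpha / 2 * `|t| ^+ 2.
  rewrite -subr_ge0.
  have -> : c ^+ 2 / (2 * alpha) + alpha / 2 * `|t| ^+ 2 - c * `|t| =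
      (c - alpha * `|t|) ^+ 2 / (2 * alpha).
    by field; rewrite gt_eqF.
  by rewrite divr_ge0 ?sqr_ge0// mulr_ge0// ltW.
move: key; rewrite t2 /c mulrDl mul1r; lra.
Qed.

Lemma continuous_gauss_moment k : continuous (fun t : R => t ^+ k * gw t).
Proof.
move=> t; apply: cvgM; first exact: exprn_continuous.
rewrite /gw; apply: continuous_comp; last exact: continuous_expR.
apply: cvgB; apply: cvgM; [exact: cvg_cst|exact: cvg_id|exact: cvg_cst|].
exact: exprn_continuous.
Qed.

Lemma integrable_gauss_moment k : mu.-integrable setT (EFin \o (fun t : R => t ^+ k * gw t)).
Proof.
pose s := Num.sqrt alpha^-1.
have s0 : s != 0 by rewrite sqrtr_eq0 -ltNge invr_gt0.
have p0 : 0 < normal_peak s by exact: normal_peak_gt0.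
have /(integrableZl measurableT) := integrable_normal_pdf 0 s.
move=> /(_ (k`!%:R * expR ((1 + `|beta|) ^+ 2 / (2 * alpha)) / normal_peak s)).
apply: le_integrable => //.
  apply/measurable_EFinP; apply: continuous_measurable_fun.
  exact: continuous_gauss_moment.
move=> t _; rewrite !abse_EFin lee_fin; apply: (le_trans (gauss_weight_bound k t)).
apply: le_trans (ler_norm _); rewrite normal_pdfE//= [leRHS]mulrA divfK ?gt_eqF//.
rewrite ler_wpM2l// ?mulr_ge0 ?expR_ge0//.
rewrite /normal_fun ler_expR subr0 sqr_sqrtr ?invr_ge0 ?(ltW alpha0)//.
rewrite le_eqVlt; apply/orP; left; apply/eqP; field.
by rewrite gt_eqF.
Qed.

Definition gauss_moment k : R := \int[mu]_t (t ^+ k * gw t).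

Lemma is_derive_gauss_moment k (t : R) : is_derive t 1 (fun x => x ^+ k * gw x)
  (k%:R * (t ^+ k.-1 * gw t) + (beta * (t ^+ k * gw t) - 2 * alpha * (t ^+ k.+1 * gw t))).
Proof.
have dw : is_derive t 1 gw ((beta - 2 * alpha * t) * gw t).
  have de := is_derive_subf (is_derive_mulf (is_derive_cstf beta t) (is_derive_idf t))
    (is_derive_mulf (is_derive_cstf alpha t) (is_derive_expf 2 t)).
  have h := @is_derive1_comp R expR (fun y => beta * y - alpha * y ^+ 2) t _ _
    (is_derive_expR _) de.
  apply: (is_derive_eq h).
  by rewrite /= /gw /GRing.scale /=; ring.
apply: (is_derive_eq (is_derive_mulf (is_derive_expf k t) dw)).
rewrite exprS; ring.
Qed.

Lemma cvg_gauss_moment k (u : nat -> R) : (forall n, n%:R <= `|u n|) ->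
  (u n ^+ k * gw (u n)) @[n --> \oo] --> (0 : R).
Proof.
move=> nu.
pose C := k`!%:R * expR ((1 + `|beta|) ^+ 2 / (2 * alpha)).
have C0 : 0 <= C by rewrite mulr_ge0 ?expR_ge0.
have B n : `|u n ^+ k * gw (u n)| <= C * expR (- (alpha / 2 * n%:R)).
  apply: (le_trans (gauss_weight_bound k (u n))).
  rewrite -/C ler_wpM2l// ler_expR lerN2 ler_wpM2l ?divr_ge0 ?(ltW alpha0)//.
  rewrite -(real_normK (num_real (u n))).
  apply: (@le_trans _ _ (n%:R ^+ 2)); last by rewrite ler_sqr ?nnegrE.
  by rewrite -natrX ler_nat; nia.
have cE : C * expR (- (alpha / 2 * n%:R)) @[n --> \oo] --> (0 : R).
  rewrite -[X in _ --> X](mulr0 C); apply: cvgM; first exact: cvg_cst.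
  have -> : (fun n => expR (- (alpha / 2 * n%:R))) = (fun n => (expR (- (alpha / 2))) ^+ n).
    by apply/funext => n; rewrite -expRM_natr mulNr.
  apply: cvg_expr; rewrite ger0_norm ?expR_ge0// expR_lt1 oppr_lt0.
  by rewrite divr_gt0.
apply/norm_cvg0P; apply: squeeze_cvgr (cvg_cst (0:R)) cE.
by near=> n; rewrite /= normr_ge0 B.
Unshelve. all: by end_near. Qed.

(** The derivative of [t ^+ k * gw t] has integral 0. *)
Lemma gauss_momentS k :
  gauss_moment k.+1 = beta / (2 * alpha) * gauss_moment k
    + (2 * alpha)^-1 * (k%:R * gauss_moment k.-1).
Proof.
have intM c j : mu.-integrable setT (EFin \o (fun t : R => c * (t ^+ j * gw t))).
  exact: (integrable_scalef measurableT c (integrable_gauss_moment j)).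
have E : \int[mu]_t (k%:R * (t ^+ k.-1 * gw t)
    + (beta * (t ^+ k * gw t) - 2 * alpha * (t ^+ k.+1 * gw t))) = 0.
  apply: (Rintegral_derive_eq0 (is_derive_gauss_moment k)).
  - move=> t; apply: cvgD; first by apply: cvgM; [exact: cvg_cst|exact: continuous_gauss_moment].
    apply: cvgB; apply: cvgM; do ?exact: cvg_cst; exact: continuous_gauss_moment.
  - by apply: integrable_addf => //; apply: integrable_subf.
  - by apply: cvg_gauss_moment => n; rewrite normr_nat.
  - by apply: cvg_gauss_moment => n; rewrite normrN normr_nat.
move: E; rewrite RintegralD//; last by apply: integrable_subf.
rewrite RintegralB// !RintegralZl//; do ?exact: integrable_gauss_moment.
rewrite -/(gauss_moment k) -/(gauss_moment k.-1) -/(gauss_moment k.+1).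
move/eqP; rewrite addrA subr_eq0 => /eqP E.
apply: (@mulfI _ (2 * alpha)); first by rewrite mulf_neq0// gt_eqF.
rewrite -E; field; by rewrite gt_eqF.
Qed.

End GaussianMoments.

(** * Densities and product measures *)

Section IntegralDensity.
Context d (T : measurableType d) (R : realType).
Variables (nu mu : {measure set T -> \bar R}) (w : T -> R).
Hypothesis w0 : forall x, 0 <= w x.
Hypothesis mw : measurable_fun setT w.
Hypothesis nuE : forall A, measurable A -> nu A = (\int[mu]_(x in A) (w x)%:E)%E.

Import HBNNSimple.
Local Open Scope ereal_scope.

Let mEw : measurable_fun setT (EFin \o w). Proof. exact/measurable_EFinP. Qed.

(** On simple functions this is linearity; monotone convergence does the rest. *)
Lemma ge0_integral_density (f : T -> \bar R) : (forall x, 0 <= f x) ->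
  measurable_fun setT f -> \int[nu]_x f x = \int[mu]_x (f x * (w x)%:E).
Proof.
move=> f0 mf.
pose h := nnsfun_approx measurableT mf.
have -> : \int[nu]_x f x = lim (\int[nu]_x (EFin \o h n) x @[n --> \oo]).
  have fE x : f x = lim ((EFin \o h n) x @[n --> \oo]).
    by apply/esym/cvg_lim => //; exact: cvg_nnsfun_approx.
  under eq_integral do rewrite fE.
  apply: monotone_convergence => //.
  - by move=> n; apply/measurable_EFinP/measurable_funP.
  - by move=> n x _ //=; rewrite lee_fin.
  - by move=> x _ a b ab; rewrite lee_fin; exact/lefP/nd_nnsfun_approx.
have -> : \int[mu]_x (f x * (w x)%:E) =
    lim (\int[mu]_x ((EFin \o h n) x * (w x)%:E) @[n --> \oo]).
  have fg x : f x * (w x)%:E = lim ((EFin \o h n) x * (w x)%:E @[n --> \oo]).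
    by apply/esym/cvg_lim => //; apply: cvgeZr => //; exact: cvg_nnsfun_approx.
  under eq_integral do rewrite fg.
  apply: monotone_convergence => //.
  - by move=> n; apply/emeasurable_funM => //; exact/measurable_EFinP.
  - by move=> n x _ /=; rewrite mule_ge0 ?lee_fin.
  - by move=> x _ a b ab/=; rewrite lee_wpmul2r ?lee_fin//; exact/lefP/nd_nnsfun_approx.
suff suf n : \int[mu]_x ((EFin \o h n) x * (w x)%:E) = \int[nu]_x (EFin \o h n) x.
  by under eq_fun do rewrite -suf.
transitivity (\int[nu]_x
   (\sum_(y \in range (h n)) (y * \1_(h n @^-1` [set y]) x)%:E)); last first.
  by apply: eq_integral => t tE; rewrite /= fimfunE -fsumEFin.
have indich r : measurable_fun setT (fun x => (r * \1_(h n @^-1` [set r]) x)%:E).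
  by apply/measurable_EFinP; exact: measurable_funM.
rewrite ge0_integral_fsum//; last by move=> y x _; exact: nnfun_muleindic_ge0.
transitivity (\int[mu]_x (\sum_(y \in range (h n))
    (y * \1_(h n @^-1` [set y]) x)%:E * (w x)%:E)).
  under [RHS]eq_integral => x xE.
    rewrite -ge0_mule_fsuml => [|y]; last exact: nnfun_muleindic_ge0.
    rewrite fsumEFin // -(fimfunE _ x); over.
  by [].
rewrite ge0_integral_fsum//; last 2 first.
  - by move=> y; apply: emeasurable_funM.
  - move=> y x _; apply: mule_ge0; last by rewrite lee_fin.
    by rewrite EFinM; exact: nnfun_muleindic_ge0.
apply: eq_fsbigr => r rhn.
have r0 : (0 <= r)%R by move: rhn; rewrite inE => -[t _ <-].
under [RHS]eq_integral do rewrite EFinM.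
rewrite integralZl_indic_nnsfun => //.
under eq_integral do rewrite EFinM -muleA.
rewrite ge0_integralZl//.
- under eq_integral do rewrite muleC.
  rewrite (eq_integral ((EFin \o w) \_ (h n @^-1` [set r]))); last first.
    by move=> x xE; rewrite epatch_indic.
  by rewrite -integral_mkcond -nuE// integral_indic// setIT.
- by apply: emeasurable_funM => //; exact/measurable_EFinP.
- by move=> t Et; rewrite mule_ge0 ?lee_fin.
Qed.

Lemma integrable_density (f : T -> R) : measurable_fun setT f ->
  mu.-integrable setT (EFin \o (fun x => f x * w x)%R) -> nu.-integrable setT (EFin \o f).
Proof.
move=> mf /integrableP[_ ioo]; apply/integrableP; split; first exact/measurable_EFinP.
rewrite ge0_integral_density => [|x|]; last 2 first.
  - exact: abse_ge0.
  - by apply: measurableT_comp => //; exact/measurable_EFinP.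
under eq_integral => x _ do rewrite -[(w x)%:E]gee0_abs ?lee_fin// -abseM -EFinM.
exact: ioo.
Qed.

Lemma Rintegral_density (f : T -> R) : measurable_fun setT f ->
  (\int[nu]_x f x = \int[mu]_x (f x * w x))%R.
Proof.
move=> mf; rewrite /Rintegral; congr fine.
rewrite integralE [in RHS]integralE.
have mEf : measurable_fun setT (EFin \o f) by exact/measurable_EFinP.
rewrite !ge0_integral_density//; [|exact: measurable_funeneg|exact: measurable_funepos].
congr (_ - _); apply: eq_integral => x _ /=.
- by rewrite !funeposE /= -!EFin_max -EFinM maxr_pMl// mul0r.
- by rewrite !funenegE /= -!EFin_max -EFinM maxr_pMl// mul0r mulNr.
Qed.

End IntegralDensity.

Section ProductIntegral.
Context d1 d2 (T1 : measurableType d1) (T2 : measurableType d2) (R : realType).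
Variables (m1 : {sigma_finite_measure set T1 -> \bar R}).
Variables (m2 : {sigma_finite_measure set T2 -> \bar R}).
Variables (u : T1 -> R) (g : T2 -> R).
Hypothesis iu : m1.-integrable setT (EFin \o u).
Hypothesis ig : m2.-integrable setT (EFin \o g).
Local Open Scope ereal_scope.

Let f (z : T1 * T2) : \bar R := (u z.1 * g z.2)%:E.

Lemma integrable_prod_mul : (m1 \x m2).-integrable setT f.
Proof.
have mu : measurable_fun setT u by apply/measurable_EFinP; exact: measurable_int iu.
have mg : measurable_fun setT g by apply/measurable_EFinP; exact: measurable_int ig.
have mf : measurable_fun setT f.
  apply/measurable_EFinP; apply: measurable_funM.
    exact: measurableT_comp.
  exact: measurableT_comp.
apply/integrable12ltyP => //.
under eq_integral => x _.
  rewrite /f /=; under eq_integral do rewrite normrM EFinM.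
  rewrite ge0_integralZl//; last first.
    by apply/measurable_EFinP; exact: measurableT_comp.
  over.
have /integrableP[_] := ig; have /integrableP[_] := iu => ufin gfin.
rewrite ge0_integralZr//; first last.
- by apply: integral_ge0.
- by apply/measurable_EFinP; exact: measurableT_comp.
rewrite lte_mul_pinfty//; first by apply: integral_ge0.
by rewrite ge0_fin_numE//; apply: integral_ge0.
Qed.

Lemma integral_prod_mul a b : \int[m1]_x (u x)%:E = a%:E -> \int[m2]_y (g y)%:E = b%:E ->
  \int[m1 \x m2]_z f z = (a * b)%:E.
Proof.
move=> ua gb; rewrite -integral12_prod_meas1; last exact: integrable_prod_mul.
rewrite /fubini_F /f /=.
under eq_integral => x _.
  under eq_integral do rewrite EFinM.
  rewrite integralZl// gb.
  over.
by rewrite integralZr// ua EFinM.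
Qed.

End ProductIntegral.

Section TupleIntegral.
Variable R : realType.
Local Notation TR := (measurableTypeR R).
Local Notation mu := (@lebesgue_measure R).

Lemma measurable_prod_tuple N (u : 'I_N -> R -> R) :
  (forall i, measurable_fun setT (u i)) ->
  measurable_fun setT (fun t : N.-tuple TR => \prod_(i < N) u i (tnth t i)).
Proof.
move=> hu; apply: measurable_prod => i _.
exact: (measurableT_comp (hu i) (measurable_tnth i)).
Qed.

(** Under Lebesgue measure on tuples, functions of different coordinates behave as
  independent ones. *)
Lemma lebesgue_tuple_prod N (u : 'I_N -> R -> R) :
  (forall i, mu.-integrable setT (EFin \o u i)) ->
  (@lebesgue_tuple R N).-integrable setT
     (EFin \o (fun t => \prod_(i < N) u i (tnth t i))) /\
  (\int[@lebesgue_tuple R N]_t (\prod_(i < N) u i (tnth t i))%:E =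
     (\prod_(i < N) \int[mu]_x u i x)%:E)%E.
Proof.
elim: N u => [|N IH] u iu.
  have E : (fun t : 0.-tuple TR => \prod_(i < 0) u i (tnth t i)) = cst 1.
    by apply/funext => t; rewrite big_ord0.
  rewrite [@lebesgue_tuple _ _]/=; split.
    rewrite E; apply/integrableP; split; first by apply/measurable_EFinP; exact: measurable_cst.
    by rewrite integral_dirac//= diracT mul1e /= normr1 ltry.
  rewrite big_ord0 (_ : (fun t : 0.-tuple TR => _) = cst 1%E); last first.
    by apply/funext => t; rewrite big_ord0.
  by rewrite integral_dirac//= diracT mul1e.
have [iI II] := IH (fun i => u (lift ord0 i)) (fun i => iu _).
have mu_ i : measurable_fun setT (u i).
  by apply/measurable_EFinP; exact: measurable_int (iu i).
have mprod := measurable_prod_tuple mu_.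
have compE (z : (TR * N.-tuple TR)%type) :
    \prod_(i < N.+1) u i (tnth (cons_pair z) i) =
    u ord0 z.1 * \prod_(i < N) u (lift ord0 i) (tnth z.2 i).
  case: z => x t; rewrite big_ord_recl; congr (u _ _ * _).
  by apply: eq_bigr => i _; congr (u _ _); rewrite !(tnth_nth x).
have mE : measurable_fun setT (EFin \o (fun t : N.+1.-tuple TR =>
   \prod_(i < N.+1) u i (tnth t i))) by exact/measurable_EFinP.
have ip := integrable_prod_mul (iu ord0) iI.
have ic : (mu \x @lebesgue_tuple R N)%E.-integrable (@cons_pair R N @^-1` setT)
   ((EFin \o (fun t : N.+1.-tuple TR => \prod_(i < N.+1) u i (tnth t i))) \o @cons_pair R N).
  rewrite preimage_setT; apply: eq_integrable ip => // z _.
  by rewrite -compE.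
split; first exact: (integrable_pushforward (@measurable_cons_pair R N) mE ic).
transitivity (\int[(mu \x @lebesgue_tuple R N)%E]_(z in @cons_pair R N @^-1` setT)
  ((EFin \o (fun t : N.+1.-tuple TR => \prod_(i < N.+1) u i (tnth t i))%R) \o @cons_pair R N) z)%E.
  exact: (integral_pushforward (@measurable_cons_pair R N) mE ic).
rewrite preimage_setT big_ord_recl.
under eq_integral do rewrite /= compE.
apply: (integral_prod_mul (iu ord0) iI) => //; rewrite /Rintegral fineK//.
by apply: integrable_fin_num => //; exact: iu.
Qed.

End TupleIntegral.

(** * Expectations in the ensemble with external source *)

Section ComplexExpectation.
Context d (T : measurableType d) (R : realType).
Variables (P : {measure set T -> \bar R}) (D : set T).
Hypothesis mD : measurable D.
Implicit Types F G : T -> R[i].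

(** Integrability is part of the predicate, as the integral of a function that is not
  integrable has no meaning. *)
Definition has_cexp F (c : R[i]) : Prop :=
  [/\ P.-integrable D (EFin \o (fun t => complex.Re (F t))),
      P.-integrable D (EFin \o (fun t => complex.Im (F t))),
      \int[P]_(t in D) complex.Re (F t) = complex.Re c &
      \int[P]_(t in D) complex.Im (F t) = complex.Im c].

Lemma ReD (x y : R[i]) : complex.Re (x + y) = complex.Re x + complex.Re y.
Proof. by case: x => a b; case: y. Qed.

Lemma ImD (x y : R[i]) : complex.Im (x + y) = complex.Im x + complex.Im y.
Proof. by case: x => a b; case: y. Qed.

Lemma ReM (x y : R[i]) : complex.Re (x * y) =
  complex.Re x * complex.Re y - complex.Im x * complex.Im y.
Proof. by case: x => a b; case: y. Qed.

Lemma ImM (x y : R[i]) : complex.Im (x * y) =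
  complex.Re x * complex.Im y + complex.Im x * complex.Re y.
Proof. by case: x => a b; case: y. Qed.

Lemma eq_has_cexp F G a : (forall t, F t = G t) -> has_cexp G a -> has_cexp F a.
Proof. by move=> /funext ->. Qed.

Lemma integrable_zero : P.-integrable D (EFin \o (fun=> 0 : R)).
Proof. by apply: eq_integrable (integrable0 P D). Qed.

Lemma Rintegral_zero : \int[P]_(t in D) (0 : R) = 0.
Proof. by rewrite /Rintegral integral0. Qed.

Lemma has_cexp0 : has_cexp (fun=> 0) 0.
Proof. by split; [exact: integrable_zero|exact: integrable_zero|exact: Rintegral_zero..]. Qed.

Lemma has_cexpD F G a b : has_cexp F a -> has_cexp G b ->
  has_cexp (fun t => F t + G t) (a + b).
Proof.
move=> [F1 F2 F3 F4] [G1 G2 G3 G4].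
have rE : (fun t => complex.Re (F t + G t)) = (fun t => complex.Re (F t) + complex.Re (G t)).
  by apply/funext => t; rewrite ReD.
have iE : (fun t => complex.Im (F t + G t)) = (fun t => complex.Im (F t) + complex.Im (G t)).
  by apply/funext => t; rewrite ImD.
rewrite /has_cexp rE iE; split; try exact: integrable_addf.
- by rewrite RintegralD// F3 G3 ReD.
- by rewrite RintegralD// F4 G4 ImD.
Qed.

Lemma has_cexpZ (c : R[i]) F a : has_cexp F a -> has_cexp (fun t => c * F t) (c * a).
Proof.
move=> [F1 F2 F3 F4].
have rE : (fun t => complex.Re (c * F t)) =
    (fun t => complex.Re c * complex.Re (F t) - complex.Im c * complex.Im (F t)).
  by apply/funext => t; rewrite ReM.
have iE : (fun t => complex.Im (c * F t)) =
    (fun t => complex.Re c * complex.Im (F t) + complex.Im c * complex.Re (F t)).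
  by apply/funext => t; rewrite ImM.
rewrite /has_cexp rE iE; split.
- by apply: integrable_subf => //; exact: integrable_scalef.
- by apply: integrable_addf => //; exact: integrable_scalef.
- rewrite RintegralB//; try exact: integrable_scalef.
  by rewrite !RintegralZl// F3 F4 ReM.
- rewrite RintegralD//; try exact: integrable_scalef.
  by rewrite !RintegralZl// F3 F4 ImM.
Qed.

Lemma has_cexp_real (f : T -> R) (a : R) : P.-integrable D (EFin \o f) ->
  \int[P]_(t in D) f t = a -> has_cexp (fun t => (f t)%:C) a%:C.
Proof. by move=> fi fa; split=> //=; [exact: integrable_zero|exact: Rintegral_zero]. Qed.

Lemma has_cexp_sum (I : eqType) (s : seq I) (F : I -> T -> R[i]) (a : I -> R[i]) :
  (forall i, has_cexp (F i) (a i)) ->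
  has_cexp (fun t => \sum_(i <- s) F i t) (\sum_(i <- s) a i).
Proof.
move=> Fa; elim: s => [|i s IH].
  by rewrite big_nil; apply: eq_has_cexp has_cexp0 => t; rewrite big_nil.
rewrite big_cons; apply: eq_has_cexp (has_cexpD (Fa i) IH) => t.
by rewrite big_cons.
Qed.

End ComplexExpectation.

Section GUEDensity.
Variables (R : realType) (n : nat) (D : 'rV[R]_n).
Local Notation TR := (measurableTypeR R).
Local Notation N := (n * n)%N.
Local Notation C := R[i].

Definition gue_alpha (k : 'I_N) : R :=
  mxvec (\matrix_(i, j) if i == j then n%:R / 2 else n%:R) 0 k.

Definition gue_beta (k : 'I_N) : R := mxvec (n%:R *: diag_mx D) 0 k.

Lemma gue_alpha_gt0 k : 0 < gue_alpha k.
Proof.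
case: (mxvec_indexP k) => i j; rewrite /gue_alpha mxvecE mxE.
have n0 : 0 < n%:R :> R by rewrite ltr0n; case: n i j => // -[].
by case: ifP; rewrite ?divr_gt0.
Qed.

Lemma sum_mxvec_index (V : nmodType) (F : 'I_N -> V) :
  \sum_k F k = \sum_i \sum_j F (mxvec_index i j).
Proof.
by rewrite pair_bigA (reindex _ (curry_mxvec_bij n n)); apply: eq_bigr => -[i j] _.
Qed.

Local Notation Herm := (hermitian_of_coords (R := R)).

Lemma hermE (t : N.-tuple TR) i j :
  Herm t i j = if (i < j)%N then tnth t (mxvec_index i j) +i* tnth t (mxvec_index j i)
    else if (j < i)%N then tnth t (mxvec_index j i) -i* tnth t (mxvec_index i j)
    else (tnth t (mxvec_index i i))%:C.
Proof. by rewrite !mxE. Qed.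

Lemma Re_sum (I : Type) (r : seq I) (F : I -> C) :
  complex.Re (\sum_(i <- r) F i) = \sum_(i <- r) complex.Re (F i).
Proof. exact: (big_morph _ (@ReD R) (erefl : complex.Re (0 : C) = 0)). Qed.

Lemma herm_trace_sqr (t : N.-tuple TR) :
  complex.Re (\tr (Herm t *m Herm t)) = \sum_i \sum_j
    (if i == j then tnth t (mxvec_index i j) ^+ 2
     else 2 * tnth t (mxvec_index i j) ^+ 2).
Proof.
pose X i j := tnth t (mxvec_index i j).
pose G i j : R := if i == j then X i j ^+ 2 / 2 else X i j ^+ 2.
have -> : complex.Re (\tr (Herm t *m Herm t)) = \sum_i \sum_j (G i j + G j i).
  rewrite /mxtrace Re_sum; apply: eq_bigr => i _.
  rewrite mxE Re_sum; apply: eq_bigr => j _; rewrite !hermE /G -/(X i j) -/(X j i) -/(X i i).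
  rewrite (eq_sym j i) -val_eqE /=.
  by case: ltngtP => [ij|ij|/ord_inj ij]; rewrite /= ?ij -?/(X j j); lra.
under eq_bigr do rewrite big_split.
rewrite big_split /= [X in _ + X]exchange_big -big_split; apply: eq_bigr => i _.
rewrite -big_split; apply: eq_bigr => j _ /=.
by rewrite /G /X; case: eqP => _; lra.
Qed.

Lemma source_trace (t : N.-tuple TR) :
  complex.Re (\tr (map_mx (real_complex R) (diag_mx D) *m Herm t)) =
    \sum_i D 0 i * tnth t (mxvec_index i i).
Proof.
rewrite map_diag_mx mul_diag_mx /mxtrace Re_sum; apply: eq_bigr => i _.
by rewrite !mxE ltnn /= mul0r subr0.
Qed.

(** The exponent is a sum over the real coordinates, as the source is diagonal; hence the
  coordinates are independent Gaussian variables. *)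
Lemma source_weightE (t : N.-tuple TR) :
  source_weight (map_mx (real_complex R) (diag_mx D)) (Herm t) =
  \prod_k gauss_weight (gue_alpha k) (gue_beta k) (tnth t k).
Proof.
rewrite /source_weight -expR_sum; congr expR.
rewrite raddfB /= mxtraceZ ReD.
have -> : complex.Re (- \tr (map_mx (real_complex R) (diag_mx D) *m Herm t)) =
    - \sum_i D 0 i * tnth t (mxvec_index i i).
  by rewrite -source_trace; case: (\tr _).
have -> : complex.Re (2^-1 * \tr (Herm t *m Herm t)) =
    2^-1 * complex.Re (\tr (Herm t *m Herm t)).
  have -> : (2^-1 : C) = (2^-1)%:C by rewrite fmorphV rmorph_nat.
  by rewrite ReM /= mul0r subr0.
rewrite herm_trace_sqr sum_mxvec_index mulrBr opprB addrC !mulr_sumr -sumrN -big_split /=.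
apply: eq_bigr => i _; rewrite /= !mulr_sumr.
rewrite (bigD1 i)//= [in RHS](bigD1 i)//= eqxx /gue_alpha /gue_beta !mxvecE !mxE eqxx.
rewrite opprD addrAC; congr (_ + _).
  by rewrite mulr1n; lra.
rewrite -sumrN; apply: eq_bigr => j ji.
have ij : (i == j) = false by rewrite eq_sym (negbTE ji).
rewrite !mxvecE !mxE ij mulr0n mulr0 mul0r add0r.
by congr (- _); lra.
Qed.

End GUEDensity.

Section GUEExpectation.
Variables (R : realType) (n : nat) (D : 'rV[R]_n).
Local Notation TR := (measurableTypeR R).
Local Notation N := (n * n)%N.
Local Notation C := R[i].

Local Notation alpha := (@gue_alpha R n).
Local Notation beta := (gue_beta D).
Local Notation leb := (@lebesgue_tuple R N).

Definition gue_mom (k : 'I_N) (a : nat) : C :=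
  (gauss_moment (alpha k) (beta k) a / gauss_moment (alpha k) (beta k) 0)%:C.

Definition gue_expect (p : mpoly N C) : C := prod_moment gue_mom p.

Definition gue_eval (t : N.-tuple TR) (p : mpoly N C) : C :=
  meval (fun k => (tnth t k)%:C) p.

Context d (Omega : measurableType d) (P : probability Omega R).
Variables (T : {mfun Omega >-> N.-tuple TR}) (c : R).
Hypothesis c0 : 0 < c.
Hypothesis densT : forall A, measurable A -> distribution P T A =
  (c%:E * \int[leb]_(t in A)
     (source_weight (map_mx (real_complex R) (diag_mx D)) (hermitian_of_coords t))%:E)%E.

Let w (t : N.-tuple TR) : R := c * \prod_k gauss_weight (alpha k) (beta k) (tnth t k).
Let mono (m : multinom N) (t : N.-tuple TR) : R := \prod_k tnth t k ^+ m k.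

Let measurable_mono m : measurable_fun setT (mono m).
Proof.
apply: (@measurable_prod_tuple R N (fun k x => x ^+ m k)) => k.
exact: measurable_funX.
Qed.

Let measurable_gw (a b : R) : measurable_fun setT (gauss_weight a b).
Proof.
have := @continuous_gauss_moment R a b 0; rewrite (_ : (fun t : R => _) = gauss_weight a b).
  exact: continuous_measurable_fun.
by apply/funext => t; rewrite expr0 mul1r.
Qed.

Let measurable_pw :
  measurable_fun setT (fun t : N.-tuple TR => \prod_k gauss_weight (alpha k) (beta k) (tnth t k)).
Proof.
apply: (@measurable_prod_tuple R N (fun k => gauss_weight (alpha k) (beta k))) => k.
exact: measurable_gw.
Qed.

Let w0 t : 0 <= w t.
Proof.
rewrite mulr_ge0 ?(ltW c0)// prodr_ge0// => k _; exact: gauss_weight_ge0.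
Qed.

Let mw : measurable_fun setT w.
Proof. by apply: measurable_funM => //; exact: measurable_cst. Qed.

Let nuE A : measurable A -> distribution P T A = (\int[leb]_(x in A) (w x)%:E)%E.
Proof.
move=> mA; rewrite densT// -ge0_integralZl//.
- by apply: eq_integral => t _; rewrite source_weightE EFinM.
- apply: measurable_funTS; apply/measurable_EFinP.
  rewrite (_ : (fun t => _) = fun t : N.-tuple TR =>
     \prod_k gauss_weight (alpha k) (beta k) (tnth t k))//.
  by apply/funext => t; exact: source_weightE.
- by move=> t _; rewrite lee_fin; exact: expR_ge0.
- by rewrite lee_fin ltW.
Qed.

Let u m (k : 'I_N) (x : R) : R := x ^+ m k * gauss_weight (alpha k) (beta k) x.

Let monoE m t : mono m t * w t = c * \prod_k u m k (tnth t k).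
Proof. by rewrite /mono /w mulrCA -big_split. Qed.

Let iu m k : lebesgue_measure.-integrable setT (EFin \o u m k).
Proof. by apply: integrable_gauss_moment; exact: gue_alpha_gt0. Qed.

Let integrable_mono m : (distribution P T).-integrable setT (EFin \o mono m).
Proof.
apply: (integrable_density w0 mw nuE) => //.
have := integrable_scalef measurableT c (lebesgue_tuple_prod (iu m)).1.
by apply: eq_integrable => // t _; rewrite /= monoE.
Qed.

Let integral_mono m : \int[distribution P T]_t mono m t =
  c * \prod_k gauss_moment (alpha k) (beta k) (m k).
Proof.
rewrite (Rintegral_density w0 mw nuE)//.
under eq_Rintegral do rewrite monoE.
have [ii II] := lebesgue_tuple_prod (iu m).
by rewrite RintegralZl//; congr (_ * _); rewrite /Rintegral II.
Qed.

Let integral_mono_norm m : \int[distribution P T]_t mono m t =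
  \prod_k (gauss_moment (alpha k) (beta k) (m k) / gauss_moment (alpha k) (beta k) 0).
Proof.
have one : c * \prod_k gauss_moment (alpha k) (beta k) 0 = 1.
  transitivity (\int[distribution P T]_t mono (@mnm0 N) t).
    by rewrite integral_mono; congr (_ * _); apply: eq_bigr => k _; rewrite mnm0E.
  transitivity (\int[distribution P T]_t (1 : R)).
    apply: eq_Rintegral => t _; rewrite /mono big1// => k _.
    by rewrite mnm0E expr0.
  by rewrite Rintegral_cst// mul1r [X in fine X]probability_setT.
rewrite prodf_div integral_mono.
set p := \prod_k gauss_moment _ _ (m _).
set q := \prod_k _ in one *.
have q0 : q != 0 by apply/eqP => q0; move: one; rewrite q0 mulr0 => /eqP; rewrite eq_sym oner_eq0.
by apply: (mulIf q0); rewrite divfK// mulrAC one mul1r.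
Qed.

(** The integral of the constant 1 identifies the normalizing constant [c] as the inverse
  of a product of one-dimensional integrals. *)
Lemma gue_expectE p : has_cexp P setT (fun x => gue_eval (T x) p) (gue_expect p).
Proof.
have mE (t : N.-tuple TR) m : meval (fun k => (tnth t k)%:C) (mpolyX C m) = (mono m t)%:C.
  rewrite mevalX rmorph_prod; apply: eq_bigr => k _ /=.
  by rewrite rmorphXn.
rewrite /gue_expect /prod_moment.
apply: (eq_has_cexp (G := fun x => \sum_(m <- msupp p) mcoeff m p * (mono m (T x))%:C)).
  move=> x; rewrite /gue_eval [in LHS](mpolyE p) raddf_sum; apply: eq_bigr => m _ /=.
  by rewrite mevalZ mE.
apply: has_cexp_sum => // m; apply: has_cexpZ => //.
have -> : \prod_k gue_mom k (m k) = (\int[distribution P T]_t mono m t)%:C.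
  by rewrite integral_mono_norm rmorph_prod.
have mT : measurable_fun setT T by [].
have im : P.-integrable setT (EFin \o (fun x => mono m (T x))).
  apply/integrableP; split; first by apply/measurable_EFinP; exact: measurableT_comp.
  have /integrableP[_] := integrable_mono m.
  rewrite ge0_integral_distribution//.
  by apply: measurableT_comp => //; exact/measurable_EFinP.
apply: has_cexp_real => //.
rewrite /Rintegral integral_distribution//.
exact/measurable_EFinP.
Qed.

End GUEExpectation.

(** * Traces of powers and eigenvalues *)

Section TracePowers.
Variable K : numClosedFieldType.

Lemma char_poly_similar n (P A B : 'M[K]_n) : P \in unitmx -> P *m A = B *m P ->
  char_poly A = char_poly B.
Proof.
move=> Pu PAB; pose Q := map_mx (@polyC K) P.
have detQ : \det Q != 0.
  by rewrite det_map_mx polyC_eq0 -unitfE -unitmxE.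
apply: (mulfI detQ); rewrite -det_mulmx [RHS]mulrC -det_mulmx; congr (\det _).
rewrite /char_poly_mx mulmxBr mulmxBl -!map_mxM PAB.
by rewrite mul_mx_scalar mul_scalar_mx.
Qed.

Lemma trig_mx_expE n (B : 'M[K]_n) q : is_trig_mx B ->
  is_trig_mx (B ^+ q) /\ forall i, (B ^+ q) i i = B i i ^+ q.
Proof.
move=> /is_trig_mxP tB; elim: q => [|q [/is_trig_mxP IH1 IH2]].
  split; last by move=> i; rewrite !expr0 mxE eqxx.
  by apply/is_trig_mxP => i j ij; rewrite expr0 mxE -val_eqE ltn_eqF.
split.
  apply/is_trig_mxP => i j ij; rewrite exprS -mulmxE mxE big1// => l _.
  have [il|li] := ltnP i l; first by rewrite tB// mul0r.
  by rewrite IH1 ?mulr0//; exact: leq_ltn_trans li ij.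
move=> i; rewrite exprS -mulmxE mxE (bigD1 i)//= big1 ?addr0.
  by rewrite IH2 exprS.
move=> l li; have [il|] := ltnP i l; first by rewrite tB// mul0r.
by rewrite leq_eqVlt val_eqE (negbTE li) /= => /IH1 ->; rewrite mulr0.
Qed.

(** Schur triangularization puts the eigenvalues on the diagonal. *)
Lemma mxtrace_exp_eigenvalues n (A : 'M[K]_n) (x : 'I_n -> K) q :
  char_poly A = \prod_(i < n) ('X - (x i)%:P) -> \tr (A ^+ q) = \sum_(i < n) x i ^+ q.
Proof.
case: n A x => [|n] A x cA; first by rewrite /mxtrace !big_ord0.
have [P /unitarymx_unit Pu tB] := Schur A (ltn0Sn n).
set B := conjmx P A in tB.
have PAB : P *m A = B *m P by rewrite /B conjumx// -!mulmxA mulVmx// mulmx1.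
have -> : \tr (A ^+ q) = \tr (B ^+ q).
  have PABq : P *m A ^+ q = B ^+ q *m P.
    elim: q => [|q IH]; first by rewrite !expr0 mulmx1 mul1mx.
    by rewrite !exprS -!mulmxE mulmxA PAB -mulmxA IH mulmxA.
  by rewrite -[A ^+ q](mulKmx Pu) PABq mxtrace_mulC mulmxK.
rewrite /mxtrace; under eq_bigr do rewrite (trig_mx_expE q tB).2.
have pe : perm_eq [seq x i | i <- index_enum 'I_n.+1] [seq B i i | i <- index_enum 'I_n.+1].
  apply: prod_XsubC_eq; rewrite !big_map -cA (char_poly_similar Pu PAB).
  exact: char_poly_trig.
transitivity (\sum_(y <- [seq B i i | i <- index_enum 'I_n.+1]) y ^+ q).
  by rewrite big_map.
by rewrite -(perm_big _ pe) big_map.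
Qed.

End TracePowers.

(** * The method of moments *)

Section PolynomialPrimitive.
Variable K : numFieldType.
Implicit Type p : {poly K}.

Definition poly_int p : {poly K} := \poly_(i < (size p).+1) (p`_i.-1 / i%:R).

Lemma deriv_poly_int p : (poly_int p)^`() = p.
Proof.
apply/polyP => i; rewrite coef_deriv coef_poly /= ltnS.
have [ip|pi] := ltnP i (size p); last by rewrite mul0rn nth_default.
by rewrite -[LHS]mulr_natr divfK// pnatr_eq0.
Qed.

Lemma poly_int0 p : (poly_int p).[0] = 0.
Proof. by rewrite horner_coef0 coef_poly /= invr0 mulr0. Qed.

End PolynomialPrimitive.

Section TrigonometricTaylor.
Variable R : realType.

(** Taylor polynomials of degree less than [n] of the cosine and the sine, obtained by
  alternately integrating from 0. *)
Fixpoint cos_sin_poly (n : nat) : {poly R} * {poly R} :=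
  if n is n'.+1 then
    let cs := cos_sin_poly n' in (1 - poly_int cs.2, poly_int cs.1)
  else (0, 0).

(** The mean value theorem for [x ^+ n.+1 / n.+1`! - s * f x], with [s] a sign, gives both
  bounds at once. *)
Lemma norm_le_derive (f df : R -> R) n (y : R) :
  (forall x : R, is_derive x 1 f (df x)) -> f 0 = 0 ->
  (forall x, `|df x| <= `|x| ^+ n / n`!%:R) -> 0 <= y ->
  `|f y| <= y ^+ n.+1 / n.+1`!%:R.
Proof.
move=> dF f0 bd y0.
suff H (s : R) : s ^+ 2 = 1 -> 0 <= y ^+ n.+1 / n.+1`!%:R - s * f y.
  rewrite ler_norml; apply/andP; split; rewrite -subr_ge0.
    by have := H (-1); rewrite sqrrN expr1n mulN1r !opprK addrC; apply.
  by have := H 1; rewrite expr1n mul1r; apply.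
move=> s2.
pose k x : R := x ^+ n.+1 / n.+1`!%:R - s * f x.
have dk (x : R) : is_derive x 1 k (x ^+ n / n`!%:R - s * df x).
  apply: (is_derive_eq (is_derive_subf
    (is_derive_mulf (is_derive_expf n.+1 x) (is_derive_cstf (n.+1`!%:R)^-1 x))
    (is_derive_mulf (is_derive_cstf s x) (dF x)))).
  rewrite mulr0 addr0 mul0r add0r factS natrM /=; congr (_ - _).
  have a0 : n.+1%:R != 0 :> R by rewrite pnatr_eq0.
  have b0 : n`!%:R != 0 :> R by rewrite pnatr_eq0 -lt0n fact_gt0.
  by rewrite -mulrA mulrCA invfM mulVKf// mulrCA divff ?mulr1.
have k0 : k 0 = 0 by rewrite /k expr0n f0 mul0r mulr0 subr0.
have ck : continuous k by exact: is_derive_continuous dk.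
have [c cy] := @MVT_segment R k _ 0 y y0 (fun x _ => dk x) (continuous_subspaceT ck).
rewrite k0 !subr0 -/(k y) => ->; rewrite mulr_ge0// subr_ge0.
have c0 : 0 <= c by move: cy; rewrite in_itv/= => /andP[].
have s1 : `|s| = 1 by apply/eqP; rewrite -(@eqrXn2 _ 2)// ?expr1n -?normrX ?s2 ?normr1.
apply: le_trans (ler_norm _) _; rewrite normrM s1 mul1r (le_trans (bd c))//.
by rewrite ger0_norm.
Qed.

Lemma norm_le_derive_sym (f df : R -> R) n (y : R) :
  (forall x : R, is_derive x 1 f (df x)) -> f 0 = 0 ->
  (forall x, `|df x| <= `|x| ^+ n / n`!%:R) ->
  `|f y| <= `|y| ^+ n.+1 / n.+1`!%:R.
Proof.
move=> dF f0 bd; have [y0|y0] := leP 0 y; first by rewrite (ger0_norm y0); exact: (norm_le_derive dF f0 bd y0).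
rewrite (ltr0_norm y0).
have dN (x : R) : is_derive x 1 (fun z => f (- z)) (- df (- x)).
  have hN := is_derive_subf (is_derive_cstf (0 : R) x) (is_derive_idf x).
  have hN' : is_derive x 1 (fun z : R => - z) (-1 : R).
    by apply: (is_derive_eq (is_deriveNid x 1)).
  by apply: (is_derive_eq (@is_derive1_comp R f (fun z => - z) x _ _ (dF (- x)) hN'));
    rewrite mulrN1.
have fN0 : f (- 0) = 0 by rewrite oppr0.
have bN x : `|- df (- x)| <= `|x| ^+ n / n`!%:R by rewrite normrN (le_trans (bd _))// normrN.
have yN0 : 0 <= - y by rewrite oppr_ge0 ltW.
by have := norm_le_derive dN fN0 bN yN0; rewrite /= opprK.
Qed.

Lemma cos_sin_poly_bound n : (forall y, `|cos y - (cos_sin_poly n).1.[y]| <= `|y| ^+ n / n`!%:R)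
  /\ (forall y, `|sin y - (cos_sin_poly n).2.[y]| <= `|y| ^+ n / n`!%:R).
Proof.
elim: n => [|n [IHc IHs]].
  by split=> y /=; rewrite horner0 subr0 expr0 fact0 divr1 ?cos_max ?sin_max.
split=> y.
- apply: (@norm_le_derive_sym (fun y => cos y - (cos_sin_poly n.+1).1.[y])
    (fun y => - (sin y - (cos_sin_poly n).2.[y]))) => [x| |x].
  + apply: (is_derive_eq (is_derive_subf (is_derive_cos x) (is_derive_poly _ x))).
    by rewrite /= derivB derivC sub0r hornerN deriv_poly_int opprB opprK addrC.
  + by rewrite /= !hornerE poly_int0 cos0 subr0 subrr.
  + by rewrite normrN.
- apply: (@norm_le_derive_sym (fun y => sin y - (cos_sin_poly n.+1).2.[y])
    (fun y => cos y - (cos_sin_poly n).1.[y])) => [x| |x].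
  + apply: (is_derive_eq (is_derive_subf (is_derive_sin x) (is_derive_poly _ x))).
    by rewrite /= deriv_poly_int.
  + by rewrite /= poly_int0 sin0 subrr.
  + exact: IHc.
Qed.

End TrigonometricTaylor.

Section MethodOfMoments.
Variable R : realType.
Local Notation TR := (measurableTypeR R).
Variables (nu : nat -> probability TR R) (mu : probability TR R).
Implicit Types g p q : R -> R.

(** Convergence of the integrals together with the integrability that makes the class of
  such functions a vector space. *)
Definition cvg_int g : Prop :=
  [/\ forall n, (nu n).-integrable setT (EFin \o g),
      mu.-integrable setT (EFin \o g) &
      \int[nu n]_x g x @[n --> \oo] --> \int[mu]_x g x].

Lemma cvg_intD g1 g2 : cvg_int g1 -> cvg_int g2 -> cvg_int (fun x => g1 x + g2 x).
Proof.
move=> [a1 b1 c1] [a2 b2 c2]; split.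
- by move=> n; exact: (integrable_addf measurableT (a1 n) (a2 n)).
- exact: (integrable_addf measurableT b1 b2).
rewrite RintegralD//.
have -> : (fun n => \int[nu n]_x (g1 x + g2 x)) =
    (fun n => \int[nu n]_x g1 x + \int[nu n]_x g2 x).
  by apply/funext => n; apply: RintegralD => //; [exact: a1|exact: a2].
exact: cvgD.
Qed.

Lemma cvg_intZ c g : cvg_int g -> cvg_int (fun x => c * g x).
Proof.
move=> [a1 b1 c1]; split.
- by move=> n; exact: (integrable_scalef measurableT c (a1 n)).
- exact: (integrable_scalef measurableT c b1).
rewrite RintegralZl//.
have -> : (fun n => \int[nu n]_x (c * g x)) = (fun n => c * \int[nu n]_x g x).
  by apply/funext => n; apply: RintegralZl => //; exact: a1.
by apply: cvgM => //; exact: cvg_cst.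
Qed.

Lemma eq_cvg_int g1 g2 : (forall x, g1 x = g2 x) -> cvg_int g2 -> cvg_int g1.
Proof. by move=> /funext ->. Qed.

Lemma cvg_int_cst c : cvg_int (fun=> c).
Proof.
have ic (P : probability TR R) : P.-integrable setT (EFin \o (fun=> c)).
  apply: eq_integrable (finite_measure_integrable_cst P c measurableT) => //.
have Ic (P : probability TR R) : \int[P]_x c = c.
  by rewrite Rintegral_cst// [X in fine X]probability_setT mulr1.
by split=> //; rewrite Ic (_ : (fun n => _) = fun=> c); [exact: cvg_cst|apply/funext].
Qed.

Lemma cvg_int_poly (p : {poly R}) : (forall k, cvg_int (fun x => x ^+ k)) ->
  cvg_int (horner p).
Proof.
move=> H; apply: (@eq_cvg_int _ (fun x => \sum_(i < size p) p`_i * x ^+ i)).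
  by move=> x; rewrite horner_coef.
elim: (size p) => [|n IH].
  by apply: eq_cvg_int (cvg_int_cst 0) => x; rewrite big_ord0.
apply: eq_cvg_int (cvg_intD IH (cvg_intZ p`_n (H n))) => x.
by rewrite big_ord_recr.
Qed.

(** Sandwich principle: it suffices to approximate up to an error that is dominated by a
  function with convergent and small integral. *)
Lemma cvg_int_approx g : measurable_fun setT g ->
  (forall e, 0 < e -> exists p q, [/\ cvg_int p, cvg_int q,
     forall x, `|g x - p x| <= q x & \int[mu]_x q x < e]) -> cvg_int g.
Proof.
move=> mg ap.
have ig (P : probability TR R) :
    (forall p, cvg_int p -> P.-integrable setT (EFin \o p)) ->
    P.-integrable setT (EFin \o g).
  move=> Pint; have [p [q [cp cq gpq _]]] := ap 1 ltr01.
  apply: (le_integrable measurableT _ _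
    (integrable_addf measurableT (integrable_abse (Pint _ cp)) (Pint _ cq))).
    exact/measurable_EFinP.
  move=> x _; rewrite /= lee_fin.
  rewrite [leRHS]ger0_norm; last by rewrite addr_ge0// (le_trans _ (gpq x)).
  by rewrite -lerBlDl (le_trans _ (gpq x))// lerB_dist.
have inu n : (nu n).-integrable setT (EFin \o g) by apply: ig => p [].
have imu : mu.-integrable setT (EFin \o g) by apply: ig => p [].
split=> //; apply/cvgrPdist_lt => e e0.
have e3 : 0 < e / 3 by rewrite divr_gt0.
have [p [q [cp cq gpq qe]]] := ap _ e3.
have diff (P : probability TR R) : P.-integrable setT (EFin \o g) ->
    P.-integrable setT (EFin \o p) -> P.-integrable setT (EFin \o q) ->
    `|\int[P]_x g x - \int[P]_x p x| <= \int[P]_x q x.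
  move=> Pg Pp Pq; rewrite -RintegralB//.
  have Pgp := integrable_subf measurableT Pg Pp.
  apply: (le_trans (le_normr_Rintegral _ _)) => //.
  by apply: le_Rintegral => //; exact: integrable_norm.
have [p1 p2 p3] := cp; have [q1 q2 q3] := cq.
near=> n.
have h1 : `|\int[mu]_x p x - \int[nu n]_x p x| < e / 3.
  by near: n; move/cvgrPdist_lt: p3; apply.
have h2 : `|\int[mu]_x q x - \int[nu n]_x q x| < e / 3 - \int[mu]_x q x.
  by near: n; move/cvgrPdist_lt: q3; apply; rewrite subr_gt0.
have h3 := diff mu imu p2 q2; have h4 := diff (nu n) (inu n) (p1 n) (q1 n).
move: h1 h2 h3 h4; rewrite !ltr_norml !ler_norml => /andP[a1 a2] /andP[a3 a4].
by move=> /andP[a5 a6] /andP[a7 a8]; apply/andP; split; lra.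
Unshelve. all: by end_near. Qed.

Hypothesis cvg_moments : forall k, cvg_int (fun x => x ^+ k).
Hypothesis moment_growth : forall t : R,
  t ^+ (2 * K) / (2 * K)`!%:R * \int[mu]_x x ^+ (2 * K) @[K --> \oo] --> (0 : R).

(** The error of a Taylor polynomial is dominated by a monomial, whose integral is small
  by [moment_growth]. *)
Let taylor_approx (g : R -> R) (cs : nat -> {poly R}) (t : R) :
  measurable_fun setT g ->
  (forall n y, `|g y - (cs n).[y]| <= `|y| ^+ n / n`!%:R) ->
  cvg_int (fun x => g (t * x)).
Proof.
move=> mg bd; apply: cvg_int_approx.
  by apply: measurableT_comp => //; apply: measurable_funM => //; exact: measurable_cst.
move=> e e0.
have [K _ HK] : \forall K \near \oo,
    `|0 - t ^+ (2 * K) / (2 * K)`!%:R * \int[mu]_x x ^+ (2 * K)| < e.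
  by move/cvgrPdist_lt: (moment_growth t); apply.
have {HK} := HK K (leqnn K); rewrite /= sub0r normrN => HK.
exists (fun x => (cs (2 * K)%N \Po (t *: 'X)).[x]),
  (fun x => t ^+ (2 * K) / (2 * K)`!%:R * x ^+ (2 * K)); split.
- exact: cvg_int_poly.
- exact: cvg_intZ.
- move=> x; rewrite horner_comp hornerZ hornerX (le_trans (bd _ _))//.
  have -> : `|t * x| ^+ (2 * K) = t ^+ (2 * K) * x ^+ (2 * K).
    by rewrite -exprMn !exprM real_normK ?num_real.
  by rewrite mulrAC.
- have [_ im _] := cvg_moments (2 * K).
  by rewrite RintegralZl//; exact: le_lt_trans (ler_norm _) HK.
Qed.

Lemma cvg_int_cosM t : cvg_int (fun x => cos (t * x)).
Proof.
apply: (@taylor_approx _ (fun n => (cos_sin_poly R n).1)) => [|n y].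
  by apply: continuous_measurable_fun; exact: continuous_cos.
exact: (cos_sin_poly_bound R n).1.
Qed.

Lemma cvg_int_sinM t : cvg_int (fun x => sin (t * x)).
Proof.
apply: (@taylor_approx _ (fun n => (cos_sin_poly R n).2)) => [|n y].
  by apply: continuous_measurable_fun; exact: continuous_sin.
exact: (cos_sin_poly_bound R n).2.
Qed.

(** The frequency [t] and the phase [s] make the statement stable under the product
  formula for [sin (a * x) * cos (t * x + s)]. *)
Lemma cvg_int_sinX_cos a k t s :
  cvg_int (fun x => sin (a * x) ^+ k * cos (t * x + s)).
Proof.
elim: k t s => [|k IH] t s.
  apply: eq_cvg_int (cvg_intD (cvg_intZ (cos s) (cvg_int_cosM t))
    (cvg_intZ (- sin s) (cvg_int_sinM t))) => x.
  by rewrite expr0 cosD; ring.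
apply: eq_cvg_int (cvg_intD (cvg_intZ 2^-1 (IH (a + t) (s - pi / 2)))
  (cvg_intZ 2^-1 (IH (a - t) (- s - pi / 2)))) => x.
have -> : cos ((a + t) * x + (s - pi / 2)) = sin (a * x + (t * x + s)).
  by rewrite -cosBpihalf; congr cos; ring.
have -> : cos ((a - t) * x + (- s - pi / 2)) = sin (a * x - (t * x + s)).
  by rewrite -cosBpihalf; congr cos; ring.
by rewrite sinD sinB exprS; field.
Qed.

Lemma cvg_int_poly_sin (p : {poly R}) a : cvg_int (fun x => p.[sin (a * x)]).
Proof.
have H k : cvg_int (fun x => sin (a * x) ^+ k).
  apply: eq_cvg_int (cvg_int_sinX_cos a k 0 0) => x.
  by rewrite mul0r addr0 cos0 mulr1.
apply: (@eq_cvg_int _ (fun x => \sum_(i < size p) p`_i * sin (a * x) ^+ i)).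
  by move=> x; rewrite horner_coef.
elim: (size p) => [|n IH].
  by apply: eq_cvg_int (cvg_int_cst 0) => x; rewrite big_ord0.
apply: eq_cvg_int (cvg_intD IH (cvg_intZ p`_n (H n))) => x.
by rewrite big_ord_recr.
Qed.

End MethodOfMoments.

Section Weierstrass.
Variable R : realType.

(** Bernstein polynomials, as the expectation of [phi] at the number of successes in [N]
  independent trials. *)
Fixpoint bernstein (N : nat) (phi : nat -> R) : {poly R} :=
  if N is N'.+1 then
    'X * bernstein N' (fun k => phi k.+1) + (1 - 'X) * bernstein N' phi
  else (phi 0)%:P.

Lemma bernsteinS N phi u : (bernstein N.+1 phi).[u] =
  u * (bernstein N (fun k => phi k.+1)).[u] + (1 - u) * (bernstein N phi).[u].
Proof. by rewrite /= !hornerE. Qed.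

Lemma le_bernstein N phi psi u : 0 <= u <= 1 -> (forall k, (k <= N)%N -> phi k <= psi k) ->
  (bernstein N phi).[u] <= (bernstein N psi).[u].
Proof.
move=> /andP[u0 u1]; elim: N phi psi => [|N IH] phi psi h.
  by rewrite !hornerC h.
rewrite !bernsteinS lerD// ler_wpM2l ?subr_ge0// IH// => k kN; apply: h => //.
exact: leqW.
Qed.

Lemma bernsteinD N phi psi u : (bernstein N (fun k => phi k + psi k)).[u] =
  (bernstein N phi).[u] + (bernstein N psi).[u].
Proof.
elim: N phi psi => [|N IH] phi psi; first by rewrite !hornerC.
by rewrite !bernsteinS !IH; ring.
Qed.

Lemma bernsteinZ N c phi u : (bernstein N (fun k => c * phi k)).[u] =
  c * (bernstein N phi).[u].
Proof.
elim: N phi => [|N IH] phi; first by rewrite !hornerC.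
by rewrite !bernsteinS !IH; ring.
Qed.

Lemma bernstein_cst N c u : (bernstein N (fun=> c)).[u] = c.
Proof. by elim: N => [|N IH]; rewrite ?hornerC// bernsteinS !IH; ring. Qed.

(** For [v = N%:R * u] this is the variance of the binomial law. *)
Lemma bernstein_sqr N u (v : R) : (bernstein N (fun k => (k%:R - v) ^+ 2)).[u] =
  (N%:R * u - v) ^+ 2 + N%:R * u * (1 - u).
Proof.
elim: N v => [|N IH] v; first by rewrite hornerC; ring.
rewrite bernsteinS IH.
have -> : (fun k => (k.+1%:R - v) ^+ 2) = (fun k => (k%:R - (v - 1)) ^+ 2) :> (nat -> R).
  by apply/funext => k; rewrite -natr1; ring.
by rewrite IH -natr1; ring.
Qed.

Lemma uniform_modulus (G : R -> R) (a b e : R) : continuous G -> 0 < e ->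
  exists2 d, 0 < d & forall x y, x \in `[a, b] -> `|x - y| < d -> `|G x - G y| < e.
Proof.
move=> cG e0.
have e2 : 0 < e / 2 by rewrite divr_gt0.
pose Q (d x : R) := forall y, `|x - y| < d -> `|G x - G y| < e.
have nc : \forall d \near (0 : R)^'+, `[a, b] `<=` Q d.
  have /compact_near_coveringP := @segment_compact R a b.
  move=> /(_ R (0 : R)^'+ Q _); apply => x _.
  have /cvgrPdist_lt/(_ _ e2) := cG x; rewrite near_nbhs => /nbhs_ballP[r /= r0 Hr].
  have r2 : 0 < r / 2 by rewrite divr_gt0.
  near=> x' d => y /= x'y.
  have xx' : `|x - x'| < r / 2.
    by near: x'; exact: (@nbhsx_ballx _ R^o x (r / 2) r2).
  have dr : d < r / 2 by near: d; exact: nbhs_right_lt.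
  have Gx' : `|G x - G x'| < e / 2.
    by apply: Hr; rewrite /ball /=; lra.
  have Gy : `|G x - G y| < e / 2.
    apply: Hr; rewrite /ball /= (_ : x - y = (x - x') + (x' - y)); last by ring.
    by rewrite (le_lt_trans (ler_normD _ _))//; lra.
  rewrite (_ : G x' - G y = - (G x - G x') + (G x - G y)); last by ring.
  by rewrite (le_lt_trans (ler_normD _ _))// normrN; lra.
have [d [d0 Hd]] : exists d : R, 0 < d /\ `[a, b] `<=` Q d.
  near (0 : R)^'+ => d; exists d; split; first by near: d; exact: nbhs_right_gt.
  by near: d.
by exists d => // x y xab; apply: Hd.
Unshelve. all: by end_near. Qed.

(** Weierstrass approximation on the unit segment: by the modulus of continuity, the
  deviation of [phi] is at most [e] plus a multiple of the variance of the frequency. *)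
Lemma weierstrass01 (G : R -> R) (B e : R) : continuous G -> (forall x, `|G x| <= B) ->
  0 < e -> exists p : {poly R}, forall u, 0 <= u <= 1 -> `|G u - p.[u]| <= e.
Proof.
move=> cG GB e0.
have B0 : 0 <= B by exact: le_trans (GB 0).
have e2 : 0 < e / 2 by rewrite divr_gt0.
have [d d0 Hd] := @uniform_modulus G 0 1 (e / 2) cG e2.
pose c := 2 * B / d ^+ 2.
have c0 : 0 <= c by rewrite divr_ge0 ?sqr_ge0// mulr_ge0.
have [N [N0 Nc]] : exists N : nat, (0 < N)%N /\ c / N%:R <= e / 2.
  exists (Num.bound (c / (e / 2))).+1; split=> //.
  rewrite ler_pdivrMr// mulrC -ler_pdivrMr// ltW//.
  by rewrite (lt_le_trans (archi_boundP _)) ?ler_nat// divr_ge0// ltW.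
have Nr : 0 < N%:R :> R by rewrite ltr0n.
exists (bernstein N (fun k => G (k%:R / N%:R))) => u u01.
have dev k : `|G u - G (k%:R / N%:R)| <= e / 2 + c * (N%:R^-1 ^+ 2 * (k%:R - N%:R * u) ^+ 2).
  have sqE : N%:R^-1 ^+ 2 * (k%:R - N%:R * u) ^+ 2 = (u - k%:R / N%:R) ^+ 2.
    by rewrite -exprMn -sqrrN; congr (_ ^+ 2); field; rewrite gt_eqF.
  rewrite sqE; have [lt_d|le_d] := ltP `|u - k%:R / N%:R| d.
    have u01' : u \in `[0, 1] by rewrite in_itv.
    rewrite (le_trans (ltW (Hd _ _ u01' lt_d)))//.
    by rewrite lerDl mulr_ge0// sqr_ge0.
  have : 2 * B <= c * (u - k%:R / N%:R) ^+ 2.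
    rewrite /c mulrAC ler_pdivlMr ?exprn_gt0// ler_wpM2l ?mulr_ge0//.
    by rewrite -(real_normK (num_real (u - _))) ler_sqr ?nnegrE// ltW.
  have : `|G u - G (k%:R / N%:R)| <= B + B.
    by rewrite (le_trans (ler_normB _ _))// lerD.
  by lra.
have bound s : s ^+ 2 = 1 ->
    s * (G u - (bernstein N (fun k => G (k%:R / N%:R))).[u]) <= e.
  move=> s2; have s1 : `|s| = 1.
    by apply/eqP; rewrite -(@eqrXn2 _ 2)// ?expr1n -?normrX ?s2 ?normr1.
  have -> : s * (G u - (bernstein N (fun k => G (k%:R / N%:R))).[u]) =
      (bernstein N (fun k => s * (G u + (-1) * G (k%:R / N%:R)))).[u].
    by rewrite bernsteinZ bernsteinD bernstein_cst bernsteinZ mulN1r.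
  apply: (@le_trans _ _ (bernstein N (fun k => e / 2 + c * (N%:R^-1 ^+ 2 *
     (k%:R - N%:R * u) ^+ 2))).[u]).
    apply: le_bernstein => // k _; apply: le_trans (dev k).
    by rewrite (le_trans (ler_norm _))// normrM s1 mul1r mulN1r.
  rewrite bernsteinD bernstein_cst !bernsteinZ bernstein_sqr subrr expr0n /= add0r.
  have u4 : u * (1 - u) <= 1.
    by case/andP: u01 => u0 u1; rewrite -[leRHS]mulr1 ler_pM// ?subr_ge0// lerBlDr lerDl.
  have -> : c * (N%:R^-1 ^+ 2 * (N%:R * u * (1 - u))) = c / N%:R * (u * (1 - u)).
    by field; rewrite gt_eqF.
  have cN0 : 0 <= c / N%:R by rewrite divr_ge0// ltW.
  have := ler_wpM2l cN0 u4; rewrite mulr1; lra.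
rewrite ler_norml; have := bound 1; have := bound (-1).
by rewrite sqrrN expr1n mulN1r mul1r => /(_ erefl) h1 /(_ erefl) h2; apply/andP; split; lra.
Qed.

End Weierstrass.

Section BoundedTestFunctions.
Variable R : realType.
Local Notation TR := (measurableTypeR R).
Variables (nu : nat -> probability TR R) (mu : probability TR R).
Hypothesis cvg_moments : forall k, cvg_int nu mu (fun x => x ^+ k).
Hypothesis moment_growth : forall t : R,
  t ^+ (2 * K) / (2 * K)`!%:R * \int[mu]_x x ^+ (2 * K) @[K --> \oo] --> (0 : R).

(** A continuous cutoff, which keeps the argument of [asin] in the open interval where
  [asin] is known to be continuous. *)
Definition clip (s y : R) : R := (`|y + s| - `|y - s|) / 2.

Lemma clip_id s y : `|y| <= s -> clip s y = y.
Proof.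
rewrite ler_norml => /andP[h1 h2]; rewrite /clip.
rewrite (ger0_norm (_ : 0 <= y + s)); last by lra.
by rewrite (ler0_norm (_ : y - s <= 0)); lra.
Qed.

Lemma norm_clip_le s y : 0 <= s -> `|clip s y| <= s.
Proof.
move=> s0; rewrite /clip ler_norml.
by have [h1|h1] := ger0P (y + s); have [h2|h2] := ger0P (y - s); apply/andP; split; lra.
Qed.

Lemma continuous_clip s : continuous (clip s).
Proof.
move=> y; rewrite /clip; apply: cvgM; last exact: cvg_cst.
by apply: cvgB; apply: (@cvg_norm _ R^o); [apply: cvgD|apply: cvgB];
  [exact: cvg_id|exact: cvg_cst|exact: cvg_id|exact: cvg_cst].
Qed.

(** Bounded continuous functions: on a large segment the change of variable
  [y = sin (x / (2 * A))] turns uniform approximation by polynomials in [y] into an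
  approximation that stays bounded on the whole line. *)
Lemma cvg_int_bounded (g : R -> R) (B : R) : continuous g -> (forall x, `|g x| <= B) ->
  cvg_int nu mu g.
Proof.
move=> cg gB; apply: cvg_int_approx; first exact: continuous_measurable_fun.
move=> e e0.
have B0 : 0 <= B by exact: le_trans (gB 0).
pose m2 := \int[mu]_x x ^+ 2.
have m20 : 0 <= m2 by apply: Rintegral_ge0 => x _; exact: sqr_ge0.
pose d := Num.min (e / 4) 1.
have d0 : 0 < d by rewrite lt_min ltr01 divr_gt0.
(* By Chebyshev, the error off [[- A, A]] is at most [(2 * B + 1) * m2 / A ^+ 2]. *)
pose A := 1 + (2 * B + 1) * m2 / (e / 4).
have A1 : 1 <= A by rewrite lerDl divr_ge0 ?mulr_ge0 ?addr_ge0 ?(ltW e0) ?mulr_ge0.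
have A0 : 0 < A by exact: lt_le_trans A1.
pose s : R := sin (1 / 2).
have pi1 : 1 / 2 < pi / 2 :> R by have := @pi_ge2 R; lra.
have hI : 1 / 2 \in `[- (pi / 2), pi / 2 : R] by rewrite in_itv/=; apply/andP; split; lra.
have s1 : s < 1.
  by rewrite -(@sin_pihalf R) ltr_sin ?in_itv//=; apply/andP; split; lra.
have s0 : 0 < s by apply: sin_gt0_pihalf; apply/andP; split; lra.
pose G (u : R) := g (2 * A * asin (clip s (2 * u - 1))).
have cG : continuous G.
  move=> u; rewrite /G; apply: (@cvg_comp _ _ _ _ g); last exact: cg.
  apply: cvgM; first exact: cvg_cst.
  apply: (@cvg_comp _ _ _ _ (@asin R)); last first.
    apply: continuous_asin.
    have := norm_clip_le (2 * u - 1) (ltW s0); rewrite ler_norml => /andP[h1 h2].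
    by apply/andP; split; lra.
  apply: (@cvg_comp _ _ _ _ (clip s)); last exact: continuous_clip.
  apply: cvgB; last exact: cvg_cst.
  by apply: cvgM; [exact: cvg_cst|exact: cvg_id].
have [p Hp] := weierstrass01 cG (fun u => gB _) d0.
pose v : {poly R} := 2^-1 *: (1 + 'X).
have vE y : v.[y] = 2^-1 * (1 + y) by rewrite /v !hornerE.
have ap x : `|G (2^-1 * (1 + sin ((2 * A)^-1 * x))) - (p \Po v).[sin ((2 * A)^-1 * x)]| <= d.
  rewrite horner_comp vE; apply: Hp.
  by have := sin_le1 ((2 * A)^-1 * x); have := sin_geN1 ((2 * A)^-1 * x); lra.
have Gg x : `|x| <= A -> G (2^-1 * (1 + sin ((2 * A)^-1 * x))) = g x.
  move=> xA; have th : `|(2 * A)^-1 * x| <= 1 / 2.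
    rewrite normrM gtr0_norm ?invr_gt0 ?mulr_gt0// mulrC ler_pdivrMr ?mulr_gt0//.
    by lra.
  have thI : (2 * A)^-1 * x \in `[- (pi / 2), pi / 2].
    by move: th; rewrite ler_norml in_itv/= => /andP[h1 h2]; apply/andP; split; lra.
  rewrite /G (_ : 2 * (2^-1 * _) - 1 = sin ((2 * A)^-1 * x)); last by field.
  rewrite clip_id ?sinK//; first by congr g; field; rewrite gt_eqF.
  rewrite ler_norml; move: th; rewrite ler_norml => /andP[h1 h2].
  have leS y z : y \in `[- (pi / 2), pi / 2] -> z \in `[- (pi / 2), pi / 2] ->
      y <= z -> sin y <= sin z :> R.
    by move=> yI zI; rewrite leNgt => yz; rewrite leNgt ltr_sin.
  rewrite /s -sinN !leS//.
  by rewrite in_itv/=; apply/andP; split; lra.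
exists (fun x => (p \Po v).[sin ((2 * A)^-1 * x)]),
  (fun x => d + (2 * B + 1) / A ^+ 2 * x ^+ 2); split.
- exact: cvg_int_poly_sin.
- by apply: cvg_intD; [exact: cvg_int_cst|exact: cvg_intZ].
- move=> x; have [xA|Ax] := lerP `|x| A.
    rewrite -(Gg x xA) (le_trans (ap x))// lerDl mulr_ge0 ?sqr_ge0//.
    by rewrite divr_ge0 ?sqr_ge0// addr_ge0 ?mulr_ge0.
  have h1 : 2 * B + 1 <= (2 * B + 1) / A ^+ 2 * x ^+ 2.
    rewrite mulrAC ler_pdivlMr ?exprn_gt0// ler_wpM2l ?addr_ge0 ?mulr_ge0//.
    by rewrite -(real_normK (num_real x)) ler_sqr ?nnegrE ?(ltW A0)// ltW.
  have d1 : d <= 1 by rewrite ge_min lexx orbT.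
  have := ap x; have := gB (2 * A * asin (clip s (2 * (2^-1 * (1 + sin ((2 * A)^-1 * x))) - 1))).
  rewrite -/(G _); have := gB x; rewrite !ler_norml.
  by move=> /andP[? ?] /andP[? ?] /andP[? ?]; apply/andP; split; lra.
have [_ i2 _] := cvg_moments 2.
have [_ ic _] := cvg_int_cst nu mu d.
rewrite RintegralD//; last exact: integrable_scalef.
rewrite RintegralZl// -/m2 Rintegral_cst// [X in fine X]probability_setT mulr1.
have de : d <= e / 4 by rewrite ge_min lexx.
have : (2 * B + 1) / A ^+ 2 * m2 <= e / 4.
  rewrite mulrAC ler_pdivrMr ?exprn_gt0//.
  apply: (@le_trans _ _ (e / 4 * A)); last first.
    by rewrite ler_wpM2l ?divr_ge0 ?(ltW e0)// expr2 ler_peMr// ltW.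
  rewrite /A mulrDr mulr1 [X in _ <= _ + X]mulrC divfK ?gt_eqF ?divr_gt0//.
  by rewrite lerDr divr_ge0// ltW.
by move=> h; apply: (le_lt_trans (lerD de h)); lra.
Qed.

End BoundedTestFunctions.

(** * Moments of the normal law *)

Section NormalMoments.
Variable R : realType.
Local Notation TR := (measurableTypeR R).
Local Notation mu := (@lebesgue_measure R).

Lemma normal_moment_even (s : R) K :
  normal_moment s (2 * K) = (2 * K)`!%:R / K`!%:R * (s / 2) ^+ K.
Proof.
elim: K => [|K IH]; first by rewrite muln0 /= fact0 divr1 expr0 mulr1.
rewrite mulnS !add2n /= IH !factS exprS !natrM.
have a0 : K.+1%:R != 0 :> R by rewrite pnatr_eq0.
have b0 : K`!%:R != 0 :> R by rewrite pnatr_eq0 -lt0n fact_gt0.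
have -> : (2 * K).+2%:R = 2 * K.+1%:R :> R by rewrite -natrM mulnS.
move: (K.+1%:R) (K`!%:R) a0 b0 => a b a0 b0.
by rewrite /=; field; rewrite a0 b0.
Qed.

(** By [normal_moment_even] this is the general term of an exponential series. *)
Lemma normal_moment_growth (s t : R) :
  t ^+ (2 * K) / (2 * K)`!%:R * normal_moment s (2 * K) @[K --> \oo] --> (0 : R).
Proof.
have -> : (fun K => t ^+ (2 * K) / (2 * K)`!%:R * normal_moment s (2 * K)) =
    exp_coeff (t ^+ 2 * (s / 2)).
  apply/funext => K; rewrite normal_moment_even exprM /exp_coeff /= [in RHS]exprMn.
  have b0 : (2 * K)`!%:R != 0 :> R by rewrite pnatr_eq0 -lt0n fact_gt0.
  have c0 : K`!%:R != 0 :> R by rewrite pnatr_eq0 -lt0n fact_gt0.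
  move: ((2 * K)`!%:R) (K`!%:R) b0 c0 ((t ^+ 2) ^+ K) ((s / 2) ^+ K) => b c b0 c0 x y.
  by field; rewrite b0 c0.
exact: cvg_series_cvg_0 (is_cvg_series_exp_coeff _).
Qed.

Lemma centered_normal_moment (s : R) k : 0 <= s ->
  (centered_normal s).-integrable setT (EFin \o (fun x : R => x ^+ k)) /\
  \int[centered_normal s]_x (x ^+ k) = normal_moment s k.
Proof.
rewrite /centered_normal; case: eqP => [-> _|/eqP s0 sge0].
  have mX : measurable_fun setT (EFin \o (fun x : TR => x ^+ k)).
    by apply/measurable_EFinP; exact: measurable_funX.
  split.
    apply/integrableP; split => //.
    rewrite integral_dirac//; last exact: measurableT_comp.
    by rewrite diracT mul1e ltry.
  rewrite /Rintegral integral_dirac// diracT mul1e /=.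
  by case: k mX => [|[|k]] _ //=; rewrite ?expr0// exprS mul0r// mulr0 mul0r.
have s_gt0 : 0 < s by rewrite lt_neqAle eq_sym s0.
pose a := (2 * s)^-1; have a0 : 0 < a by rewrite invr_gt0 mulr_gt0.
pose sg := Num.sqrt s; have sg0 : sg != 0 by rewrite sqrtr_eq0 -ltNge.
pose w (x : TR) : R := normal_peak sg * gauss_weight a 0 x.
have w0 (x : TR) : 0 <= w x by rewrite mulr_ge0 ?normal_peak_ge0 ?gauss_weight_ge0.
have wE x : normal_pdf 0 sg x = w x.
  rewrite normal_pdfE//= /w /normal_fun /gauss_weight subr0 sqr_sqrtr//.
  by congr (_ * expR _); rewrite /a mul0r sub0r mulNr; congr (- _); field.
have mw : measurable_fun (setT : set TR) w.
  by rewrite -(funext (wE : forall x : TR, _ = w x)); exact: measurable_normal_pdf.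
have nuE A : measurable A -> normal_prob 0 sg A = (\int[mu]_(x in A) (w x)%:E)%E.
  by move=> _; rewrite /normal_prob; apply: eq_integral => x _; rewrite wE.
have mX j : measurable_fun setT (fun x : TR => x ^+ j) by exact: measurable_funX.
have eqw j x : x ^+ j * w x = normal_peak sg * (x ^+ j * gauss_weight a 0 x).
  by rewrite /w mulrCA.
have int j : (normal_prob 0 sg).-integrable setT (EFin \o (fun x : TR => x ^+ j)).
  apply: (integrable_density w0 mw nuE (mX j)).
  have := integrable_scalef measurableT (normal_peak sg) (integrable_gauss_moment 0 a0 j).
  by apply: eq_integrable => // x _; rewrite /= eqw.
have intE j : \int[normal_prob 0 sg]_x (x ^+ j) = normal_peak sg * gauss_moment a 0 j.
  rewrite (Rintegral_density w0 mw nuE (mX j)).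
  under eq_Rintegral do rewrite eqw.
  by rewrite RintegralZl//; exact: integrable_gauss_moment.
split; first exact: int.
have S j : \int[normal_prob 0 sg]_x (x ^+ j.+1) =
    s * (j%:R * \int[normal_prob 0 sg]_x (x ^+ j.-1)).
  rewrite !intE (gauss_momentS 0 a0) mul0r mul0r add0r.
  by rewrite (_ : (2 * a)^-1 = s) /a; [ring|field].
have M0 : \int[normal_prob 0 sg]_x (x ^+ 0) = 1.
  rewrite (_ : (fun x : R => x ^+ 0) = fun=> 1); last by apply/funext => x; rewrite expr0.
  by rewrite Rintegral_cst// [X in fine X]probability_setT mulr1.
suff [] : \int[normal_prob 0 sg]_x (x ^+ k) = normal_moment s k /\
  \int[normal_prob 0 sg]_x (x ^+ k.+1) = normal_moment s k.+1 by [].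
elim: k => [|k [IH1 IH2]]; first by rewrite M0 S /= mul0r mulr0.
by split=> //; rewrite S /= IH1; ring.
Qed.

End NormalMoments.

(** * Contour integrals along piecewise smooth curves *)

Section ComplexIntegralUnion.
Context d (T : measurableType d) (R : realType).
Variable P : {measure set T -> \bar R}.
Implicit Types (F : T -> R[i]) (A B : set T).

Lemma integrable_setU A B (f : T -> R) : measurable A -> measurable B ->
  [disjoint A & B] -> P.-integrable A (EFin \o f) -> P.-integrable B (EFin \o f) ->
  P.-integrable (A `|` B) (EFin \o f).
Proof.
move=> mA mB AB /integrableP[mf fA] /integrableP[mg fB]; apply/integrableP; split.
  by apply/measurable_funU.
rewrite ge0_integral_setU//; first by rewrite lte_add_pinfty.
by apply: measurableT_comp => //; apply/measurable_funU.
Qed.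

Lemma has_cexp_setU A B F a b : measurable A -> measurable B ->
  [disjoint A & B] -> has_cexp P A F a -> has_cexp P B F b ->
  has_cexp P (A `|` B) F (a + b).
Proof.
move=> mA mB AB [A1 A2 A3 A4] [B1 B2 B3 B4].
split; try exact: integrable_setU.
- by rewrite Rintegral_setU//; [rewrite A3 B3 ReD|exact: integrable_setU].
- by rewrite Rintegral_setU//; [rewrite A4 B4 ImD|exact: integrable_setU].
Qed.

Lemma has_cexp_set0 F : has_cexp P set0 F 0.
Proof. by split; rewrite ?Rintegral_set0//; exact: integrable_set0. Qed.

Lemma eq_in_has_cexp A F G a : measurable A ->
  (forall t, A t -> F t = G t) -> has_cexp P A G a -> has_cexp P A F a.
Proof.
move=> mA FG [A1 A2 A3 A4]; split.
- by apply: eq_integrable A1 => // t /set_mem At; rewrite /= FG.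
- by apply: eq_integrable A2 => // t /set_mem At; rewrite /= FG.
- by rewrite -A3; apply: eq_Rintegral => t /set_mem At; rewrite FG.
- by rewrite -A4; apply: eq_Rintegral => t /set_mem At; rewrite FG.
Qed.

End ComplexIntegralUnion.

Section ComplexIntegralSet1.
Variable R : realType.
Local Notation mu := (@lebesgue_measure R).
Implicit Types (F : R -> R[i]) (a b : R).

Lemma integrable_set1 (f : R -> R) a : mu.-integrable [set a] (EFin \o f).
Proof.
apply/integrableP; split; last by rewrite integral_set1.
exact: measurable_fun_set1.
Qed.

Lemma has_cexp_set1 F a : has_cexp mu [set a] F 0.
Proof. by split; rewrite ?Rintegral_set1//; exact: integrable_set1. Qed.

Lemma has_cexp_co_oo F a b v : a < b -> has_cexp mu `]a, b[ F v -> has_cexp mu `[a, b[ F v.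
Proof.
move=> ab Fv; have -> : `[a, b[%classic = [set a] `|` `]a, b[.
  by rewrite setU1itv// bnd_simp.
rewrite -[v]add0r; apply: has_cexp_setU => //; last exact: has_cexp_set1.
by apply/disj_set2P; apply/seteqP; split=> // x [/= ->]; rewrite in_itv/= ltxx.
Qed.

Lemma has_cexp_cc_co F a b v : a < b -> has_cexp mu `[a, b[ F v -> has_cexp mu `[a, b] F v.
Proof.
move=> ab Fv; have -> : `[a, b]%classic = `[a, b[ `|` [set b].
  by rewrite setUitv1// bnd_simp ltW.
rewrite -[v]addr0; apply: has_cexp_setU => //; last exact: has_cexp_set1.
by apply/disj_set2P; apply/seteqP; split=> // x [/= + xb]; rewrite in_itv/= xb ltxx andbF.
Qed.

Lemma has_cexp_co_cat F a x b u v : a <= x -> x <= b ->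
  has_cexp mu `[a, x[ F u -> has_cexp mu `[x, b[ F v -> has_cexp mu `[a, b[ F (u + v).
Proof.
move=> ax xb Fu Fv; have -> : `[a, b[%classic = `[a, x[ `|` `[x, b[.
  by rewrite -itv_bndbnd_setU ?bnd_simp.
apply: has_cexp_setU => //.
apply/disj_set2P; apply/seteqP; split=> // y [] /=; rewrite !in_itv/=.
by move=> /andP[_ yx] /andP[xy _]; move: (lt_le_trans yx xy); rewrite ltxx.
Qed.

End ComplexIntegralSet1.

Section DerivativeAlongCurves.
Variable R : realType.
Local Notation C := R[i].
Implicit Types (c : R -> C) (F G : C -> C) (t : R) (u v w z : C).

Lemma is_derive_oppf (f : R -> R) (t df : R) : is_derive t 1 f df ->
  is_derive t 1 (fun s => - f s) (- df).
Proof. exact: is_deriveN. Qed.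

Lemma is_derive_invf (f : R -> R) (t df : R) : f t != 0 -> is_derive t 1 f df ->
  is_derive t 1 (fun s => (f s)^-1) (- (f t) ^- 2 * df).
Proof.
move=> f0 [fd <-]; apply: DeriveDef; first exact: derivableV.
by rewrite deriveV.
Qed.

Definition cderiv c t v : Prop :=
  is_derive t 1 (fun s => complex.Re (c s)) (complex.Re v) /\
  is_derive t 1 (fun s => complex.Im (c s)) (complex.Im v).

Lemma cderivD c1 c2 t v1 v2 : cderiv c1 t v1 -> cderiv c2 t v2 ->
  cderiv (fun s => c1 s + c2 s) t (v1 + v2).
Proof.
move=> [r1 i1] [r2 i2]; split.
  have -> : (fun s => complex.Re (c1 s + c2 s)) =
      (fun s => complex.Re (c1 s) + complex.Re (c2 s)) by apply/funext => s; rewrite ReD.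
  by rewrite ReD; exact: is_derive_addf.
have -> : (fun s => complex.Im (c1 s + c2 s)) =
    (fun s => complex.Im (c1 s) + complex.Im (c2 s)) by apply/funext => s; rewrite ImD.
by rewrite ImD; exact: is_derive_addf.
Qed.

Lemma cderivM c1 c2 t v1 v2 : cderiv c1 t v1 -> cderiv c2 t v2 ->
  cderiv (fun s => c1 s * c2 s) t (v1 * c2 t + c1 t * v2).
Proof.
move=> [r1 i1] [r2 i2]; split.
  have -> : (fun s => complex.Re (c1 s * c2 s)) =
      (fun s => complex.Re (c1 s) * complex.Re (c2 s) - complex.Im (c1 s) * complex.Im (c2 s)).
    by apply/funext => s; rewrite ReM.
  apply: (is_derive_eq (is_derive_subf (is_derive_mulf r1 r2) (is_derive_mulf i1 i2))).
  by rewrite ReD !ReM; ring.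
have -> : (fun s => complex.Im (c1 s * c2 s)) =
    (fun s => complex.Re (c1 s) * complex.Im (c2 s) + complex.Im (c1 s) * complex.Re (c2 s)).
  by apply/funext => s; rewrite ImM.
apply: (is_derive_eq (is_derive_addf (is_derive_mulf r1 i2) (is_derive_mulf i1 r2))).
by rewrite ImD !ImM; ring.
Qed.

Lemma cderiv_cst (a : C) t : cderiv (fun=> a) t 0.
Proof. by split; exact: is_derive_cstf. Qed.

Lemma sqr_norm_neq0 (z : C) : z != 0 -> complex.Re z ^+ 2 + complex.Im z ^+ 2 != 0.
Proof.
case: z => a b; rewrite eq_complex /= negb_and => /orP[] h; rewrite paddr_eq0 ?sqr_ge0//.
  by rewrite !sqrf_eq0 (negbTE h).
by rewrite !sqrf_eq0 (negbTE h) andbF.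
Qed.

Lemma cderivV c t v : c t != 0 -> cderiv c t v ->
  cderiv (fun s => (c s)^-1) t (- (c t)^-1 ^+ 2 * v).
Proof.
move=> c0 [r1 i1]; have n0 := sqr_norm_neq0 c0.
have dn := @is_derive_invf (fun s => complex.Re (c s) * complex.Re (c s)
  + complex.Im (c s) * complex.Im (c s)) t _ n0 (is_derive_addf (is_derive_mulf r1 r1) (is_derive_mulf i1 i1)).
have rE s : complex.Re (c s)^-1 =
  complex.Re (c s) * (complex.Re (c s) * complex.Re (c s) + complex.Im (c s) * complex.Im (c s))^-1.
  by case: (c s) => a b /=; rewrite -!expr2.
have iE s : complex.Im (c s)^-1 =
  - (complex.Im (c s) * (complex.Re (c s) * complex.Re (c s) + complex.Im (c s) * complex.Im (c s))^-1).
  by case: (c s) => a b /=; rewrite -!expr2.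
split.
  rewrite (funext rE).
  apply: (is_derive_eq (is_derive_mulf r1 dn)).
  move: n0 c0 {rE iE dn r1 i1}; case: (c t) => a b /= n0 _; case: v => x y.
  by rewrite expr2 /=; field.
rewrite (funext iE).
apply: (is_derive_eq (is_derive_oppf (is_derive_mulf i1 dn))).
move: n0 c0 {rE iE dn r1 i1}; case: (c t) => a b /= n0 _; case: v => x y.
by rewrite expr2 /=; field.
Qed.

(** The chain rule along curves through [z]. It is all that the fundamental theorem of
  calculus along a contour needs of a complex derivative, and it is stable under algebraic
  operations. *)
Definition cdiff F z v : Prop :=
  forall c t u, c t = z -> cderiv c t u -> cderiv (fun s => F (c s)) t (v * u).

Lemma cdiff_eq F z v w : cdiff F z v -> v = w -> cdiff F z w.
Proof. by move=> + <-. Qed.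

Lemma cdiff_cst (a : C) z : cdiff (fun=> a) z 0.
Proof. by move=> c t u _ _; rewrite mul0r; exact: cderiv_cst. Qed.

Lemma cdiff_id z : cdiff (fun y => y) z 1.
Proof. by move=> c t u _; rewrite mul1r. Qed.

Lemma cdiffD F G z v w : cdiff F z v -> cdiff G z w ->
  cdiff (fun y => F y + G y) z (v + w).
Proof.
by move=> hF hG c t u ct cu; rewrite mulrDl; apply: cderivD; [exact: hF|exact: hG].
Qed.

Lemma cdiffM F G z v w : cdiff F z v -> cdiff G z w ->
  cdiff (fun y => F y * G y) z (v * G z + F z * w).
Proof.
move=> hF hG c t u ct cu; have := cderivM (hF c t u ct cu) (hG c t u ct cu).
by rewrite ct; congr cderiv; ring.
Qed.

Lemma cdiffV F z v : F z != 0 -> cdiff F z v ->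
  cdiff (fun y => (F y)^-1) z (- (F z)^-1 ^+ 2 * v).
Proof.
move=> F0 hF c t u ct cu.
by have := cderivV (c := fun s => F (c s)) _ (hF c t u ct cu); rewrite ct mulrA; apply.
Qed.

Lemma cdiff_sum (I : Type) (s : seq I) (F : I -> C -> C) (v : I -> C) z :
  (forall i, cdiff (F i) z (v i)) ->
  cdiff (fun y => \sum_(i <- s) F i y) z (\sum_(i <- s) v i).
Proof.
move=> Fv; elim: s => [|i s IH].
  have -> : (fun y => \sum_(i <- [::]) F i y) = (fun=> 0) by apply/funext => y; rewrite big_nil.
  by rewrite big_nil; exact: cdiff_cst.
have -> : (fun y => \sum_(j <- i :: s) F j y) = (fun y => F i y + \sum_(j <- s) F j y).
  by apply/funext => y; rewrite big_cons.
by rewrite big_cons; exact: cdiffD.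
Qed.

Lemma cdiff_horner (p : {poly C}) F z v : cdiff F z v ->
  cdiff (fun y => p.[F y]) z (p^`().[F z] * v).
Proof.
move=> Fv; elim/poly_ind: p => [|p a IH].
  have -> : (fun y => (0 : {poly C}).[F y]) = (fun=> 0) by apply/funext => y; rewrite horner0.
  by rewrite deriv0 horner0 mul0r; exact: cdiff_cst.
have -> : (fun y => (p * 'X + a%:P).[F y]) = (fun y => p.[F y] * F y + a).
  by apply/funext => y; rewrite !hornerE.
apply: (cdiff_eq (cdiffD (cdiffM IH Fv) (@cdiff_cst a z))).
by rewrite derivD derivM derivX derivC !hornerE; ring.
Qed.

End DerivativeAlongCurves.

Section ContourIntegral.
Variables (R : realType) (gamma : R -> R[i]).
Local Notation C := R[i].
Local Notation mu := (@lebesgue_measure R).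
Local Notation Re := (@complex.Re R).
Local Notation Im := (@complex.Im R).
Implicit Types (F G : C -> C) (a b t : R).

Definition C1_on (u : R -> R) a b : Prop := exists g : R -> R,
  [/\ forall t, derivable g t 1, continuous (derive1 g) & {in `[a, b], u =1 g}].

Lemma C1_onS (u : R -> R) a b a' b' : a <= a' -> b' <= b -> C1_on u a b -> C1_on u a' b'.
Proof.
move=> aa bb [g [g1 g2 g3]]; exists g; split=> // t; rewrite in_itv/= => /andP[h1 h2].
by apply: g3; rewrite in_itv/= (le_trans aa)//= (le_trans h2).
Qed.

Definition contour_integrand G (t : R) : C := G (gamma t) * contour_velocity gamma t.

Lemma cdiff_cont F z v c t u : cdiff F z v -> c t = z -> cderiv c t u ->
  {for t, continuous (fun s => Re (F (c s)))} /\ {for t, continuous (fun s => Im (F (c s)))}.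
Proof.
move=> Fv ct cu; have [dr di] := Fv c t u ct cu.
by split; apply/differentiable_continuous/derivable1_diffP; [case: dr|case: di].
Qed.

Definition smooth_on_contour a b G := forall t, a <= t <= b -> exists v, cdiff G (gamma t) v.

(** On a smooth piece the integrand coincides, off the end points, with a continuous
  function. *)
Lemma has_cexp_piece a b G : a < b -> C1_on (Re \o gamma) a b -> C1_on (Im \o gamma) a b ->
  smooth_on_contour a b G ->
  exists2 v, has_cexp mu `[a, b[ (contour_integrand G) v &
    forall F, (forall t, a <= t <= b -> cdiff F (gamma t) (G (gamma t))) ->
      v = F (gamma b) - F (gamma a).
Proof.
move=> ab [gx [dgx cgx gxE]] [gy [dgy cgy gyE]] sG.
pose c t : C := gx t +i* gy t; pose u t : C := derive1 gx t +i* derive1 gy t.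
have cu t : cderiv c t (u t).
  by split=> /=; rewrite derive1E; exact: DeriveDef.
have gcE t : a <= t <= b -> gamma t = c t.
  move=> tab; have tab' : t \in `[a, b] by rewrite in_itv.
  by apply/eqP; rewrite eq_complex/= -gxE// -gyE//= !eqxx.
pose phi t := G (c t) * u t.
have cphi : {within `[a, b], continuous (fun t => Re (phi t))} /\
            {within `[a, b], continuous (fun t => Im (phi t))}.
  have cG t : t \in (`[a, b]%classic : set R) -> {for t, continuous (fun s => Re (G (c s)))} /\
      {for t, continuous (fun s => Im (G (c s)))}.
    rewrite inE/= in_itv/= => tab; have [v Gv] := sG t tab.
    by apply: (cdiff_cont Gv _ (cu t)); rewrite gcE.
  split; apply: continuous_in_subspaceT => t /cG[c1 c2].
    have -> : (fun s => Re (phi s)) = (fun s => Re (G (c s)) * derive1 gx s - Im (G (c s)) * derive1 gy s).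
      by apply/funext => s; rewrite /phi ReM.
    by apply: cvgB; apply: cvgM; [exact: c1|exact: cgx|exact: c2|exact: cgy].
  have -> : (fun s => Im (phi s)) = (fun s => Re (G (c s)) * derive1 gy s + Im (G (c s)) * derive1 gx s).
    by apply/funext => s; rewrite /phi ImM.
  by apply: cvgD; apply: cvgM; [exact: c1|exact: cgy|exact: c2|exact: cgx].
have [cphir cphii] := cphi.
have ir := continuous_compact_integrable (@segment_compact R a b) cphir.
have ii := continuous_compact_integrable (@segment_compact R a b) cphii.
have sub : `]a, b[ `<=` `[a, b] by apply: subset_itv_oo_cc.
have iro : mu.-integrable `]a, b[ (EFin \o (fun t => Re (phi t))) by apply: integrableS ir.
have iio : mu.-integrable `]a, b[ (EFin \o (fun t => Im (phi t))) by apply: integrableS ii.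
exists (\int[mu]_(t in `[a, b]) Re (phi t) +i* \int[mu]_(t in `[a, b]) Im (phi t)).
  apply: (has_cexp_co_oo ab).
  apply: (@eq_in_has_cexp _ _ _ mu _ _ phi); first exact: measurable_itv.
    move=> t /=; rewrite in_itv/= => tab.
    have tab' : a <= t <= b by case/andP: tab => /ltW -> /ltW ->.
    rewrite /contour_integrand /phi gcE//; congr (_ * _).
    have nt : \forall s \near t, gamma s = c s.
      have : t \in `]a, b[ by rewrite in_itv.
      move=> /near_in_itvoo; apply: filterS => s; rewrite in_itv/= => /andP[/ltW sa /ltW sb].
      by rewrite gcE// sa.
    rewrite /contour_velocity /u !derive1E; congr Complex; apply: near_eq_derive;
      by apply: filterS nt => s /= ->.
  split=> /=.
  - exact: iro.
  - exact: iio.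
  - rewrite /Rintegral [in RHS]integral_itv_bndoo//.
    exact: (measurable_int mu iro).
  - rewrite /Rintegral [in RHS]integral_itv_bndoo//.
    exact: (measurable_int mu iio).
move=> F dF.
have dFc t : a <= t <= b -> cderiv (fun s => F (c s)) t (phi t).
  by move=> tab; rewrite /phi -gcE//; apply: (dF t tab) => //; rewrite gcE.
rewrite !gcE ?lexx ?ltW//.
rewrite (Rintegral_segment_derive (ltW ab) (fun t tab => (dFc t tab).1) cphir).
rewrite (Rintegral_segment_derive (ltW ab) (fun t tab => (dFc t tab).2) cphii).
by case: (F (c b)) => ? ?; case: (F (c a)).
Qed.

Fixpoint pieces (u : R -> R) a (s : seq R) : Prop :=
  if s is b :: s' then [/\ a < b, C1_on u a b & pieces u b s'] else True.

Lemma pieces_le (u : R -> R) s : forall a, pieces u a s -> a <= last a s.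
Proof. by elim: s => [|b s IH] a //= [/ltW ab _ /IH]; exact: le_trans. Qed.

Lemma piecewise_C1_pieces (u : R -> R) : piecewise_C1 u ->
  exists2 s, pieces u 0 s & last 0 s = 1.
Proof.
have H s : forall a, path <%O a s ->
    (forall i, (i < size s)%N -> C1_on u (nth 0 (a :: s) i) (nth 0 s i)) -> pieces u a s.
  elim: s => [|b s IH] a //= /andP[ab bs] sg; split=> //; first exact: (sg 0%N).
  by apply: IH => // i si; exact: (sg i.+1).
by case=> s [sp /eqP sl] sg; exists s => //; exact: H.
Qed.

(** The two coordinates of [gamma] come with different subdivisions; an inductive predicate
  for a common one avoids all indexing. *)
Inductive smooth_pieces : R -> R -> Prop :=
| smooth_nil a : smooth_pieces a a
| smooth_cons a x b : a < x -> C1_on (Re \o gamma) a x -> C1_on (Im \o gamma) a x ->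
    smooth_pieces x b -> smooth_pieces a b.

(** Walk along both subdivisions at once, cutting the longer of the two current pieces at
  the end of the shorter one. *)
Lemma smooth_pieces_merge n s1 s2 a b : (size s1 + size s2 <= n)%N ->
  pieces (Re \o gamma) a s1 -> pieces (Im \o gamma) a s2 ->
  last a s1 = b -> last a s2 = b -> smooth_pieces a b.
Proof.
elim: n s1 s2 a => [|n IH] [|x s1] [|y s2] a //= sz.
- by move=> _ _ -> _; exact: smooth_nil.
- by move=> _ _ -> _; exact: smooth_nil.
- by move=> _ [ay _ /pieces_le yl] <- lE; move: (lt_le_trans ay yl); rewrite lE ltxx.
- by move=> [ax _ /pieces_le xl] _ lE ab; move: (lt_le_trans ax xl); rewrite lE ab ltxx.
move=> [ax rx ps1] [ay iy ps2] l1 l2; have [xy|yx|xy] := ltgtP x y.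
- apply: (smooth_cons ax rx (C1_onS (lexx _) (ltW xy) iy)).
  apply: (IH s1 (y :: s2)) => //=.
  by split=> //; apply: (C1_onS (ltW ax) _ iy).
- apply: (smooth_cons ay (C1_onS (lexx _) (ltW yx) rx) iy).
  apply: (IH (x :: s1) s2) => //=; first by rewrite addSn -addnS.
  by split=> //; apply: (C1_onS (ltW ay) _ rx).
- rewrite xy in ax rx ps1 l1; apply: (smooth_cons ay rx iy).
  by apply: (IH s1 s2) => //; rewrite addnS in sz; apply: leq_trans (leqnSn _) sz.
Qed.

Lemma smooth_pieces_le a b : smooth_pieces a b -> a <= b.
Proof. by move=> sp; elim: sp => // {}a x {}b /ltW ax _ _ _; exact: le_trans. Qed.

Lemma has_cexp_pieces G a b : smooth_pieces a b -> smooth_on_contour a b G ->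
  exists2 v, has_cexp mu `[a, b[ (contour_integrand G) v &
    forall F, (forall t, a <= t <= b -> cdiff F (gamma t) (G (gamma t))) ->
      v = F (gamma b) - F (gamma a).
Proof.
move=> sp; elim: sp => [{}a|{}a x {}b ax rx ix /smooth_pieces_le xb IH] sG.
  exists 0; last by move=> F _; rewrite subrr.
  rewrite set_itv_ge ?bnd_simp ?ltxx//; exact: has_cexp_set0.
have [|v Gv Fv] := @has_cexp_piece a x G ax rx ix.
  by move=> t /andP[at_ tx]; apply: sG; rewrite at_ (le_trans tx).
have [|u Gu Fu] := IH.
  by move=> t /andP[xt tb]; apply: sG; rewrite tb (le_trans (ltW ax)).
exists (v + u); first exact: has_cexp_co_cat (ltW ax) xb Gv Gu.
move=> F dF; rewrite (Fv F) ?(Fu F); first by ring.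
  by move=> t /andP[xt tb]; apply: dF; rewrite tb (le_trans (ltW ax)).
by move=> t /andP[at_ tx]; apply: dF; rewrite at_ (le_trans tx).
Qed.

Hypothesis gammaRe : piecewise_C1 (Re \o gamma).
Hypothesis gammaIm : piecewise_C1 (Im \o gamma).

Definition smooth_along G := smooth_on_contour 0 1 G.

(** Integrability, together with the fundamental theorem of calculus along [gamma]. *)
Lemma has_cexp_contour G : smooth_along G ->
  exists2 v, has_cexp mu `[0, 1] (contour_integrand G) v &
    forall F, (forall t, 0 <= t <= 1 -> cdiff F (gamma t) (G (gamma t))) ->
      v = F (gamma 1) - F (gamma 0).
Proof.
have [s1 ps1 l1] := piecewise_C1_pieces gammaRe.
have [s2 ps2 l2] := piecewise_C1_pieces gammaIm.
have sp : smooth_pieces 0 1 := smooth_pieces_merge (leqnn _) ps1 ps2 l1 l2.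
move=> /(has_cexp_pieces sp)[v Gv Fv]; exists v => //.
exact: (has_cexp_cc_co ltr01 Gv).
Qed.

Lemma contour_integral_eq G v : has_cexp mu `[0, 1] (contour_integrand G) v ->
  contour_integral gamma G = v.
Proof.
case=> _ _ rv iv; rewrite /contour_integral.
by apply/eqP; rewrite eq_complex/= -rv -iv !eqxx.
Qed.

Lemma has_contour G : smooth_along G ->
  has_cexp mu `[0, 1] (contour_integrand G) (contour_integral gamma G).
Proof. by case/has_cexp_contour => v Gv _; rewrite (contour_integral_eq Gv). Qed.

Lemma contour_integral_derive F G : smooth_along G ->
  (forall t, 0 <= t <= 1 -> cdiff F (gamma t) (G (gamma t))) ->
  contour_integral gamma G = F (gamma 1) - F (gamma 0).
Proof.
by case/has_cexp_contour => v Gv Fv dF; rewrite (contour_integral_eq Gv); exact: Fv.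
Qed.

End ContourIntegral.

(** * Residues and the limiting variance *)

Section Residues.
Variables (R : realType) (gamma : R -> R[i]).
Local Notation C := R[i].
Local Notation mu := (@lebesgue_measure R).
Hypothesis gamma_contour : simple_closed_contour gamma.
Implicit Types (F G N : C -> C) (p q z r : C) (P : {poly C}).

Let gammaRe : piecewise_C1 (@complex.Re R \o gamma).
Proof. by case: gamma_contour. Qed.
Let gammaIm : piecewise_C1 (@complex.Im R \o gamma).
Proof. by case: gamma_contour. Qed.
Let gamma_closed : gamma 0 = gamma 1.
Proof. by case: gamma_contour. Qed.

Definition on_contour z := exists2 t, 0 <= t <= 1 & gamma t = z.

Definition cdiff_on_contour F G := forall z, on_contour z -> cdiff F z (G z).

Definition residue G : C := (two_pi_i R)^-1 * contour_integral gamma G.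

(** [r] is the sum of the residues of [G] at the points that [gamma] encircles. *)
Definition has_res G r : Prop :=
  has_cexp mu `[0, 1] (contour_integrand gamma G) (two_pi_i R * r).

Lemma two_pi_i_neq0 : two_pi_i R != 0.
Proof.
rewrite /two_pi_i eq_complex /= negb_and mulf_eq0 negb_or; apply/orP; right.
by rewrite pnatr_eq0 /= gt_eqF// pi_gt0.
Qed.

Lemma has_resE G r : has_res G r -> residue G = r.
Proof.
by move=> /contour_integral_eq h; rewrite /residue h mulKf// two_pi_i_neq0.
Qed.

Lemma has_res_unique G r s : has_res G r -> has_res G s -> r = s.
Proof. by move=> /has_resE <- /has_resE. Qed.

Lemma eq_has_res F G r : (forall z, on_contour z -> F z = G z) -> has_res G r -> has_res F r.
Proof.
move=> FG; apply: eq_in_has_cexp; first exact: measurable_itv.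
move=> t /=; rewrite in_itv/= => t01.
by rewrite /contour_integrand FG//; exists t.
Qed.

Lemma has_resD F G r s : has_res F r -> has_res G s -> has_res (fun z => F z + G z) (r + s).
Proof.
move=> Fr Gs; rewrite /has_res mulrDr.
apply: eq_has_cexp (has_cexpD _ Fr Gs) => [t|]; last exact: measurable_itv.
by rewrite /contour_integrand mulrDl.
Qed.

Lemma has_resZ (a : C) F r : has_res F r -> has_res (fun z => a * F z) (a * r).
Proof.
move=> Fr; rewrite /has_res mulrCA.
apply: eq_has_cexp (has_cexpZ _ a Fr) => [t|]; last exact: measurable_itv.
by rewrite /contour_integrand mulrA.
Qed.

Lemma has_res0 : has_res (fun=> 0) 0.
Proof.
rewrite /has_res mulr0; apply: (eq_has_cexp (G := fun=> 0)) => [t|]; last first.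
  by apply: has_cexp0; exact: measurable_itv.
by rewrite /contour_integrand mul0r.
Qed.

Lemma has_res_sum (I : Type) (s : seq I) (F : I -> C -> C) (r : I -> C) :
  (forall i, has_res (F i) (r i)) ->
  has_res (fun z => \sum_(i <- s) F i z) (\sum_(i <- s) r i).
Proof.
move=> Fr; elim: s => [|i s IH].
  by rewrite big_nil; apply: eq_has_res has_res0 => z _; rewrite big_nil.
rewrite big_cons; apply: eq_has_res (has_resD (Fr i) IH) => z _.
by rewrite big_cons.
Qed.

Lemma cdiff_smooth_along F F' : cdiff_on_contour F F' -> smooth_along gamma F.
Proof. by move=> dF t t01; exists (F' (gamma t)); apply: dF; exists t. Qed.

Lemma residue_has_res F F' : cdiff_on_contour F F' -> has_res F (residue F).
Proof.
move=> /cdiff_smooth_along sF; rewrite /has_res /residue mulrA divff ?two_pi_i_neq0// mul1r.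
exact: has_contour.
Qed.

(** As the contour is closed, the boundary terms cancel. *)
Lemma has_res_derive F F' F'' : cdiff_on_contour F F' -> cdiff_on_contour F' F'' ->
  has_res F' 0.
Proof.
move=> dF dF'; have := residue_has_res dF'; rewrite /residue.
rewrite (contour_integral_derive gammaRe gammaIm (cdiff_smooth_along dF') (F := F)).
  by rewrite gamma_closed subrr mulr0.
by move=> t t01; apply: dF; exists t.
Qed.

Lemma has_res_poly P : has_res (fun z => P.[z]) 0.
Proof.
have dP P1 : cdiff_on_contour (fun z => P1.[z]) (fun z => P1^`().[z]).
  by move=> z _; apply: (cdiff_eq (cdiff_horner P1 (@cdiff_id _ z))); rewrite mulr1.
rewrite -(deriv_poly_int P); exact: (has_res_derive (dP (poly_int P)) (dP _)).
Qed.

Definition inside p := ccw_around gamma p.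

Definition pole_part p (k : nat) z : C := (z - p)^-1 ^+ k.+1.

Lemma inside_neq0 p z : inside p -> on_contour z -> z - p != 0.
Proof. by move=> [gp _] [t t01 <-]; rewrite subr_eq0 gp// in_itv. Qed.

Lemma cdiff_pole_part p k : inside p ->
  cdiff_on_contour (pole_part p k) (fun z => - k.+1%:R * pole_part p k.+1 z).
Proof.
move=> ip z oz; have zp := inside_neq0 ip oz.
have d0 := @cdiffV _ (fun y => y - p) z _ zp (cdiffD (@cdiff_id _ z) (@cdiff_cst _ (- p) z)).
have := cdiff_horner ('X^(k.+1) : {poly C}) d0.
have -> : (fun y : C => ('X^(k.+1) : {poly C}).[(y - p)^-1]) = pole_part p k.
  by apply/funext => y; rewrite hornerXn.
move/cdiff_eq; apply; rewrite derivXn hornerMn hornerXn /pole_part /=.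
by rewrite addr0 mulr1 -mulr_natl !exprS expr0; ring.
Qed.

Lemma has_res_pole_part p k : inside p -> has_res (pole_part p k) (k == 0)%:R.
Proof.
move=> ip; case: k => [|k].
  have := residue_has_res (cdiff_pole_part 0 ip); rewrite /residue.
  have -> : pole_part p 0 = (fun z => (z - p)^-1).
    by apply/funext => z; rewrite /pole_part expr1.
  by case: (ip) => _ ->; rewrite mulVf ?two_pi_i_neq0.
have dk := cdiff_pole_part k.+1 ip; have dk0 := cdiff_pole_part k ip.
have k0 : - k.+1%:R != 0 :> C by rewrite oppr_eq0 pnatr_eq0.
have h : has_res (fun z => - k.+1%:R * pole_part p k.+1 z) 0.
  apply: (has_res_derive dk0 (F'' := fun z => - k.+1%:R * (- k.+2%:R * pole_part p k.+2 z))).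
  move=> z oz; apply: (cdiff_eq (cdiffM (@cdiff_cst _ (- k.+1%:R) z) (dk z oz))).
  by rewrite mul0r add0r.
have := has_resZ (- k.+1%:R)^-1 h; rewrite mulr0; apply: eq_has_res => z _.
by rewrite mulKf.
Qed.

(** The rational functions that vanish at infinity and have all their poles inside
  [gamma], given by their partial fraction expansion; only simple poles contribute to the
  residue [r]. *)
Inductive polar : (C -> C) -> C -> Prop :=
| polar_zero : polar (fun=> 0) 0
| polar_cons a p k N r : inside p -> polar N r ->
    polar (fun z => a * pole_part p k z + N z) (a * (k == 0)%:R + r)
| polar_ext N N' r : (forall z, on_contour z -> N' z = N z) -> polar N r -> polar N' r.

Lemma polar_has_res N r : polar N r -> has_res N r.
Proof.
elim=> [|a p k {}N {}r ip _ IH|{}N N' {}r NE _ IH]; first exact: has_res0.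
  by apply: has_resD => //; apply: has_resZ; exact: has_res_pole_part.
exact: eq_has_res IH.
Qed.

Lemma polarD N N' r r' : polar N r -> polar N' r' -> polar (fun z => N z + N' z) (r + r').
Proof.
move=> pN pN'; elim: pN => [|a p k {}N {}r ip _ IH|{}N N1 {}r NE _ IH].
- by rewrite add0r; apply: polar_ext pN' => z _; rewrite add0r.
- by rewrite -addrA; apply: polar_ext (polar_cons a k ip IH) => z _; rewrite addrA.
- by apply: polar_ext IH => z oz; rewrite NE.
Qed.

Lemma polarZ (a : C) N r : polar N r -> polar (fun z => a * N z) (a * r).
Proof.
elim=> [|b p k {}N {}r ip _ IH|{}N N1 {}r NE _ IH].
- by rewrite mulr0; exact: polar_zero.
- rewrite mulrDr mulrA; apply: polar_ext (polar_cons (a * b) k ip IH) => z _.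
  by rewrite mulrDr mulrA.
- by apply: polar_ext IH => z oz; rewrite NE.
Qed.

Lemma polar_sum (I : Type) (s : seq I) (N : I -> C -> C) (r : I -> C) :
  (forall i, polar (N i) (r i)) ->
  polar (fun z => \sum_(i <- s) N i z) (\sum_(i <- s) r i).
Proof.
move=> Fr; elim: s => [|i s IH].
  by rewrite big_nil; apply: polar_ext polar_zero => z _; rewrite big_nil.
rewrite big_cons; apply: polar_ext (polarD (Fr i) IH) => z _.
by rewrite big_cons.
Qed.

Lemma polar_pole_part p k : inside p -> polar (pole_part p k) (k == 0)%:R.
Proof.
move=> ip; have := polar_cons 1 k ip polar_zero; rewrite mul1r addr0.
by apply: polar_ext => z _; rewrite mul1r addr0.
Qed.

(** A product of polar parts decays at infinity like [z ^- 2]; algebraically, partial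
  fractions move its poles apart two at a time. *)
Lemma polar_pole_partM p q k l : inside p -> inside q ->
  polar (fun z => pole_part p k z * pole_part q l z) 0.
Proof.
move=> ip iq; have [<-|pq] := eqVneq p q.
  apply: polar_ext (polar_pole_part (k + l).+1 ip) => z _.
  by rewrite /pole_part -exprD addSn addnS.
have pq0 : p - q != 0 by rewrite subr_eq0.
have split k1 l1 z : on_contour z -> pole_part p k1 z * pole_part q l1 z =
    (p - q)^-1 * (pole_part p k1 z * (z - q)^-1 ^+ l1 - (z - p)^-1 ^+ k1 * pole_part q l1 z).
  move=> oz; have zp := inside_neq0 ip oz; have zq := inside_neq0 iq oz.
  have e : (z - p)^-1 * (z - q)^-1 = (p - q)^-1 * ((z - p)^-1 - (z - q)^-1).
    by field; rewrite zp zq pq0.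
  rewrite /pole_part !exprSr; set u := _ ^+ k1; set v := _ ^+ l1.
  transitivity (u * v * ((z - p)^-1 * (z - q)^-1)); first by ring.
  by rewrite e; ring.
have [n] := ubnP (k + l); elim: n k l => [|n IH] k l //; rewrite ltnS => kl.
have step N1 N2 r : polar N1 r -> polar N2 r ->
    (forall z, on_contour z -> pole_part p k z * pole_part q l z = (p - q)^-1 * (N1 z - N2 z)) ->
    polar (fun z => pole_part p k z * pole_part q l z) 0.
  move=> h1 h2 e; have := polarZ (p - q)^-1 (polarD h1 (polarZ (-1) h2)).
  rewrite mulN1r subrr mulr0; apply: polar_ext => z oz.
  by rewrite e// mulN1r.
case: k l kl step => [|k] [|l] kl step.
- apply: (step _ _ _ (polar_pole_part 0 ip) (polar_pole_part 0 iq)) => z oz.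
  by rewrite split// !expr0 mul1r mulr1.
- apply: (step _ _ _ (IH 0%N l _) (polar_pole_part l.+1 iq)) => [|z oz].
    by rewrite add0n in kl *; exact: leq_trans kl.
  by rewrite split// expr0 mul1r.
- apply: (step _ _ _ (polar_pole_part k.+1 ip) (IH k 0%N _)) => [|z oz].
    by rewrite !addn0 in kl *.
  by rewrite split// expr0 mulr1.
- apply: (step _ _ _ (IH k.+1 l _) (IH k l.+1 _)) => [||z oz].
  + by rewrite addnS in kl *.
  + by rewrite addSn in kl *.
  by rewrite split.
Qed.

Lemma polarM N N' r r' : polar N r -> polar N' r' -> polar (fun z => N z * N' z) 0.
Proof.
move=> pN pN'; elim: pN => [|a p k {}N {}r ip _ IH|{}N N1 {}r NE _ IH].
- by apply: polar_ext polar_zero => z _; rewrite mul0r.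
- suff h : polar (fun z => pole_part p k z * N' z) 0.
    have := polarD (polarZ a h) IH; rewrite mulr0 addr0.
    by apply: polar_ext => z _; rewrite mulrDl mulrA.
  elim: pN' {IH} => [|b q l {}N' {}r' iq _ IH|{}N' N1 {}r' NE _ IH].
  + by apply: polar_ext polar_zero => z _; rewrite mulr0.
  + have := polarD (polarZ b (polar_pole_partM k l ip iq)) IH; rewrite mulr0 addr0.
    by apply: polar_ext => z _; rewrite mulrDr mulrCA.
  + by apply: polar_ext IH => z oz; rewrite NE.
- by apply: polar_ext IH => z oz; rewrite NE.
Qed.

(** The value at infinity of [z * N z] is the residue of [N]. *)
Lemma polar_mulz N r : polar N r -> exists r', polar (fun z => z * N z - r) r'.
Proof.
elim=> [|a p k {}N {}r ip _ [r' IH]|{}N N1 {}r NE _ [r' IH]].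
- by exists 0; apply: polar_ext polar_zero => z _; rewrite mulr0 subr0.
- have [s h] : exists s, polar (fun z => z * pole_part p k z - (k == 0)%:R) s.
    case: k => [|k].
      have h := polarZ p (polar_pole_part 0 ip); exists (p * 1).
      apply: polar_ext h => z oz; have zp := inside_neq0 ip oz.
      by rewrite /pole_part expr1 eqxx mulr1n; field.
    have h := polarD (polarZ p (polar_pole_part k.+1 ip)) (polar_pole_part k ip).
    eexists; apply: polar_ext h => z oz; have zp := inside_neq0 ip oz.
    rewrite /= subr0 /pole_part (exprS _ k.+1); set u := _ ^+ k.+1.
    by field.
  exists (a * s + r'); apply: polar_ext (polarD (polarZ a h) IH) => z oz.
  by ring.
- by exists r'; apply: polar_ext IH => z oz; rewrite NE.
Qed.

Lemma horner_pole_part P p z : inside p -> on_contour z ->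
  P.[z] * (z - p)^-1 = (P %/ ('X - p%:P)).[z] + P.[p] * pole_part p 0 z.
Proof.
move=> ip oz; have zp := inside_neq0 ip oz.
rewrite {1}(divp_eq P ('X - p%:P)) modp_XsubC !hornerE /pole_part expr1.
by rewrite mulrDl mulfK.
Qed.

Lemma has_res_horner_pole P p : inside p -> has_res (fun z => P.[z] * (z - p)^-1) P.[p].
Proof.
move=> ip; have := has_resD (has_res_poly (P %/ ('X - p%:P)))
  (has_resZ P.[p] (has_res_pole_part 0 ip)).
by rewrite add0r mulr1; apply: eq_has_res => z oz; exact: horner_pole_part.
Qed.

Lemma has_res_coef P k : inside 0 -> has_res (fun z => P.[z] * pole_part 0 k z) P`_k.
Proof.
move=> i0; elim: k P => [|k IH] P.
  have := has_res_horner_pole P i0; rewrite horner_coef0.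
  by apply: eq_has_res => z _; rewrite /pole_part expr1.
elim/poly_ind: P => [|P a _].
  by rewrite coef0; apply: eq_has_res has_res0 => z _; rewrite horner0 mul0r.
have := has_resD (IH P) (has_resZ a (has_res_pole_part k.+1 i0)).
rewrite mulr0 addr0 coefD coefMX coefC /= addr0; apply: eq_has_res => z oz.
have e : z * pole_part 0 k.+1 z = pole_part 0 k z.
  by have := inside_neq0 i0 oz; rewrite /pole_part subr0 (exprS _ k.+1) => z0; rewrite mulVKf.
by rewrite -e hornerD hornerMX hornerC; ring.
Qed.

Variables (m : nat) (h nu : 'I_m -> C).
Hypothesis inside_h : forall j, inside (h j).
Hypothesis inside_0 : inside 0.

Local Notation Q := (free_appell h nu).
Local Notation L := (source_int h nu).

(** The inverse of the subordination function: the Stieltjes transform [G] of the limiting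
  eigenvalue distribution satisfies [w (x - G x) = x]. *)
Definition inv_subordination z : C := z + \sum_(j < m) nu j / (z - h j).
Local Notation w := inv_subordination.

Definition deriv_inv_subordination z : C := 1 - \sum_(j < m) nu j * pole_part (h j) 1 z.
Local Notation w' := deriv_inv_subordination.

Lemma inv_subordinationE z : w z = z + \sum_(j < m) nu j * pole_part (h j) 0 z.
Proof. by rewrite /w; under [in RHS]eq_bigr do rewrite /pole_part expr1. Qed.

Let w'' z : C := \sum_(j < m) nu j * (2 * pole_part (h j) 2 z).

Lemma cdiff_inv_subordination : cdiff_on_contour w w'.
Proof.
move=> z oz; have h1 j : cdiff (fun y => nu j / (y - h j)) z (- (nu j * pole_part (h j) 1 z)).
  have := cdiffM (@cdiff_cst _ (nu j) z) (cdiff_pole_part 0 (inside_h j) oz).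
  rewrite (_ : (fun y => nu j * _) = (fun y => nu j / (y - h j))); last first.
    by apply/funext => y; rewrite /pole_part expr1.
  by move/cdiff_eq; apply; rewrite mul0r add0r mulN1r mulrN.
apply: (cdiff_eq (cdiffD (@cdiff_id _ z) (cdiff_sum _ h1))).
by rewrite /w' sumrN.
Qed.

Let cdiff_w' : cdiff_on_contour w' w''.
Proof.
move=> z oz.
have h1 j : cdiff (fun y => nu j * pole_part (h j) 1 y) z (nu j * (- 2 * pole_part (h j) 2 z)).
  have := cdiffM (@cdiff_cst _ (nu j) z) (cdiff_pole_part 1 (inside_h j) oz).
  by move/cdiff_eq; apply; rewrite mul0r add0r.
have -> : w' = (fun y => 1 + - 1 * \sum_(j < m) nu j * pole_part (h j) 1 y).
  by apply/funext => y; rewrite mulN1r.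
apply: (cdiff_eq (cdiffD (@cdiff_cst _ 1 z)
  (cdiffM (@cdiff_cst _ (- 1) z) (cdiff_sum _ h1)))).
rewrite mul0r !add0r mulN1r -sumrN; apply: eq_bigr => j _.
by rewrite -mulrN mulNr opprK.
Qed.

Lemma has_res_parts F F' F'' G G' G'' r : cdiff_on_contour F F' -> cdiff_on_contour F' F'' ->
  cdiff_on_contour G G' -> cdiff_on_contour G' G'' ->
  has_res (fun z => F z * G' z) r -> has_res (fun z => F' z * G z) (- r).
Proof.
move=> dF dF' dG dG' FG.
have FG0 : has_res (fun z => F' z * G z + F z * G' z) 0.
  apply: (has_res_derive (F := fun z => F z * G z)
    (F'' := fun z => (F'' z * G z + F' z * G' z) + (F' z * G' z + F z * G'' z))).
    by move=> z oz; exact: cdiffM (dF z oz) (dG z oz).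
  move=> z oz; exact: cdiffD (cdiffM (dF' z oz) (dG z oz)) (cdiffM (dF z oz) (dG' z oz)).
have := has_resD FG0 (has_resZ (- 1) FG); rewrite add0r mulN1r.
by apply: eq_has_res => z _; ring.
Qed.

Let cdiff_poly P : cdiff_on_contour (fun z => P.[z]) (fun z => P^`().[z]).
Proof.
by move=> z _; apply: (cdiff_eq (cdiff_horner P (@cdiff_id _ z))); rewrite mulr1.
Qed.

Let cdiff_fw P : cdiff_on_contour (fun z => P.[w z]) (fun z => P^`().[w z] * w' z).
Proof. by move=> z oz; exact: cdiff_horner (cdiff_inv_subordination oz). Qed.

Let cdiff_fw' P : cdiff_on_contour (fun z => P^`().[w z] * w' z)
  (fun z => P^`(2).[w z] * w' z * w' z + P^`().[w z] * w'' z).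
Proof. by move=> z oz; exact: cdiffM (cdiff_fw _ oz) (cdiff_w' oz). Qed.

Lemma horner_mul_inv_subordination P z : on_contour z ->
  P.[z] * w z = ('X * P + source_quot h nu P).[z] +
    \sum_(j < m) nu j * P.[h j] * pole_part (h j) 0 z.
Proof.
move=> oz; rewrite /w hornerD hornerM hornerX /source_quot horner_sum.
rewrite -addrA -big_split mulrDr mulr_sumr [P.[z] * z]mulrC; congr (_ + _).
apply: eq_bigr => j _; rewrite hornerZ /= mulrCA horner_pole_part//; ring.
Qed.

(** The polynomial part of [w ^+ q * w'] is [free_appell q]; the rest is polar, with
  residue zero, as [w ^+ q * w'] has a primitive. *)
Lemma free_appell_polar (q : nat) : exists2 N, polar N 0 &
  forall z, on_contour z -> w z ^+ q * w' z = (Q q).[z] + N z.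
Proof.
elim: q => [|q [N pN NE]].
  exists (fun z => - 1 * \sum_(j < m) nu j * pole_part (h j) 1 z); last first.
    by move=> z _; rewrite expr0 mul1r mulN1r hornerC.
  rewrite -[X in polar _ X](mulr0 (-1)); apply: polarZ.
  rewrite -[X in polar _ X](@big1_eq _ 0 +%R _ (index_enum 'I_m) xpredT).
  by apply: polar_sum => j; rewrite -[X in polar _ X](mulr0 (nu j)); apply: polarZ;
    exact: (polar_pole_part 1 (inside_h j)).
pose N1 z := \sum_(j < m) nu j * (Q q).[h j] * pole_part (h j) 0 z.
have pN1 : polar N1 (\sum_(j < m) nu j * (Q q).[h j] * 1).
  by apply: polar_sum => j; apply: polarZ; exact: (polar_pole_part 0 (inside_h j)).
have [r' pN2] := polar_mulz pN.
have pN3 : polar (fun z => (\sum_(j < m) nu j * pole_part (h j) 0 z) * N z) 0.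
  apply: polarM pN; apply: polar_sum => j; apply: polarZ.
  exact: (polar_pole_part 0 (inside_h j)).
have pN' := polarD pN1 (polarD pN2 pN3); set r := (X in polar _ X) in pN'.
have E z : on_contour z -> w z ^+ q.+1 * w' z = (Q q.+1).[z] +
    (N1 z + ((z * N z - 0) + (\sum_(j < m) nu j * pole_part (h j) 0 z) * N z)).
  move=> oz; have wN : w z * N z = z * N z + (\sum_(j < m) nu j * pole_part (h j) 0 z) * N z.
    by rewrite -mulrDl inv_subordinationE.
  by rewrite exprS -mulrA NE// mulrDr [w z * _]mulrC horner_mul_inv_subordination// wN subr0 -!addrA.
suff r0 : r = 0 by eexists; [rewrite -r0; exact: pN'|exact: E].
have h1 : has_res (fun z => w z ^+ q.+1 * w' z) (0 + r).
  by apply: eq_has_res (has_resD (has_res_poly (Q q.+1)) (polar_has_res pN')).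
apply: (@has_res_unique (fun z => w z ^+ q.+1 * w' z)).
  by move: h1; rewrite add0r.
pose P : {poly C} := q.+2%:R^-1 *: 'X^(q.+2).
have PE z : P^`().[w z] = w z ^+ q.+1.
  rewrite derivZ derivXn hornerZ hornerMn hornerXn /=.
  by rewrite mulrnAr -mulrnAl -[X in X * _]mulr_natr mulVf ?mul1r// pnatr_eq0.
have := has_res_derive (cdiff_fw P) (cdiff_fw' P).
by apply: eq_has_res => z _; rewrite PE.
Qed.

(** Induction on [q] for all [k], by [Q q.+1 = w * Q q - N] with [N] polar and
  simple poles at the [h j]. *)
Lemma has_res_free_appell (q k : nat) :
  has_res (fun z => (Q q).[z] * (w z ^+ k * w' z)) (- \sum_(i < q) L (Q i * Q (q - i.+1 + k))).
Proof.
elim: q k => [|q IH] k.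
  have [N pN NE] := free_appell_polar k.
  rewrite big_ord0 oppr0 -[X in has_res _ X]addr0.
  apply: eq_has_res (has_resD (has_res_poly (Q k)) (polar_has_res pN)) => z oz.
  by rewrite NE//= hornerC mul1r.
have h1 j : has_res (fun z => (z - h j)^-1 * (w z ^+ k * w' z)) (Q k).[h j].
  have [N pN NE] := free_appell_polar k.
  have := polar_has_res (polarM pN (polar_pole_part 0 (inside_h j))).
  move=> /(has_resD (has_res_horner_pole (Q k) (inside_h j))); rewrite addr0.
  apply: eq_has_res => z oz; rewrite NE// /pole_part expr1; ring.
have := has_resD (IH k.+1) (has_resZ (- 1)
  (has_res_sum (index_enum 'I_m) (fun j => has_resZ (nu j * (Q q).[h j]) (h1 j)))).
have -> : - (\sum_(i < q) L (Q i * Q (q - i.+1 + k.+1))) +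
    - 1 * \sum_(j < m) nu j * (Q q).[h j] * (Q k).[h j] =
    - \sum_(i < q.+1) L (Q i * Q (q.+1 - i.+1 + k)).
  have -> : \sum_(j < m) nu j * (Q q).[h j] * (Q k).[h j] = L (Q q * Q k).
    by apply: eq_bigr => j _; rewrite hornerM mulrA.
  have -> : \sum_(i < q) L (Q i * Q (q - i.+1 + k.+1)) =
      \sum_(i < q) L (Q i * Q (q.+1 - i.+1 + k)).
    apply: eq_bigr => i _; have -> // : (q - i.+1 + k.+1 = q.+1 - i.+1 + k)%N.
    by have := ltn_ord i; lia.
  by rewrite mulN1r -opprD big_ord_recr /= subnn add0n.
apply: eq_has_res => z oz.
have -> : (Q q.+1).[z] = (Q q).[z] * w z - \sum_(j < m) nu j * (Q q).[h j] * pole_part (h j) 0 z.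
  by rewrite horner_mul_inv_subordination// addrK.
rewrite mulrBl exprS mulN1r mulr_suml; congr (_ - _); first by ring.
by apply: eq_bigr => j _; rewrite /pole_part expr1; ring.
Qed.

Variable f : {poly C}.

Lemma horner_deriv_coef P z :
  P^`().[z] = \sum_(b < size P) b%:R * P`_b * z ^+ b.-1.
Proof.
rewrite horner_poly; case: (size P) => [|n]; first by rewrite !big_ord0.
rewrite [RHS]big_ord_recl mul0r mul0r add0r; apply: eq_bigr => i _ /=.
by rewrite /bump /= add1n mulr_natl.
Qed.

(** The functional that stands for [res] in the recursion of the covariances. *)
Definition res_test P : C := residue (fun z => P.[z] * f.[w z]).

Let cdiff_test P : cdiff_on_contour (fun z => P.[z] * f.[w z])
  (fun z => P^`().[z] * f.[w z] + P.[z] * (f^`().[w z] * w' z)).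
Proof. by move=> z oz; exact: cdiffM (cdiff_poly P oz) (cdiff_fw f oz). Qed.

Lemma has_res_test P : has_res (fun z => P.[z] * f.[w z]) (res_test P).
Proof. exact: residue_has_res (cdiff_test P). Qed.

Lemma res_testD P1 P2 : res_test (P1 + P2) = res_test P1 + res_test P2.
Proof.
apply: has_resE; apply: eq_has_res (has_resD (has_res_test P1) (has_res_test P2)) => z _.
by rewrite hornerD mulrDl.
Qed.

Lemma res_testZ (a : C) P : res_test (a *: P) = a * res_test P.
Proof.
apply: has_resE; apply: eq_has_res (has_resZ a (has_res_test P)) => z _.
by rewrite hornerZ mulrA.
Qed.

Lemma res_test_deriv (q : nat) :
  res_test (Q q)^`() = L (conv Q (cov_source h nu f) q).
Proof.
apply: has_resE.
pose r := \sum_(b < size f) b%:R * f`_b * - \sum_(i < q) L (Q i * Q (q - i.+1 + b.-1)).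
have -> : L (conv Q (cov_source h nu f) q) = - r.
  rewrite /conv source_int_sum /r -sumrN.
  under [RHS]eq_bigr do rewrite mulrN opprK mulr_sumr.
  rewrite [RHS]exchange_big /=; apply: eq_bigr => i _.
  rewrite /cov_source mulr_sumr source_int_sum; apply: eq_bigr => b _.
  rewrite -scalerAr source_intZ; case: (b : nat) => [|b']; first by rewrite !mul0r.
  by rewrite addnS.
apply: (has_res_parts (cdiff_poly (Q q)) (cdiff_poly _) (cdiff_fw f) (cdiff_fw' f)).
apply: eq_has_res (has_res_sum (index_enum 'I_(size f))
  (fun b => has_resZ (b%:R * f`_b) (has_res_free_appell q b.-1))) => z oz.
rewrite horner_deriv_coef mulr_suml mulr_sumr; apply: eq_bigr => b _; ring.
Qed.

(** The polynomial part of the derivative of [f \o w], by [deriv_test_polar]. *)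
Definition deriv_test_poly : {poly C} := \sum_(b < size f) f`_b *: index_deriv Q b.

Lemma res_test_deriv_test :
  res_test deriv_test_poly = \sum_(b < size f) f`_b * res_test (index_deriv Q b).
Proof.
have r0 : res_test 0 = 0 by have := res_testZ 0 0; rewrite scale0r mul0r.
by rewrite (big_morph _ res_testD r0); apply: eq_bigr => b _; rewrite res_testZ.
Qed.

Lemma deriv_test_polar : exists2 N, polar N 0 &
  forall z, on_contour z -> f^`().[w z] * w' z = deriv_test_poly.[z] + N z.
Proof.
have /choice[N NE] : forall b : nat, exists N, polar N 0 /\
    forall z, on_contour z -> w z ^+ b * w' z = (Q b).[z] + N z.
  by move=> b; have [N pN NE] := free_appell_polar b; exists N.
exists (fun z => \sum_(b < size f) b%:R * f`_b * N b.-1 z).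
  rewrite -[X in polar _ X](@big1_eq _ 0 +%R _ (index_enum 'I_(size f)) xpredT).
  apply: polar_sum => b; rewrite -[X in polar _ X](mulr0 (b%:R * f`_b)); apply: polarZ.
  exact: (NE _).1.
move=> z oz; rewrite horner_deriv_coef mulr_suml /deriv_test_poly horner_sum -big_split.
apply: eq_bigr => b _ /=; rewrite -[LHS]mulrA (NE _).2// hornerZ.
have -> : (index_deriv Q b).[z] = b%:R * (Q b.-1).[z].
  by rewrite /index_deriv mulr_natl hornerMn mulr_natl.
ring.
Qed.

(** After integration by parts the polar part of the derivative of [f \o w] is multiplied
  by a polar function, and does not contribute. *)
Lemma residue_pole_test (l : nat) :
  l.+1%:R * residue (fun z => f.[w z] * pole_part 0 l.+1 z) = deriv_test_poly`_l.
Proof.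
have dP k := cdiff_pole_part k inside_0.
have dG : cdiff_on_contour (fun z => - l.+1%:R * pole_part 0 l.+1 z)
    (fun z => - l.+1%:R * (- l.+2%:R * pole_part 0 l.+2 z)).
  move=> z oz; apply: (cdiff_eq (cdiffM (@cdiff_cst _ (- l.+1%:R) z) (dP l.+1 z oz))).
  by rewrite mul0r add0r.
have h1 : has_res (fun z => pole_part 0 l z * (f^`().[w z] * w' z)) deriv_test_poly`_l.
  have [N pN NE] := deriv_test_polar.
  have := polar_has_res (polarM pN (polar_pole_part l inside_0)).
  move=> /(has_resD (has_res_coef deriv_test_poly l inside_0)); rewrite addr0.
  by apply: eq_has_res => z oz; rewrite NE//; ring.
have h2 := has_res_parts (dP l) dG (cdiff_fw f) (cdiff_fw' f) h1.
have l0 : l.+1%:R != 0 :> C by rewrite pnatr_eq0.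
rewrite (@has_resE _ (l.+1%:R^-1 * deriv_test_poly`_l)) ?mulVKf//.
have := has_resZ (- l.+1%:R^-1) h2; rewrite mulrNN; apply: eq_has_res => z _.
by field.
Qed.

Lemma res_test_deriv_test_coef (n : nat) : (size deriv_test_poly <= n)%N ->
  res_test deriv_test_poly = \sum_(l < n) l.+1%:R *
    residue (fun z => f.[w z] * pole_part 0 l.+1 z) * residue (fun z => f.[w z] * z ^+ l).
Proof.
move=> sn; apply: has_resE.
have h1 l : has_res (fun z => f.[w z] * z ^+ l) (residue (fun z => f.[w z] * z ^+ l)).
  have -> : (fun z => f.[w z] * z ^+ l) = (fun z => ('X^l : {poly C}).[z] * f.[w z]).
    by apply/funext => z; rewrite hornerXn mulrC.
  exact: has_res_test.
apply: eq_has_res (has_res_sum (index_enum 'I_n) (fun l : 'I_n => has_resZ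
  (l.+1%:R * residue (fun z => f.[w z] * pole_part 0 l.+1 z)) (h1 l))) => z oz.
rewrite (horner_coef_wide _ sn) mulr_suml; apply: eq_bigr => l _.
by rewrite residue_pole_test; ring.
Qed.

End Residues.

(** * Passage from complex to real limits *)

Section ComplexLimits.
Variable R : realType.
Local Notation C := R[i].
Implicit Types (u : nat -> C) (l : C).

Lemma arch_complex (e : C) : 0 < e -> \forall n \near \oo, n%:R^-1 < e.
Proof.
case: e => a b; rewrite ltcE/= => /andP[/eqP -> a0]; near=> n.
have -> : (n%:R^-1 : C) = (n%:R^-1 : R)%:C by rewrite fmorphV rmorph_nat.
rewrite ltcE /= eqxx /=.
have n0 : 0 < (n%:R : R) by rewrite ltr0n; near: n; exists 1%N.
rewrite -(invrK a) ltf_pV2 ?posrE ?invr_gt0//.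
by near: n; exact: nbhs_infty_gtr.
Unshelve. all: by end_near. Qed.

Lemma cvg_real_complex (v : nat -> R) (a : R) : v n @[n --> \oo] --> a ->
  (v n)%:C @[n --> \oo] --> (a%:C : C^o).
Proof.
move=> /(@cvgrPdist_lt _ R^o) va; apply/(@cvgrPdist_lt _ C^o) => -[e b].
rewrite ltcE/= => /andP[/eqP -> e0]; near=> n.
rewrite -rmorphB /= normc_def /= expr0n /= addr0 sqrtr_sqr ltcE /= eqxx /=.
by near: n; exact: va.
Unshelve. all: by end_near. Qed.

Lemma cvg_complex_Re u l : u n @[n --> \oo] --> (l : C^o) ->
  complex.Re (u n) @[n --> \oo] --> complex.Re l.
Proof.
move=> /(@cvgrPdist_lt _ C^o) ul; apply/(@cvgrPdist_lt _ R^o) => e e0; near=> n.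
have : `|l - u n| < e%:C by near: n; apply: ul; rewrite ltcR.
move=> /(le_lt_trans (normc_ge_Re _)); rewrite ltcR.
have -> // : complex.Re (l - u n) = complex.Re l - complex.Re (u n).
by case: (l) => ? ?; case: (u n).
Unshelve. all: by end_near. Qed.

Lemma cvg_complex_Im u l : u n @[n --> \oo] --> (l : C^o) ->
  complex.Im (u n) @[n --> \oo] --> complex.Im l.
Proof.
have ReiE (z : C) : complex.Re (- 'i * z) = complex.Im z.
  by case: z => a b /=; rewrite !(mul0r, oppr0, mulN1r, opprK, sub0r, mulNr).
move=> ul; rewrite -ReiE; under eq_fun do rewrite -ReiE.
apply: cvg_complex_Re; apply: (@cvgMr C); exact: ul.
Qed.

Lemma cvg_complex_real u (v : nat -> R) l : (forall n, u n = (v n)%:C) ->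
  u n @[n --> \oo] --> (l : C^o) ->
  l = (complex.Re l)%:C /\ v n @[n --> \oo] --> complex.Re l.
Proof.
move=> uv ul; have h1 := cvg_complex_Im ul; have h2 := cvg_complex_Re ul.
rewrite (_ : (fun n => _) = fun=> 0) in h1; last by apply/funext => n; rewrite uv.
rewrite (_ : (fun n => _) = v) in h2; last by apply/funext => n; rewrite uv.
split=> //; apply/eqP; rewrite eq_complex /= eqxx /=.
by apply/eqP; apply: (cvg_unique _ h1); [exact: Rhausdorff|exact: cvg_cst].
Qed.

End ComplexLimits.

(** * Linear statistics of the eigenvalues *)

Section GUEMoments.
Variables (R : realType) (n : nat) (D : 'rV[R]_n).
Local Notation C := R[i].
Local Notation N := (n * n)%N.

Definition source_mx : 'M[C]_n := map_mx (real_complex R) (diag_mx D).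

Lemma gue_momS (k : 'I_N) (a : nat) : gue_mom D k a.+1 =
  (gue_beta D k / (2 * gue_alpha R k))%:C * gue_mom D k a
  + ((2 * gue_alpha R k)^-1)%:C * (a%:R * gue_mom D k a.-1).
Proof.
rewrite /gue_mom gauss_momentS ?gue_alpha_gt0//.
rewrite -(rmorph_nat (real_complex R)) -!rmorphM -rmorphD; congr (_%:C).
by rewrite mulrDl !mulrA.
Qed.

Lemma gue_mean i j :
  (gue_beta D (mxvec_index i j) / (2 * gue_alpha R (mxvec_index i j)))%:C = source_mx i j.
Proof.
rewrite /gue_beta /gue_alpha !mxvecE !mxE; congr (_%:C).
have n0 : (n%:R : R) != 0 by rewrite pnatr_eq0; case: (n) i => // -[].
by case: eqP => _; rewrite ?mulr1n ?mulr0n; field.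
Qed.

Lemma gue_var (i j : 'I_n) : ((2 * gue_alpha R (mxvec_index i j))^-1)%:C =
  if i == j then n%:R^-1 else 2^-1 * n%:R^-1 :> C.
Proof.
have n0 : (n%:R : R) != 0 by rewrite pnatr_eq0; case: (n) i => // -[].
rewrite /gue_alpha !mxvecE !mxE; case: eqP => _.
  by rewrite -(rmorph_nat (real_complex R) n) -fmorphV; congr (_%:C); field.
rewrite -(rmorph_nat (real_complex R) n) -(rmorph_nat (real_complex R) 2) -!fmorphV -rmorphM.
by congr (_%:C); field.
Qed.

Lemma source_mx_diag i j : i != j -> source_mx i j = 0.
Proof. by move=> /negbTE ij; rewrite !mxE ij mulr0n. Qed.

Lemma gue_entry_ibp (a b : 'I_n) (x : mpoly N C) :
  gue_expect D ((generic_herm R n a b - (source_mx a b)%:A) * x) =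
  n%:R^-1 * gue_expect D (entry_deriv b a x).
Proof. exact: (gue_ibp gue_momS gue_mean source_mx_diag gue_var). Qed.

Definition gue_trace (p q : nat) : mpoly N C := mixed_trace (generic_herm R n) source_mx p q.

Definition gue_word_deriv (p q : nat) (x : mpoly N C) : mpoly N C :=
  word_deriv (generic_herm R n) source_mx (@entry_deriv R n) p q x.

Lemma gue_eval_trace (t : N.-tuple (measurableTypeR R)) (q : nat) :
  gue_eval t (gue_trace 0 q) = \tr (hermitian_of_coords t ^+ q).
Proof.
pose ev : {rmorphism mpoly N C -> C} := meval (fun k => (tnth t k)%:C).
have HE : map_mx ev (generic_herm R n) = hermitian_of_coords t.
  have evX i j : ev (coord R i j) = (tnth t (mxvec_index i j))%:C by exact: mevalXU.
  apply/matrixP => i j; rewrite mxE [generic_herm _ _ _ _]mxE hermE.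
  case: ltngtP => [ij|ij|/ord_inj ->]; last exact: evX.
    rewrite rmorphD /= [X in _ + X]mevalZ !evX.
    by apply/eqP; rewrite eq_complex /= !(mul0r, mul1r, mulr0, addr0, add0r, sub0r, oppr0, addr0) !eqxx.
  rewrite rmorphB /= [X in _ - X]mevalZ !evX.
  by apply/eqP; rewrite eq_complex /= !(mul0r, mul1r, mulr0, addr0, add0r, sub0r, oppr0, addr0) !eqxx.
rewrite /gue_trace /mixed_trace expr0 mul1r -HE -rmorphXn /gue_eval.
by rewrite -[LHS]/(ev _) /mxtrace rmorph_sum; apply: eq_bigr => i _; rewrite mxE.
Qed.

Variable f : {poly R}.
Local Notation fC := (map_poly (real_complex R) f).

Definition gue_stat : mpoly N C := \sum_(b < size fC) fC`_b *: gue_trace 0 b.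

Lemma gue_eval_stat (t : N.-tuple (measurableTypeR R)) (x : 'I_n -> R) :
  are_eigenvalues (hermitian_of_coords t) x ->
  gue_eval t gue_stat = (\sum_(i < n) f.[x i])%:C.
Proof.
move=> xt; rewrite /gue_stat /gue_eval raddf_sum rmorph_sum /=.
transitivity (\sum_(b < size fC) \sum_(i < n) fC`_b * (x i)%:C ^+ b).
  apply: eq_bigr => b _; rewrite mevalZ -[meval _ _]/(gue_eval t _) gue_eval_trace.
  by rewrite (mxtrace_exp_eigenvalues b xt) mulr_sumr.
rewrite exchange_big /=; apply: eq_bigr => i _.
by rewrite -[RHS](horner_map (real_complex R)) [RHS]horner_coef.
Qed.

Context d (Omega : measurableType d) (P : probability Omega R).
Variables (M : Omega -> 'M[C]_n) (x : Omega -> 'I_n -> R).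
Hypothesis M_gue : gue_external_source source_mx P M.
Hypothesis x_eig : forall w, are_eigenvalues (M w) (x w).

Lemma gue_expect1 : gue_expect D 1 = 1.
Proof.
have [T MT [c c0 dens]] := M_gue.
have [_ _ rE iE] := gue_expectE c0 dens 1.
apply/eqP; rewrite eq_complex -rE -iE /gue_eval /=.
under eq_Rintegral do rewrite meval1 /=; under [X in _ && (X == _)]eq_Rintegral do rewrite meval1 /=.
by rewrite !Rintegral_cst// mul0r mul1r [X in fine X]probability_setT !eqxx.
Qed.

Lemma has_cexp_realP (g : Omega -> R) (a : C) : has_cexp P setT (fun w => (g w)%:C) a ->
  P.-integrable setT (EFin \o g) /\ a = (\int[P]_w g w)%:C.
Proof.
move=> [/= h1 _ h2 h3]; split=> //; apply/eqP; rewrite eq_complex /= -h2 -h3 eqxx /=.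
by rewrite Rintegral_cst// mul0r.
Qed.

Let S w := \sum_(i < n) f.[x w i].

Definition centered_gue_stat : mpoly N C := gue_stat - (gue_expect D gue_stat)%:A.

(** [gue_eval] is a ring morphism, so that powers of the statistic are the values of
  powers of a polynomial, whose expectation is [gue_expect]. *)
Lemma gue_stat_moments :
  measurable_fun setT S /\
  forall r, P.-integrable setT (EFin \o (fun w => (S w - fine ('E_P[S])%E) ^+ r)) /\
    gue_expect D (centered_gue_stat ^+ r) =
      (\int[P]_w ((S w - fine ('E_P[S])%E) ^+ r))%:C.
Proof.
have [T MT [c c0 dens]] := M_gue.
have SE w : gue_eval (T w) gue_stat = (S w)%:C.
  by apply: gue_eval_stat; rewrite -MT.
have [iS eS] : P.-integrable setT (EFin \o S) /\ gue_expect D gue_stat = (\int[P]_w S w)%:C.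
  by apply: has_cexp_realP; apply: eq_has_cexp (gue_expectE c0 dens gue_stat).
have mS : measurable_fun setT S by apply/measurable_EFinP; exact: measurable_int iS.
split=> // r.
have eE : fine ('E_P[S])%E = \int[P]_w S w by rewrite unlock.
apply: has_cexp_realP; apply: eq_has_cexp (gue_expectE c0 dens (centered_gue_stat ^+ r)) => w.
have YE : gue_eval (T w) centered_gue_stat = (S w - fine ('E_P[S])%E)%:C.
  have -> : gue_eval (T w) centered_gue_stat =
      gue_eval (T w) gue_stat - gue_expect D gue_stat * gue_eval (T w) 1.
    by rewrite /gue_eval mevalB mevalZ.
  by rewrite SE /gue_eval meval1 mulr1 eS eE rmorphB.
by rewrite rmorphXn /= -YE /gue_eval rmorphXn.
Qed.

End GUEMoments.

(** * Convergence of the source and conclusion *)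

Section SourceLimit.
Variables (R : realType) (m : nat) (h : 'I_m -> R).
Hypothesis h_inj : injective h.

(** An entry of the source is exactly one of the [h j], as the multiplicities add up to
  the dimension. *)
Lemma sum_source n (k : 'I_m -> nat) (D : 'rV[R]_n) (F : R -> R) :
  (\sum_(j < m) k j)%N = n ->
  (forall j, #|[set i | D 0 i == h j]%SET| = k j) ->
  \sum_(i < n) F (D 0 i) = \sum_(j < m) (k j)%:R * F (h j).
Proof.
move=> kn Dk; pose s i := (\sum_(j < m) (D 0%R i == h j))%N.
have kE j : k j = (\sum_(i < n) (D 0%R i == h j))%N.
  by rewrite -Dk -sum1dep_card big_mkcond /=; apply: eq_bigr => i _; case: eqP.
have s1 i : (s i <= 1)%N.
  rewrite /s; case: (pickP (fun j => D 0 i == h j)) => [j /eqP Dj|noj].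
    rewrite (bigD1 j)//= Dj eqxx big1 ?addn0// => l lj.
    by case: eqP => // /h_inj jl; rewrite jl eqxx in lj.
  by rewrite big1// => j _; rewrite noj.
have sn : (\sum_(i < n) (1 - s i) = 0)%N.
  have : (\sum_(i < n) (1 - s i) + \sum_(i < n) s i = n)%N.
    rewrite -big_split /= (eq_bigr (fun=> 1%N)); last by move=> i _; rewrite subnK.
    by rewrite sum_nat_const card_ord muln1.
  have -> : (\sum_(i < n) s i = n)%N.
    by rewrite /s exchange_big /= -[RHS]kn; apply: eq_bigr => j _; rewrite kE.
  by move=> e; apply/eqP; rewrite -(eqn_add2r n) e.
have s1E i : s i = 1%N.
  move/eqP: sn; rewrite sum_nat_eq0 => /forallP/(_ i)/=; rewrite subn_eq0 => s1'.
  by apply/eqP; rewrite eqn_leq s1.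
transitivity (\sum_(i < n) \sum_(j < m) (D 0 i == h j)%:R * F (h j)).
  apply: eq_bigr => i _; have e : 1 = (s i)%:R :> R by rewrite s1E.
  rewrite -[LHS]mul1r [in LHS]e /s natr_sum mulr_suml.
  by apply: eq_bigr => j _; case: eqP => [<-//|_]; rewrite !mul0r.
rewrite exchange_big /=; apply: eq_bigr => j _.
by rewrite -mulr_suml kE natr_sum.
Qed.

Lemma mxtrace_source n (D : 'rV[R]_n) p :
  \tr (source_mx D ^+ p) = (\sum_(i < n) D 0 i ^+ p)%:C.
Proof.
have -> : source_mx D ^+ p = source_mx (\row_i (D 0 i ^+ p)).
  elim: p => [|p IH].
    by apply/matrixP => i j; rewrite expr0 !mxE; case: eqP => [->|].
  rewrite exprS IH -mulmxE /source_mx -map_mxM mul_diag_mx; congr (map_mx _ _).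
  by apply/matrixP => i j; rewrite !mxE exprS -mulrnAr.
by rewrite /mxtrace rmorph_sum; apply: eq_bigr => i _; rewrite !mxE eqxx.
Qed.

Lemma cvg_source_trace (nu : 'I_m -> R) (k : nat -> 'I_m -> nat) (D : forall n, 'rV[R]_n) p :
  (forall n, (\sum_(j < m) k n j)%N = n) ->
  (forall n j, #|[set i | D n 0 i == h j]%SET| = k n j) ->
  (forall j, (k n j)%:R / n%:R @[n --> \oo] --> nu j) ->
  (n%:R^-1 * \tr (source_mx (D n) ^+ p)) @[n --> \oo] -->
    (source_int (fun j => (h j)%:C) (fun j => (nu j)%:C) 'X^p : R[i]^o).
Proof.
move=> ks Dk kl.
have -> : (fun n => n%:R^-1 * \tr (source_mx (D n) ^+ p)) =
    (fun n => (\sum_(j < m) (k n j)%:R / n%:R * h j ^+ p)%:C).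
  apply/funext => n; rewrite mxtrace_source (sum_source (fun x => x ^+ p) (ks n) (Dk n)).
  rewrite -(rmorph_nat (real_complex R)) -fmorphV -rmorphM; congr (_%:C).
  by rewrite mulr_sumr; apply: eq_bigr => j _; rewrite mulrA [_^-1 * _]mulrC.
have -> : source_int (fun j => (h j)%:C) (fun j => (nu j)%:C) 'X^p =
    (\sum_(j < m) nu j * h j ^+ p)%:C.
  by rewrite rmorph_sum; apply: eq_bigr => j _; rewrite hornerXn rmorphM rmorphXn.
apply: cvg_real_complex; apply: cvg_sum_ord => j.
by apply: cvgM; [exact: kl|exact: cvg_cst].
Qed.

End SourceLimit.

Section NormalMoments.
Variable R : realType.

Lemma normal_moment_complex (s : R) r :
  normal_moment (s%:C : R[i]) r = (normal_moment s r)%:C.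
Proof.
suff [] : normal_moment (s%:C : R[i]) r = (normal_moment s r)%:C /\
  normal_moment (s%:C : R[i]) r.+1 = (normal_moment s r.+1)%:C by [].
elim: r => [//|r [IH1 IH2]]; split=> //.
rewrite -[LHS]/(r.+1%:R * s%:C * normal_moment s%:C r).
rewrite -[normal_moment s r.+2]/(r.+1%:R * s * normal_moment s r).
by rewrite IH1 !rmorphM rmorph_nat.
Qed.

End NormalMoments.

Section MethodOfMomentsNormal.
Variables (R : realType) (d : nat -> measure_display).
Variables (Omega : forall n, measurableType (d n)) (P : forall n, probability (Omega n) R).
Variable X : forall n, Omega n -> R.

Lemma cvg_in_distribution_moments (s : R) : 0 <= s ->
  (forall n, measurable_fun setT (@X n)) ->
  (forall n k, (P n).-integrable setT (EFin \o (fun w => X w ^+ k))) ->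
  (forall k, \int[P n]_w (X w ^+ k) @[n --> \oo] --> normal_moment s k) ->
  cvg_in_distribution P X (centered_normal s).
Proof.
move=> s0 mX iX cX; split=> // g cg [B gB].
pose XM n : {mfun Omega n >-> measurableTypeR R} :=
  @mfun_Sub _ _ (Omega n) (measurableTypeR R) (@X n) (mem_set (mX n)).
pose law n := distribution (P n) (XM n).
have mpow k : measurable_fun setT (EFin \o (fun y : measurableTypeR R => y ^+ k)).
  by apply/measurable_EFinP; exact: measurable_funX.
have moments k : cvg_int law (centered_normal s) (fun y => y ^+ k).
  split; last first.
  - rewrite (centered_normal_moment k s0).2.
    rewrite (_ : (fun n => _) = fun n => \int[P n]_w (X w ^+ k)); first exact: cX.
    apply/funext => n; rewrite /Rintegral; congr fine.
    by rewrite integral_distribution; [|exact: mpow|exact: iX].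
  - exact: (centered_normal_moment k s0).1.
  move=> n; apply/integrableP; split=> //.
  have /integrableP[_] := iX n k.
  by rewrite ge0_integral_distribution//; exact: measurableT_comp.
have growth t : t ^+ (2 * K) / (2 * K)`!%:R *
    \int[centered_normal s]_x (x ^+ (2 * K)) @[K --> \oo] --> (0 : R).
  rewrite (_ : (fun K => _) = fun K => t ^+ (2 * K) / (2 * K)`!%:R * normal_moment s (2 * K)).
    exact: normal_moment_growth.
  by apply/funext => K; rewrite (centered_normal_moment _ s0).2.
have [ilaw imu cvg_g] := @cvg_int_bounded R law (centered_normal s) moments growth g B cg gB.
have mg : measurable_fun setT (EFin \o (g : measurableTypeR R -> R)).
  by apply/measurable_EFinP; exact: continuous_measurable_fun.
have igX n : (P n).-integrable setT (EFin \o (fun w => g (X w))).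
  apply/integrableP; split.
    exact: (measurableT_comp mg (mX n)).
  have /integrableP[_] := ilaw n.
  by rewrite ge0_integral_distribution//; exact: measurableT_comp.
have -> : (fun n => \int[P n]_w (g (X w))%:E)%E = (fun n => (\int[law n]_y g y)%:E).
  apply/funext => n; rewrite /Rintegral fineK; last exact: (integrable_fin_num measurableT (ilaw n)).
  by rewrite integral_distribution; [|exact: mg|exact: igX].
have -> : (\int[centered_normal s]_x (g x)%:E)%E = (\int[centered_normal s]_x g x)%:E.
  by rewrite /Rintegral fineK//; exact: (integrable_fin_num measurableT imu).
by apply: cvg_EFin => //; exact: nearW.
Qed.

End MethodOfMomentsNormal.

Section LimitingVariance.
Variables (R : realType) (gamma : R -> R[i]).
Hypothesis gamma_contour : simple_closed_contour gamma.
Variables (m : nat) (h nu : 'I_m -> R) (f : {poly R}).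
Hypothesis gamma_h : forall j, ccw_around gamma (h j)%:C.
Hypothesis gamma_0 : ccw_around gamma 0.
Local Notation C := R[i].
Local Notation hC := (fun j => (h j)%:C).
Local Notation nuC := (fun j => (nu j)%:C).
Local Notation fC := (map_poly (real_complex R) f).
Local Notation fc := (fourier_coef h nu f gamma).
Local Notation w := (inv_subordination hC nuC).

Definition lim_stat_var : C := lim_var hC nuC fC (res_test gamma hC nuC fC).

Lemma fourier_coef_pos (l : nat) :
  fc l.+1%:Z = residue gamma (fun z => fC.[w z] * pole_part 0 l.+1 z).
Proof.
rewrite /fourier_coef /residue; congr (_ * contour_integral _ _); apply/funext => z.
by rewrite /pole_part subr0 exprVn -PoszD addn1.
Qed.

Lemma fourier_coef_neg (l : nat) :
  fc (- l.+1%:Z) = residue gamma (fun z => fC.[w z] * z ^+ l).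
Proof.
rewrite /fourier_coef /residue; congr (_ * contour_integral _ _); apply/funext => z.
have -> : - l.+1%:Z + 1 = - l%:Z by lia.
by rewrite -exprz_inv -exprnP exprVn invrK.
Qed.

(** The sum is eventually constant, as the Fourier coefficients of large positive index
  vanish. *)
Lemma cvg_fourier_sum :
  (\sum_(1 <= l < N) l%:R * fc l%:Z * fc (- l%:Z)) @[N --> \oo] --> (lim_stat_var : C^o).
Proof.
apply: (@cvg_near_cst _ C^o); near=> N.
have -> : \sum_(1 <= l < N) l%:R * fc l%:Z * fc (- l%:Z) =
  \sum_(l < N.-1) l.+1%:R * fc l.+1%:Z * fc (- l.+1%:Z).
  by rewrite big_add1 big_mkord.
have sN : (size (deriv_test_poly hC nuC fC) <= N.-1)%N.
  have : (size (deriv_test_poly hC nuC fC) < N)%N by near: N; exact: nbhs_infty_gt.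
  by case: (N).
rewrite /lim_stat_var /lim_var -(@res_test_deriv_test _ _ gamma_contour _ hC nuC gamma_h).
rewrite (@res_test_deriv_test_coef _ _ gamma_contour _ hC nuC gamma_h gamma_0 fC _ sN).
by apply: eq_bigr => l _; rewrite fourier_coef_pos fourier_coef_neg.
Unshelve. all: by end_near. Qed.

End LimitingVariance.

Section MomentsOfLinearStatistics.
Variables (R : realType) (m : nat) (h : 'I_m -> R) (h_inj : injective h).
Variables (nu : 'I_m -> R) (k : nat -> 'I_m -> nat).
Hypothesis k_sum : forall n, (\sum_(j < m) k n j)%N = n.
Hypothesis k_lim : forall j, (k n j)%:R / n%:R @[n --> \oo] --> nu j.
Variable D : forall n, 'rV[R]_n.
Hypothesis D_mult : forall n j, #|[set i | D n 0 i == h j]%SET| = k n j.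
Hypothesis E1 : forall n, gue_expect (D n) 1 = 1.
Variable f : {poly R}.
Variable gamma : R -> R[i].
Hypothesis gamma_contour : simple_closed_contour gamma.
Hypothesis gamma_h : forall j, ccw_around gamma (h j)%:C.
Local Notation C := R[i].
Local Notation A n := (mpoly (n * n) R[i]).

Let E n : {scalar A n} := prod_moment (gue_mom (D n)).

Lemma gue_loop_eq n p q (x : A n) :
  E n (gue_trace (D n) p q.+1 * x) = E n (gue_trace (D n) p.+1 q * x)
    + n%:R^-1 * \sum_(i < q) E n (gue_trace (D n) 0 i * gue_trace (D n) p (q - i.+1) * x)
    + n%:R^-1 * E n (gue_word_deriv (D n) p q x).
Proof.
apply: matrix_loop_eq.
- exact: entry_derivD.
- exact: entry_derivZ.
- exact: entry_derivM.
- exact: entry_deriv_herm.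
- exact: gue_entry_ibp.
Qed.

Lemma cvg_gue_stat_moment r : gue_expect (D n) (centered_gue_stat (D n) f ^+ r) @[n --> \oo] -->
  (normal_moment (lim_stat_var gamma h nu f) r : C^o).
Proof.
have YE n : centered_gue_stat (D n) f =
    lin_stat E (fun n => gue_trace (D n)) (map_poly (real_complex R) f) n.
  rewrite /lin_stat /centered_gue_stat /gue_stat -[gue_expect _ _]/(E n _).
  rewrite linear_sum scaler_suml -sumrB; apply: eq_bigr => b _.
  by rewrite /centered scalerBr scalerA -prod_momentZ.
rewrite (_ : (fun n => _) = fun n => E n (lin_stat E (fun n => gue_trace (D n))
  (map_poly (real_complex R) f) n ^+ r)); last by apply/funext => n; rewrite -YE.
apply: (@cvg_moment_lin_stat C (fun n => A n) _ E _ (fun n => gue_word_deriv (D n))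
  _ _ _ _ _ (fun n p => \tr (source_mx (D n) ^+ p))).
- exact: arch_complex.
- exact: E1.
- by move=> n p q x y; apply: word_derivD; exact: entry_derivD.
- by move=> n p q c x; apply: word_derivZ; exact: entry_derivZ.
- by move=> n p q x y; apply: word_derivM; exact: entry_derivM.
- move=> n p q b; apply: word_deriv_trace.
  + exact: entry_derivD.
  + exact: entry_derivZ.
  + exact: entry_derivM.
  + exact: entry_deriv_herm.
- by move=> n p; exact: mixed_trace_p0.
- by move=> n p q x; exact: gue_loop_eq.
- by move=> p; exact: (@cvg_source_trace _ _ h h_inj nu k D p k_sum D_mult k_lim).
- by move=> P1 P2; exact: res_testD.
- by move=> c P; exact: res_testZ.
- by move=> q; exact: res_test_deriv.
Qed.

End MomentsOfLinearStatistics.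

Theorem corollary5p1 (R : realType) (m : nat) (m_gt0 : (0 < m)%N)
  (h : 'I_m -> R) (h_inj : injective h)
  (k : nat -> 'I_m -> nat)
  (k_sum : forall n, (\sum_(j < m) k n j)%N = n)
  (k_path : forall n, exists jn : 'I_m, forall j, k n.+1 j = (k n j + (j == jn))%N)
  (nu : 'I_m -> R) (nu01 : forall j, 0 <= nu j <= 1)
  (nu_sum : \sum_(j < m) nu j = 1)
  (k_lim : forall j, (k n j)%:R / n%:R @[n --> \oo] --> nu j)
  (D : forall n, 'rV[R]_n)
  (D_mult : forall n j, #|[set i | D n 0 i == h j]%SET| = k n j)
  (d : nat -> measure_display) (Omega : forall n, measurableType (d n))
  (P : forall n, probability (Omega n) R)
  (M : forall n, Omega n -> 'M[R[i]]_n)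
  (M_gue : forall n,
    gue_external_source (map_mx (real_complex R) (diag_mx (D n))) (P n) (M n))
  (x : forall n, Omega n -> 'I_n -> R)
  (x_eig : forall n w, are_eigenvalues (M n w) (x n w))
  (f : {poly R})
  (gamma : R -> R[i]) (gamma_contour : simple_closed_contour gamma)
  (gamma_h : forall j, ccw_around gamma (h j)%:C)
  (gamma_0 : ccw_around gamma 0) :
  let S n w := \sum_(j < n) f.[x n w j] in
  let fc := fourier_coef h nu f gamma in
  exists s2 : R,
    [/\ 0 <= s2,
        (\sum_(1 <= l < N) l%:R * fc l%:Z * fc (- l%:Z)) @[N --> \oo] --> (s2%:C : R[i]^o) &
        cvg_in_distribution P (fun n w => S n w - fine ('E_(P n)[S n])%E)
          (centered_normal s2)].
Proof.
move=> S fc.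
have E1 n := gue_expect1 (M_gue n).
have mom n := gue_stat_moments f (M_gue n) (x_eig n).
pose s2C := lim_stat_var gamma h nu f.
pose Y n w := S n w - fine ('E_(P n)[S n])%E.
have cvgC r := @cvg_gue_stat_moment _ _ _ h_inj _ _ k_sum k_lim _ D_mult E1 f _ gamma_contour gamma_h r.
have momE r n : gue_expect (D n) (centered_gue_stat (D n) f ^+ r) = (\int[P n]_w (Y n w ^+ r))%:C.
  by have [_ /(_ r)[_]] := mom n.
have momR r := cvg_complex_real (momE r) (cvgC r).
have s2E : s2C = (complex.Re s2C)%:C.
  by have [] := momR 2; rewrite -/s2C /= !mul1r !mulr1.
set s2 := complex.Re s2C in s2E.
have cvgY r : \int[P n]_w (Y n w ^+ r) @[n --> \oo] --> normal_moment s2 r.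
  have [_] := momR r; rewrite -/s2C s2E normal_moment_complex; exact.
have s2_ge0 : 0 <= s2.
  have := cvgY 2; rewrite /= mul1r mulr1 => /cvgr_to_ge; apply.
  by apply: nearW => n; apply: Rintegral_ge0 => w _; exact: sqr_ge0.
exists s2; split=> //.
  by rewrite -s2E; exact: cvg_fourier_sum.
apply: cvg_in_distribution_moments => //.
- move=> n; have [mS _] := mom n; apply: measurable_funB => //; exact: measurable_cst.
- by move=> n r; have [_ /(_ r)[]] := mom n.
Qed.
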